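(* There exist $C^\infty$-diffeomorphisms $\varphi$ of the two-torus $\mathbb{T}^2$ with the following properties. (a) $\varphi$ is a skew product over some irrational rotation $R_\alpha:\mathbb{T}^1\to\mathbb{T}^1$, $x\mapsto x+\alpha \bmod 1$ (with $\alpha\in\mathbb{R}\setminus\mathbb{Q}$). (b) $\varphi$ is totally strictly ergodic and mean equicontinuous, with $(\mathbb{T}^1,R_\alpha)$ as its maximal equicontinuous factor and the projection to the first coordinate $\pi:\mathbb{T}^2\to\mathbb{T}^1$, $(x,y)\mapsto x$, as the factor map. (c) The unique $\varphi$-invariant Borel probability measure $\mu$ is the projection of the Lebesgue measure $\lambda$ on $\mathbb{T}^1$ onto some measurable graph, that is, $\mu=(\mathrm{Id}_{\mathbb{T}^1}\times\gamma)_*\lambda$ for some measurable function $\gamma:\mathbb{T}^1\to\mathbb{T}^1$.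
   Context: $\mathbb{T}^d=\mathbb{R}^d/\mathbb{Z}^d$, and $\lambda$ is the normalized Lebesgue measure on $\mathbb{T}^1$. $\mathrm{Id}_{\mathbb{T}^1}\times\gamma$ denotes the map $\mathbb{T}^1\to\mathbb{T}^2$, $x\mapsto(x,\gamma(x))$. A skew product over $R_\alpha$ is a map of the form $\varphi(x,y)=(x+\alpha,\varphi_x(y))$ on $\mathbb{T}^2$. A topological dynamical system (tds) is a pair $(X,\varphi)$ with $X$ a compact metric space (metric $d_X$) and $\varphi$ a homeomorphism of $X$. It is minimal if every orbit $\{\varphi^n(x)\mid n\in\mathbb{Z}\}$ is dense in $X$, uniquely ergodic if there is exactly one $\varphi$-invariant Borel probability measure, and strictly ergodic if it is both minimal and uniquely ergodic. It is totally strictly ergodic if all iterates $\varphi^n$, $n\geq 1$, are strictly ergodic. It is mean equicontinuous if for all $\varepsilon>0$ there is $\delta>0$ such that $d_X(x,y)<\delta$ implies $\limsup_{n\to\infty}\frac1n\sum_{i=0}^{n-1}d_X(\varphi^i(x),\varphi^i(y))<\varepsilon$. It is equicontinuous if for all $\varepsilon>0$ there is $\delta>0$ such that $d_X(x,y)<\delta$ implies $d_X(\varphi^n(x),\varphi^n(y))<\varepsilon$ for all $n\in\mathbb{N}$. A factor of $(X,\varphi)$ is a triple $(Y,\psi,\pi)$ with $(Y,\psi)$ a tds and $\pi:X\to Y$ continuous and onto with $\pi\circ\varphi=\psi\circ\pi$; $\pi$ is called the factor map. $(Y,\psi,\pi)$ is a maximal equicontinuous factor of $(X,\varphi)$ if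 $(Y,\psi)$ is equicontinuous and for every other factor $(Z,\rho,p)$ of $(X,\varphi)$ with $(Z,\rho)$ equicontinuous there is a unique factor map $q$ from $(Y,\psi)$ to $(Z,\rho)$ with $p=q\circ\pi$. *)

(* Defs.v *)
From HB Require Import structures.
From mathcomp Require Import all_boot all_order all_algebra.
From mathcomp Require Import all_classical all_reals all_analysis measurable_realfun.
From mathcomp Require Import ring.

Set Implicit Arguments.
Unset Strict Implicit.
Unset Printing Implicit Defensive.

Import Order.TTheory GRing.Theory Num.Theory.
Import numFieldNormedType.Exports.

Local Open Scope classical_set_scope.
Local Open Scope ring_scope.
Local Open Scope quotient_scope.

(* The measurable types of the library are pointed, hence so are the metric
   spaces below; this excludes only the empty space, and the chosen point enters
   no definition. *)
#[short(type="pmetricType")]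
HB.structure Definition PointedMetric (K : numDomainType) :=
  {M of Metric K M & Pointed M}.

Section prod_metric.
Context {R : realFieldType} {U V : metricType R}.
Implicit Types x y : U * V.

Definition prod_dist x y : R := Num.max (mdist x.1 y.1) (mdist x.2 y.2).

Let prod_dist_ge0 x y : 0 <= prod_dist x y.
Proof. by rewrite le_max mdist_ge0. Qed.

Let prod_dist_positivity x y : prod_dist x y = 0 -> x = y.
Proof.
move=> xy0; case: x y xy0 => [x1 x2] [y1 y2] xy0.
have : prod_dist (x1, x2) (y1, y2) <= 0 by rewrite xy0.
rewrite ge_max => /andP[/= x10 x20].
by congr pair; apply: (@mdist_positivity R); apply/eqP;
  rewrite eq_le mdist_ge0 ?x10 ?x20.
Qed.

Let ballE_prod_dist x d : ball x d = [set y | prod_dist x y < d].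
Proof.
apply/seteqP; split=> y; rewrite /ball/= /prod_ball !ballEmdist/= /prod_dist.
  by rewrite gt_max => -[-> ->].
by rewrite gt_max => /andP.
Qed.

HB.instance Definition _ := @PseudoMetric_isMetric.Build R (U * V)%type
  prod_dist prod_dist_ge0 prod_dist_positivity ballE_prod_dist.

End prod_metric.

HB.instance Definition _ (R : realFieldType) (U V : pmetricType R) :=
  Metric.on (U * V)%type.

Definition borel (X : ptopologicalType) := g_sigma_algebraType (@open X).

HB.instance Definition _ (X : ptopologicalType) :=
  Measurable.on (borel X).

Section circle.
Variable R : realType.

Definition int_pred : pred R := fun x => x \is a Num.int.

Let int_pred_zmod_closed : zmod_closed int_pred.
Proof. by split=> [|x y]; [exact: rpred0 | exact: rpredB]. Qed.

HB.instance Definition _ := GRing.isZmodClosed.Build R int_pred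
  int_pred_zmod_closed.

Definition circle : Type := Quotient.quot (GRing.ZmodClosed.clone R int_pred _).

HB.instance Definition _ := Choice.on circle.
HB.instance Definition _ := GRing.Zmodule.on circle.
HB.instance Definition _ := ZmodQuotient.on circle.
HB.instance Definition _ := isPointed.Build circle 0.

Definition circle_proj : R -> circle := \pi_circle.

Lemma circle_projP (a b : R) :
  reflect (circle_proj a = circle_proj b) (a - b \is a Num.int).
Proof.
have -> : (a - b \is a Num.int) = ((a - b) \in (GRing.ZmodClosed.clone R int_pred _)) by [].
by rewrite Quotient.idealrBE; exact: eqP.
Qed.

Lemma circle_projD : {morph circle_proj : a b / a + b}.
Proof. by move=> a b; exact: raddfD. Qed.

Lemma circle_projB : {morph circle_proj : a b / a - b}.
Proof. by move=> a b; exact: raddfB. Qed.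

Lemma circle_proj_surj x : exists a, circle_proj a = x.
Proof. by exists (repr x); exact: reprK. Qed.

(* The quotient metric: the distance between two cosets of Z in R. *)
Definition circle_dists (x y : circle) : set R :=
  [set r | exists a b, [/\ circle_proj a = x, circle_proj b = y & r = `|a - b|]].

Definition circle_dist (x y : circle) : R := inf (circle_dists x y).

Let dists_neq0 x y : circle_dists x y !=set0.
Proof.
have [a ax] := circle_proj_surj x; have [b bx] := circle_proj_surj y.
by exists `|a - b|, a, b.
Qed.

Let dists_lb x y : lbound (circle_dists x y) 0.
Proof. by move=> _ [a [b [_ _ ->]]]; exact: normr_ge0. Qed.

Lemma circle_dist_le a b :
  circle_dist (circle_proj a) (circle_proj b) <= `|a - b|.
Proof. by apply: ge_inf; [exists 0; exact: dists_lb | exists a, b]. Qed.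

Let circle_dist_ge0 x y : 0 <= circle_dist x y.
Proof. by apply: lb_le_inf; [exact: dists_neq0 | exact: dists_lb]. Qed.

Let circle_distxx x : circle_dist x x = 0.
Proof.
apply/eqP; rewrite eq_le circle_dist_ge0 andbT.
have [a <-] := circle_proj_surj x.
by rewrite (le_trans (circle_dist_le a a))// subrr normr0.
Qed.

Let circle_dist_eq0 x y : circle_dist x y = 0 -> x = y.
Proof.
move=> xy0.
have small r : 0 < r -> exists2 t, circle_dists x y t & t < r.
  by move=> r0; apply: inf_lt; [exact: dists_neq0|
    rewrite -[inf _]/(circle_dist x y) xy0].
have [|_ [a [b [ax bx ->]]] ab] := small 2^-1; first by rewrite invr_gt0.
have [ab0|ab0] := eqVneq (a - b) 0.
  by rewrite -ax -bx; congr circle_proj; apply/eqP; rewrite -subr_eq0 ab0.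
have [|_ [c [d [cx dx ->]]] cd] := small `|a - b|; first by rewrite normr_gt0.
have abcd : (a - b) - (c - d) \is a Num.int.
  have -> : (a - b) - (c - d) = (a - c) - (b - d) by ring.
  by apply: rpredB; apply/circle_projP; rewrite ?ax ?bx.
have [/eqP|abcd0] := eqVneq ((a - b) - (c - d)) 0.
  by rewrite subr_eq0 => /eqP abcdE; move: cd; rewrite abcdE ltxx.
have := norm_intr_ge1 abcd abcd0; rewrite leNgt => /negP; case.
rewrite (le_lt_trans (ler_normB _ _))// [ltRHS]splitr mul1r.
by rewrite ltrD// (lt_trans cd).
Qed.

Let circle_dist_sym x y : circle_dist x y = circle_dist y x.
Proof.
congr inf; apply/seteqP; split=> r [a [b [ax bx ->]]];
  by exists b, a; split=> //; rewrite distrC.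
Qed.

Let circle_dist_triangle y x z :
  circle_dist x z <= circle_dist x y + circle_dist y z.
Proof.
rewrite -lerBlDr; apply: lb_le_inf; first exact: dists_neq0.
move=> _ [a [b [ax bx ->]]]; rewrite lerBlDr -lerBlDl.
apply: lb_le_inf; first exact: dists_neq0.
move=> _ [c [d [cy dz ->]]]; rewrite lerBlDl.
have bc : b - c \is a Num.int by apply/circle_projP; rewrite bx.
have <- : circle_proj (d + (b - c)) = z.
  by rewrite -dz; apply/circle_projP; rewrite addrAC subrr add0r.
rewrite -ax (le_trans (circle_dist_le _ _))//.
have -> : a - (d + (b - c)) = (a - b) + (c - d) by ring.
exact: ler_normD.
Qed.

Lemma circle_distD z x y : circle_dist (x + z) (y + z) = circle_dist x y.
Proof.
have [c <-] := circle_proj_surj z.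
congr inf; apply/seteqP; split=> _ [a [b [ax bx ->]]].
  exists (a - c), (b - c); split; last by congr `|_|; ring.
    by rewrite circle_projB ax addrK.
  by rewrite circle_projB bx addrK.
exists (a + c), (b + c); split; last by congr `|_|; ring.
  by rewrite circle_projD ax.
by rewrite circle_projD bx.
Qed.

HB.instance Definition _ := @isMetric.Build R circle circle_dist
  circle_distxx circle_dist_eq0 circle_dist_sym circle_dist_triangle.

Lemma circle_mdistD (z x y : circle) :
  @mdist R circle (x + z) (y + z) = mdist x y.
Proof. exact: circle_distD. Qed.

Lemma circle_proj_continuous : continuous circle_proj.
Proof.
move=> a; apply/(@metricType_numDomainType.cvgrPdist_lt R circle) => e e0.
near=> b; apply: le_lt_trans (circle_dist_le _ _) _.
by near: b; apply: cvgr_dist_lt.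
Unshelve. all: by end_near. Qed.

Lemma circle_compact : compact [set: circle].
Proof.
have -> : [set: circle] = circle_proj @` `[0, 1]%classic.
  apply/seteqP; split=> // x _; have [a <-] := circle_proj_surj x.
  exists (a - (Num.floor a)%:~R).
    rewrite /= in_itv/= subr_ge0 floor_le lerBlDl ltW//.
    by rewrite -[1]/(1%:~R) -intrD floorD1_gt.
  by apply/circle_projP; rewrite addrAC subrr add0r rpredN intr_int.
apply: continuous_compact; last exact: segment_compact.
exact/continuous_subspaceT/circle_proj_continuous.
Qed.

End circle.

Definition torus2 (R : realType) : pmetricType R :=
  (circle R * circle R)%type.

Definition torus2_proj (R : realType) (p : R * R) : torus2 R :=
  (circle_proj p.1, circle_proj p.2).

Lemma torus2_compact (R : realType) : compact [set: torus2 R].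
Proof. by rewrite -setXTT; apply: compact_setX; exact: circle_compact. Qed.

Section circle_lebesgue.
Variable R : realType.

Let I01 : set (measurableTypeR R) := `[0%R, 1%R[%classic.

Let measurable_I01 : measurable I01.
Proof. exact: measurable_itv. Qed.

Lemma measurable_circle_proj :
  measurable_fun setT
    (@circle_proj R : measurableTypeR R -> borel (circle R)).
Proof.
apply: (@measurability _ _ (measurableTypeR R) (borel (circle R)) _ _
  (@open (circle R))) => //.
move=> _ [A oA <-]; rewrite setTI; apply: open_measurable.
by apply: open_comp => // x _; exact: circle_proj_continuous.
Qed.

Definition circle_lebesgue : set (borel (circle R)) -> \bar R :=
  pushforward (mrestr (@lebesgue_measure R) measurable_I01)
    (@circle_proj R : measurableTypeR R -> borel (circle R)).

Let preimage_measurable (A : set (borel (circle R))) : measurable A ->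
  measurable (@circle_proj R @^-1` A : set (measurableTypeR R)).
Proof.
by move=> mA; rewrite -[X in measurable X]setTI; exact: measurable_circle_proj.
Qed.

Let circle_lebesgue0 : circle_lebesgue set0 = 0%E.
Proof. by rewrite /circle_lebesgue/pushforward preimage_set0 measure0. Qed.

Let circle_lebesgue_ge0 A : (0 <= circle_lebesgue A)%E.
Proof. by rewrite /circle_lebesgue/pushforward measure_ge0. Qed.

Let circle_lebesgue_sigma_additive : semi_sigma_additive circle_lebesgue.
Proof.
move=> F mF tF mUF; rewrite /circle_lebesgue/pushforward preimage_bigcup.
apply: measure_semi_sigma_additive.
- by move=> n; exact: preimage_measurable.
- apply/trivIsetP => /= i j _ _ ij; rewrite -preimage_setI.
  by move/trivIsetP : tF => /(_ _ _ _ _ ij) ->//; rewrite preimage_set0.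
- by rewrite -preimage_bigcup; exact: preimage_measurable.
Qed.

HB.instance Definition _ := isMeasure.Build _ _ _ circle_lebesgue
  circle_lebesgue0 circle_lebesgue_ge0 circle_lebesgue_sigma_additive.

Let circle_lebesgueT : circle_lebesgue setT = 1%E.
Proof.
rewrite /circle_lebesgue/pushforward preimage_setT /mrestr setTI.
by rewrite lebesgue_measure_itv/= lte_fin ltr01 sube0.
Qed.

HB.instance Definition _ := Measure_isProbability.Build _ _ _ circle_lebesgue
  circle_lebesgueT.

End circle_lebesgue.

Record homeo (X : topologicalType) := Homeo {
  homeo_fun :> X -> X;
  homeo_inv : X -> X;
  homeo_funK : cancel homeo_fun homeo_inv;
  homeo_invK : cancel homeo_inv homeo_fun;
  homeo_fun_continuous : continuous homeo_fun;
  homeo_inv_continuous : continuous homeo_inv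
}.

Lemma iter_cancel (T : Type) (f g : T -> T) n :
  cancel f g -> cancel (iter n f) (iter n g).
Proof. by move=> fK; elim: n => // n IHn x; rewrite iterSr (iterS n f) fK IHn. Qed.

Lemma iter_continuous (X : topologicalType) (f : X -> X) n :
  continuous f -> continuous (iter n f).
Proof.
move=> cf; elim: n => [|n IHn] x; first exact: cvg_id.
by apply: continuous_comp; [exact: IHn | exact: cf].
Qed.

Definition homeo_iter (X : topologicalType) (n : nat) (h : homeo X) : homeo X :=
  Homeo (iter_cancel n (homeo_funK h)) (iter_cancel n (homeo_invK h))
    (iter_continuous (n := n) (homeo_fun_continuous (h := h)))
    (iter_continuous (n := n) (homeo_inv_continuous (h := h))).

Definition homeo_zpow (X : topologicalType) (h : homeo X) (n : int) : X -> X :=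
  match n with
  | Posz m => iter m h
  | Negz m => iter m.+1 (homeo_inv h)
  end.

Record tds (R : realType) := Tds {
  tds_space :> pmetricType R;
  tds_compact : compact [set: tds_space];
  tds_map : homeo tds_space
}.

Definition tds_iter (R : realType) (n : nat) (X : tds R) : tds R :=
  Tds (@tds_compact R X) (homeo_iter n (tds_map X)).

Section dynamics.
Variable R : realType.
Implicit Types X Y Z : tds R.

Definition minimal X : Prop :=
  forall x : X, dense (range (fun n : int => homeo_zpow (tds_map X) n x)).

Definition invariant X (mu : probability (borel X) R) : Prop :=
  forall A : set (borel X), measurable A ->
    pushforward mu (tds_map X : borel X -> borel X) A = mu A.

Definition unique_invariant X (mu : probability (borel X) R) : Prop :=
  invariant mu /\
  forall nu : probability (borel X) R, invariant nu ->
    forall A : set (borel X), measurable A -> nu A = mu A.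

Definition uniquely_ergodic X : Prop :=
  exists mu : probability (borel X) R, unique_invariant mu.

Definition strictly_ergodic X : Prop := minimal X /\ uniquely_ergodic X.

Definition totally_strictly_ergodic X : Prop :=
  forall n : nat, (1 <= n)%N -> strictly_ergodic (tds_iter n X).

Definition mean_equicontinuous X : Prop :=
  forall eps : R, 0 < eps -> exists2 delta : R, 0 < delta &
    forall x y : X, mdist x y < delta ->
      (limn_esup (fun n : nat =>
        (n%:R^-1 * \sum_(0 <= i < n)
           mdist (iter i (tds_map X) x) (iter i (tds_map X) y))%:E)
       < eps%:E)%E.

Definition equicontinuous X : Prop :=
  forall eps : R, 0 < eps -> exists2 delta : R, 0 < delta &
    forall x y : X, mdist x y < delta ->
      forall n : nat, mdist (iter n (tds_map X) x) (iter n (tds_map X) y) < eps.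

Definition factor_map X Y (p : X -> Y) : Prop :=
  [/\ continuous p, range p = setT &
      forall x, p (tds_map X x) = tds_map Y (p x)].

Definition max_equicontinuous_factor X Y (p : X -> Y) : Prop :=
  [/\ factor_map p, equicontinuous Y &
      forall Z (q : X -> Z), factor_map q -> equicontinuous Z ->
        exists! r : Y -> Z, factor_map r /\ q = r \o p].

End dynamics.

Section rotation.
Variables (R : realType) (alpha : R).

Definition rotate (a : circle R) (x : circle R) : circle R := x + a.

Lemma rotateK a : cancel (rotate a) (rotate (- a)).
Proof. exact: addrK. Qed.

Lemma rotateNK a : cancel (rotate (- a)) (rotate a).
Proof. exact: subrK. Qed.

Lemma rotate_continuous a : continuous (rotate a).
Proof.
move=> x; apply/(@metricType_numDomainType.cvgrPdist_lt R (circle R) (circle R)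
  (nbhs x) (nbhs_filter x)) => e e0.
apply: filterS (@metricType_numDomainType.cvgr_dist_lt R (circle R) _ _
  (nbhs_filter x) id x cvg_id e e0) => y.
by rewrite /rotate circle_mdistD.
Qed.

Definition rotation : homeo (circle R) :=
  let a := circle_proj alpha in
  Homeo (rotateK a) (rotateNK a) (rotate_continuous (a := a))
    (rotate_continuous (a := - a)).

Definition rotation_tds : tds R := Tds (@circle_compact R) rotation.

End rotation.

Section torus_maps.
Variable R : realType.

Definition torus2_tds (phi : homeo (torus2 R)) : tds R :=
  Tds (@torus2_compact R) phi.

Definition skew_product_over (alpha : R) (phi : torus2 R -> torus2 R) : Prop :=
  exists fib : circle R -> circle R -> circle R,
    forall x y, phi (x, y) = (rotation alpha x, fib x y).

(* [Ck_on k U f], for [U] open: all the partial derivatives of [f] of order at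
   most [k] exist and are continuous at every point of [U]. *)
Fixpoint Ck_on (k : nat) (U : set (R * R)) (f : R * R -> R) : Prop :=
  (forall p, U p -> {for p, continuous f}) /\
  match k with
  | 0%N => True
  | k'.+1 =>
      [/\ forall p, U p -> derivable f p (1, 0) /\ derivable f p (0, 1),
          Ck_on k' U ('D_(1, 0) f) & Ck_on k' U ('D_(0, 1) f)]
  end.

Definition smooth_on (U : set (R * R)) (F : R * R -> R * R) : Prop :=
  forall k, Ck_on k U (fst \o F) /\ Ck_on k U (snd \o F).

(* The local inverses of [torus2_proj] are the charts of the torus, so a map is
   smooth when near every point it lifts to a smooth map between open subsets
   of the plane. *)
Definition torus_smooth (f : torus2 R -> torus2 R) : Prop :=
  forall p : R * R, exists (U : set (R * R)) (F : R * R -> R * R),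
    [/\ open U, U p, smooth_on U F &
        forall z, U z -> torus2_proj (F z) = f (torus2_proj z)].

Definition torus_diffeo (phi : homeo (torus2 R)) : Prop :=
  torus_smooth phi /\ torus_smooth (homeo_inv phi).

End torus_maps.

(* Main.v *)
(* Anosov-Katok construction inside the SL(2,R)-cocycles, acting projectively
   on the fibres R/Z. The diffeomorphism is the limit of the maps H_n R H_n^-1,
   where R is the rotation of the base by a rational beta_n, H_n acts on the
   fibre over x by a matrix B_n(x), and B_(n+1)(x) = B_n(x) D Rot(2 pi Q x)
   with D strongly hyperbolic and Q a multiple of the denominator of beta_n. As
   the new factor commutes with the rotation by beta_n, choosing beta_(n+1)
   close to beta_n makes consecutive maps, and any prescribed number of their
   iterates, close in C^n. D contracts all of the circle outside a small arc,
   and this arc turns with x; so every orbit spends most of its time near the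
   graph of gam_n(x) = B_n(x) 0, while it also becomes dense.

   The average distance of every orbit to the continuous graph of gam_n is thus
   at most 4^-n. Mean equicontinuity follows at once, and two points of a fibre
   are close at some time of the past, so they have the same image in any
   equicontinuous factor. A measure invariant under an iterate projects to
   Lebesgue measure and integrates the distance to the graph of gam_n to
   O(4^-n); hence it is the limit of the graph measures of gam_n, which
   converge since gam_n converges almost everywhere. *)
Require Import Defs.
From HB Require Import structures.
From mathcomp Require Import all_boot all_order all_algebra.
From mathcomp Require Import all_classical all_reals all_analysis.
From mathcomp Require Import measurable_realfun zify ring lra.

Set Implicit Arguments.
Unset Strict Implicit.
Unset Printing Implicit Defensive.

Import Order.TTheory GRing.Theory Num.Theory.
Import numFieldNormedType.Exports.

Local Open Scope classical_set_scope.
Local Open Scope ring_scope.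

(** * Uniformly bounded derivatives of functions of one variable *)

(** Acting through SL(2,R) reduces a fibred diffeomorphism to a matrix function of one real
    variable: the fibre variable enters only through an arctangent, the inverse is the adjugate,
    distances in a fibre are cross products divided by lengths, and C^k convergence concerns four
    entries.

    The obstacle is that the conjugacies B_n need not converge and their Lipschitz constants are not
    controlled, so the limit map is not conjugate to anything simple. Each stage therefore fixes,
    after its own estimates, a tolerance [stheta] and a time window [sW] that all later stages must
    respect. A stage moves by at most half its tolerance and the tolerances at least halve, so
    everything later adds up to at most the current one. The first tolerance, 1/8, keeps the limit
    cocycle close enough to the identity to be lifted to the plane.

    Two further demands are arithmetic. The tolerance is small against the denominator of beta_n,
    which makes alpha irrational as in Liouville's argument. Density is required along the multiples
    of every m <= n + 1, so that all iterates of the limit are minimal. *)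

Section bounded_smooth.
Variable R : realType.
Implicit Types (f g df : R -> R) (k : nat) (C D : R).

(** One constant bounds f and its derivatives up to order k. The last derivative is bounded but not
    assumed continuous, so [smooth1 k] is obtained from [Cb k.+1]. Derivatives are existential
    witnesses, so explicit formulas can be supplied. *)
Fixpoint Cb k C f : Prop :=
  (forall x, `|f x| <= C) /\
  if k is k'.+1 then
    exists2 df : R -> R, (forall x : R, is_derive x 1 f (df x)) & Cb k' C df
  else True.

Lemma Cb_bound k C f x : Cb k C f -> `|f x| <= C.
Proof. by case: k => [|k] []. Qed.

Lemma Cb_le k C D f : C <= D -> Cb k C f -> Cb k D f.
Proof.
move=> CD; elim: k f => [|k IH] f [fC] => [_|[df fdf dfC]].
  by split=> // x; exact: le_trans CD.
by split=> [x|]; [exact: le_trans CD|exists df => //; exact: IH].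
Qed.

Lemma Cb_lower k j C f : (j <= k)%N -> Cb k C f -> Cb j C f.
Proof.
elim: j k f => [|j IH] [|k] f // jk; first by case.
by case=> fC [df fdf dfC]; split=> //; exists df => //; exact: IH dfC.
Qed.

Lemma Cb_add k C D f g :
  Cb k C f -> Cb k D g -> Cb k (C + D) (fun x => f x + g x).
Proof.
elim: k f g => [|k IH] f g [fC hf] [gD hg].
  by split=> // x; rewrite (le_trans (ler_normD _ _))// lerD.
split=> [x|]; first by rewrite (le_trans (ler_normD _ _))// lerD.
case: hf hg => df fdf dfC [dg gdg dgD].
by exists (fun x => df x + dg x) => [x|]; [exact: is_deriveD|exact: IH].
Qed.

(** By Leibniz, the k-th derivative of a product is a sum of 2^k products, each at most C D. *)
Lemma Cb_mul k C D f g :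
  Cb k C f -> Cb k D g -> Cb k (2 ^+ k * (C * D)) (fun x => f x * g x).
Proof.
have bnd (u v : R -> R) : (forall x, `|u x| <= C) -> (forall x, `|v x| <= D) ->
    forall x, `|u x * v x| <= C * D.
  by move=> uC vD x; rewrite normrM ler_pM.
elim: k f g => [|k IH] f g [fC hf] [gD hg].
  by split=> //; rewrite expr0 mul1r; exact: bnd.
have CD0 : 0 <= C * D by rewrite (le_trans _ (bnd _ _ fC gD 0)).
split=> [x|].
  by rewrite (le_trans (bnd _ _ fC gD x))// ler_peMl// exprn_ege1// ler1n.
case: hf hg => df fdf dfC [dg gdg dgD].
exists (fun x => f x * dg x + df x * g x) => [x|].
  have := is_deriveM (fdf x) (gdg x); move/is_derive_eq; apply.
  by rewrite /GRing.scale/= (mulrC (g x)).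
have -> : 2 ^+ k.+1 * (C * D) = 2 ^+ k * (C * D) + 2 ^+ k * (C * D).
  by rewrite exprS; ring.
apply: Cb_add; apply: IH => //.
  by apply: (@Cb_lower k.+1) => //; split=> //; exists df.
by apply: (@Cb_lower k.+1) => //; split=> //; exists dg.
Qed.

Lemma Cb_cst k C : 0 <= C -> forall c, `|c| <= C -> Cb k C (fun _ => c).
Proof.
move=> C0; elim: k => [|k IH] c cC; split=> //.
exists (fun _ => 0) => [x|]; first exact: is_derive_cst.
by apply: IH; rewrite normr0.
Qed.

Lemma is_derive1_shift f (d t x : R) : is_derive (x + t) 1 f d ->
  is_derive x 1 (fun y => f (y + t)) d.
Proof.
move=> fd; have xt : is_derive x 1 (fun y : R => y + t) 1.
  by apply: is_derive_eq; rewrite addr0.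
by apply: is_derive_eq; rewrite mulr1.
Qed.

Lemma Cb_shift k C f t : Cb k C f -> Cb k C (fun x => f (x + t)).
Proof.
elim: k f => [|k IH] f [fC hf]; split=> //.
case: hf => df fdf dfC; exists (fun x => df (x + t)) => [x|]; last exact: IH.
exact: is_derive1_shift.
Qed.

Lemma Cb_MVT C f s t : Cb 1 C f -> `|f t - f s| <= C * `|t - s|.
Proof.
move=> [_ [df fdf [dfC _]]].
suff H u v : u <= v -> `|f v - f u| <= C * `|v - u|.
  have [/H//|/ltW/H] := leP s t.
  by rewrite distrC (distrC s).
move=> uv.
have cf : {within `[u, v], continuous f}.
  apply: continuous_subspaceT => x; apply: differentiable_continuous.
  by apply/derivable1_diffP; have [] := fdf x.
have [c _ ->] := MVT_segment uv (fun x _ => fdf x) cf.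
by rewrite normrM ler_wpM2r.
Qed.

Lemma Cb_shiftB k C f s t : Cb k.+1 C f ->
  Cb k (C * `|t - s|) (fun x => f (x + t) - f (x + s)).
Proof.
have bnd j g : Cb j.+1 C g -> forall x, `|g (x + t) - g (x + s)| <=
  C * `|t - s|.
  move=> gC x; have := Cb_MVT (x + s) (x + t) (Cb_lower (ltn0Sn j) gC).
  by have -> : x + t - (x + s) = t - s by ring.
elim: k f => [|k IH] f fC; (split=> [x|]; first exact: bnd fC x) => //.
have [_ [df fdf dfC]] := fC.
exists (fun x => df (x + t) - df (x + s)) => [x|]; last exact: IH.
by apply: is_deriveB; exact: is_derive1_shift.
Qed.

Fixpoint smooth1 k f : Prop :=
  if k is k'.+1 then
    exists2 df : R -> R, (forall x : R, is_derive x 1 f (df x)) & smooth1 k' df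
  else continuous f.

Lemma is_derive_continuous f df :
  (forall x : R, is_derive x 1 f (df x)) -> continuous f.
Proof.
move=> fdf x; apply: differentiable_continuous.
by apply/derivable1_diffP; have [] := fdf x.
Qed.

Lemma smooth1_continuous k f : smooth1 k f -> continuous f.
Proof. by case: k => [//|k] [df /is_derive_continuous]. Qed.

Lemma Cb_smooth1 k C f : Cb k.+1 C f -> smooth1 k f.
Proof.
elim: k f => [|k IH] f [_ [df fdf dfC]]; first exact: is_derive_continuous fdf.
by exists df => //; exact: IH.
Qed.

(** Increments are at most e n / 2 <= e n - e n.+1, so the sum telescopes; the induction carries the
    sharper bound e n - e m. *)
Lemma dist_sum_halving (u : nat -> R) (e : nat -> R) n0 :
  (forall n, e n.+1 <= e n / 2) ->
  (forall n, (n0 <= n)%N -> `|u n.+1 - u n| <= e n / 2) ->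
  forall n m, (n0 <= n)%N -> (n <= m)%N -> `|u m - u n| <= e n.
Proof.
move=> he hu n m n0n /subnK <-.
suff : `|u (m - n + n)%N - u n| <= e n - e (m - n + n)%N /\ 0 <= e (m - n +
  n)%N.
  by case=> + e0 => /le_trans; apply; rewrite gerBl.
have e0 k : (n0 <= k)%N -> 0 <= e k.
  by move=> /hu /(le_trans (normr_ge0 _)); lra.
elim: (m - n)%N => [|j [IH _]]; first by rewrite add0n !subrr normr0 e0.
have n0j : (n0 <= j + n)%N by rewrite (leq_trans n0n)// leq_addl.
split; last by rewrite addSn e0// (leq_trans n0j).
rewrite addSn (le_trans (ler_distD (u (j + n)%N) _ _))//.
have := hu _ n0j; have := he (j + n)%N; move: IH; lra.
Qed.

Lemma halving_cvg0 (e : nat -> R) : (forall n, 0 <= e n) ->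
  (forall n, e n.+1 <= e n / 2) -> e @ \oo --> 0.
Proof.
move=> e0 he.
have eg n : e n <= geometric (e 0) 2^-1 n.
  elim: n => [|n IH]; first by rewrite /geometric/= expr0 mulr1.
  rewrite (le_trans (he n))//; move: IH; rewrite /geometric/= exprS; lra.
apply: (@squeeze_cvgr _ _ _ _ (fun=> 0) (geometric (e 0) 2^-1)).
- by near=> n; rewrite e0 eg.
- exact: cvg_cst.
- by apply: cvg_geometric; rewrite ger0_norm ?invr_ge0// invf_lt1// ltr1n.
Unshelve. all: by end_near. Qed.

Lemma halving_limit (u e : nat -> R) n0 : (forall n, 0 <= e n) ->
  (forall n, e n.+1 <= e n / 2) ->
  (forall n, (n0 <= n)%N -> `|u n.+1 - u n| <= e n / 2) ->
  exists2 l, u @ \oo --> l & forall n, (n0 <= n)%N -> `|l - u n| <= e n.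
Proof.
move=> e0 he hu.
have ue := dist_sum_halving he hu.
have ul : cvg (u @ \oo).
  apply/cauchy_cvgP/cauchy_exP => d d0.
  have /cvgrPdist_lt/(_ _ d0)[N _ eN] := halving_cvg0 e0 he.
  exists (u (maxn N n0)); exists (maxn N n0) => // m /= Nm.
  rewrite /ball/= distrC (le_lt_trans (ue _ _ _ Nm))// ?leq_maxr//.
  have /= := eN (maxn N n0) (leq_maxl _ _).
  by rewrite sub0r normrN ger0_norm.
exists (lim (u @ \oo)) => // n n0n.
have : (fun m => `|u m - u n|) @ \oo --> `|lim (u @ \oo) - u n|.
  by apply: cvg_norm; apply: cvgB => //; exact: cvg_cst.
move/(@cvg_lim _ (@norm_hausdorff _ _)) => <-.
apply: limr_le.
  by apply: is_cvg_norm; apply: is_cvgB => //; exact: is_cvg_cst.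
by near=> m; apply: ue => //; near: m; exact: nbhs_infty_ge.
Unshelve. all: by end_near. Qed.

Lemma cvg_near_seq (u v e : nat -> R) (l : R) : e @ \oo --> 0 ->
  (forall n, `|u n - v n| <= e n) -> v @ \oo --> l -> u @ \oo --> l.
Proof.
move=> ecvg uv vl; apply/cvgrPdist_lt => d d0.
have d2 : 0 < d / 2 by rewrite divr_gt0.
move/cvgrPdist_lt/(_ _ d2) : vl; move/cvgrPdist_lt/(_ _ d2) : ecvg.
apply: filterS2 => n; rewrite sub0r normrN => h1 h2.
rewrite (le_lt_trans (ler_distD (v n) _ _))// (distrC (v n)).
have := ler_norm (e n); move: (uv n) h1 h2; lra.
Qed.

Lemma is_derive_nearP f (x d : R) : is_derive x 1 f d <->
  forall e, 0 < e ->
    \forall h \near 0^', `|h^-1 * (f (h + x) - f x) - d| <= e.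
Proof.
have E : (fun h : R => h^-1 *: ((f \o shift x) (h *: 1) - f x)) =
         (fun h : R => h^-1 * (f (h + x) - f x)).
  by apply/funext => h /=; rewrite /GRing.scale/= mulr1.
split=> [[dv <-] e e0|H].
  have : (fun h : R => h^-1 * (f (h + x) - f x)) @ 0^' --> 'D_1 f x.
    by rewrite -E; exact: dv.
  move=> /cvgrPdist_le/(_ _ e0).
  by apply: filterS => h; rewrite distrC.
suff L : (fun h : R => h^-1 *: ((f \o shift x) (h *: 1) - f x)) @ 0^' --> d.
  by split; [exact/cvgP/L|apply: cvg_lim L; exact: norm_hausdorff].
rewrite E; apply/cvgrPdist_le => e /H.
by apply: filterS => h; rewrite distrC.
Qed.

(** The mean value theorem bounds the increments of f m - f n by (e n + e m) |z - y|. Letting m tend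
    to infinity, the difference quotients of g and f n differ by at most e n. *)
Lemma derive_limit (f df : nat -> R -> R) (e : nat -> R) g dg n0 :
  e @ \oo --> 0 ->
  (forall n (x : R), is_derive x 1 (f n) (df n x)) ->
  (forall x, f ^~ x @ \oo --> g x) ->
  (forall n x, (n0 <= n)%N -> `|dg x - df n x| <= e n) ->
  forall x : R, is_derive x 1 g (dg x).
Proof.
move=> ecvg fdf fg hdg x.
have mvt n m y z : (n0 <= n)%N -> (n0 <= m)%N ->
    `|(f m z - f n z) - (f m y - f n y)| <= (e n + e m) * `|z - y|.
  move=> n0n n0m.
  suff H u v : u <= v ->
      `|(f m v - f n v) - (f m u - f n u)| <= (e n + e m) * `|v - u|.
    have [/H//|/ltW/H] := leP y z.
    by rewrite distrC (distrC y).
  move=> uv.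
  have h (w : R) : is_derive w 1 (fun w => f m w - f n w) (df m w - df n w).
    by apply: is_deriveB; exact: fdf.
  have cf : {within `[u, v], continuous (fun w => f m w - f n w)}.
    exact/continuous_subspaceT/(is_derive_continuous h).
  have [c _ ->] := MVT_segment uv (fun x _ => h x) cf.
  rewrite normrM ler_wpM2r// (le_trans (ler_distD (dg c) _ _))//.
  by rewrite addrC distrC lerD ?hdg// distrC hdg.
have lim n z : (n0 <= n)%N ->
    `|(g z - f n z) - (g x - f n x)| <= e n * `|z - x|.
  move=> n0n.
  have L : (fun m => `|(f m z - f n z) - (f m x - f n x)|) @ \oo -->
      `|(g z - f n z) - (g x - f n x)|.
    by apply: cvg_norm; do 2?apply: cvgB => //; exact: cvg_cst.
  have M : (fun m => (e n + e m) * `|z - x|) @ \oo --> (e n + 0) * `|z - x|.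
    by apply: cvgMr_tmp; apply: cvgD => //; exact: cvg_cst.
  rewrite -[e n]addr0; apply: (ler_cvg_to L M).
  near=> m; apply: mvt => //; near: m; exact: nbhs_infty_ge.
apply/is_derive_nearP => d d0.
have d4 : 0 < d / 4 by rewrite divr_gt0.
have /cvgrPdist_lt/(_ _ d4)[N _ eN] := ecvg.
pose n := maxn N n0.
have n0n : (n0 <= n)%N by rewrite leq_maxr.
have en : e n < d / 4.
  have /= := eN n (leq_maxl _ _).
  by rewrite sub0r normrN; apply: le_lt_trans; exact: ler_norm.
have /is_derive_nearP/(_ _ d4) := fdf n x.
apply: filterS2 (nbhs_dnbhs_neq _) => h h0 hn.
have := lim n (h + x) n0n; rewrite addrK => hl.
have -> : h^-1 * (g (h + x) - g x) - dg x =
    h^-1 * ((g (h + x) - f n (h + x)) - (g x - f n x)) +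
    (h^-1 * (f n (h + x) - f n x) - df n x) - (dg x - df n x) by ring.
have h1 : `|h^-1 * ((g (h + x) - f n (h + x)) - (g x - f n x))| <= e n.
  by rewrite normrM normfV mulrC ler_pdivrMr ?normr_gt0.
rewrite (le_trans (ler_normB _ _))//.
have := hdg n x n0n.
have := ler_normD (h^-1 * ((g (h + x) - f n (h + x)) - (g x - f n x)))
  (h^-1 * (f n (h + x) - f n x) - df n x).
move: h1 hn en; lra.
Unshelve. all: by end_near. Qed.

Lemma continuous_limit (f : nat -> R -> R) (e : nat -> R) g n0 :
  e @ \oo --> 0 -> (forall n, continuous (f n)) ->
  (forall n x, (n0 <= n)%N -> `|g x - f n x| <= e n) -> continuous g.
Proof.
move=> ecvg cf hg x; apply/cvgrPdist_lt => d d0.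
have d4 : 0 < d / 4 by rewrite divr_gt0.
have /cvgrPdist_lt/(_ _ d4)[N _ eN] := ecvg.
pose n := maxn N n0.
have n0n : (n0 <= n)%N by rewrite leq_maxr.
have en : e n < d / 4.
  have /= := eN n (leq_maxl _ _).
  by rewrite sub0r normrN; apply: le_lt_trans; exact: ler_norm.
have := cf n x => /cvgrPdist_lt/(_ _ d4); apply: filterS => y fy.
rewrite (le_lt_trans (ler_distD (f n x) _ _))//.
have := ler_distD (f n y) (f n x) (g y).
have := hg n x n0n; have := hg n y n0n; rewrite (distrC (g y)).
move: fy en; lra.
Qed.

(** Induction on k, the derivatives forming a sequence of the same kind. The threshold [n0] is there
    because step n of the construction controls only n derivatives: order k is controlled from stage
    k on. *)
Lemma smooth1_limit k (f : nat -> R -> R) (e : nat -> R) g n0 :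
  (forall n, 0 <= e n) -> (forall n, e n.+1 <= e n / 2) ->
  (forall n, smooth1 k (f n)) ->
  (forall n, (n0 <= n)%N -> Cb k (e n / 2) (fun x => f n.+1 x - f n x)) ->
  (forall x, f ^~ x @ \oo --> g x) ->
  smooth1 k g.
Proof.
move=> e0 he; have ecvg := halving_cvg0 e0 he.
elim: k f g => [|k IH] f g sf hf fg.
  apply: (continuous_limit (n0 := n0) ecvg sf) => n x n0n.
  have [|l fl hl] := @halving_limit (f ^~ x) e n0 e0 he.
    by move=> m /hf/Cb_bound.
  by rewrite (norm_cvg_unique (fg x) fl); exact: hl.
have /choice[df hdf] : forall n, exists df : R -> R,
    (forall x : R, is_derive x 1 (f n) (df x)) /\ smooth1 k df.
  by move=> n; have [df ? ?] := sf n; exists df.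
have dfB n : (n0 <= n)%N -> Cb k (e n / 2) (fun x => df n.+1 x - df n x).
  move=> /hf[_ [d' fd' d'e]].
  suff -> : (fun x => df n.+1 x - df n x) = d' by [].
  apply/funext => x; have [_ <-] := fd' x.
  have [f1 _] := hdf n.+1; have [f2 _] := hdf n.
  by have [_ <-] := is_deriveB (f1 x) (f2 x).
have lim x := @halving_limit (df ^~ x) e n0 e0 he
  (fun n n0n => Cb_bound x (dfB n n0n)).
have /choice[dg hdg] : forall x, exists l, (df ^~ x @ \oo --> l) /\
    (forall n, (n0 <= n)%N -> `|l - df n x| <= e n).
  by move=> x; have [l ? ?] := lim x; exists l.
exists dg; last first.
  by apply: (IH df) => // [n|x]; [have [] := hdf n|have [] := hdg x].
apply: (derive_limit (f := f) (df := df) (e := e) (n0 := n0)) => //.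
  by move=> n; have [] := hdf n.
by move=> n x; have [_] := hdg x; apply.
Qed.

Definition bsmooth f : Prop := forall k, exists C, Cb k C f.

Lemma bsmooth_add f g : bsmooth f -> bsmooth g -> bsmooth (fun x => f x + g x).
Proof.
by move=> fb gb k; have [C fC] := fb k; have [D gD] := gb k; exists (C + D);
  exact: Cb_add.
Qed.

Lemma bsmooth_mul f g : bsmooth f -> bsmooth g -> bsmooth (fun x => f x * g x).
Proof.
by move=> fb gb k; have [C fC] := fb k; have [D gD] := gb k;
  exists (2 ^+ k * (C * D)); exact: Cb_mul.
Qed.

Lemma bsmooth_cst c : bsmooth (fun _ => c).
Proof. by move=> k; exists `|c|; exact: Cb_cst. Qed.

Lemma bsmooth_shift f t : bsmooth f -> bsmooth (fun x => f (x + t)).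
Proof. by move=> fb k; have [C fC] := fb k; exists C; exact: Cb_shift. Qed.

Lemma bsmooth_cos_sin c :
  bsmooth (fun x => cos (c * x)) /\ bsmooth (fun x => sin (c * x)).
Proof.
have lin (x : R) : is_derive x 1 (fun y => c * y) c.
  by apply: is_derive_eq; rewrite /GRing.scale/= mulr1.
have dcos (x : R) : is_derive x 1 (fun y => cos (c * y)) (- c * sin (c * x)).
  by apply: is_derive_eq; ring.
have dsin (x : R) : is_derive x 1 (fun y => sin (c * y)) (c * cos (c * x)).
  by apply: is_derive_eq; ring.
suff H k : exists2 C, 1 <= C &
    Cb k C (fun x => cos (c * x)) /\ Cb k C (fun x => sin (c * x)).
  by split=> k; have [C _ []] := H k; exists C.
elim: k => [|k [C C1 [hc hs]]].
  by exists 1 => //; do 2!split=> //; move=> x; rewrite ?cos_max ?sin_max.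
pose D := 2 ^+ k * (`|c| * C).
have cst u : `|u| <= `|c| -> Cb k `|c| (fun _ => u) by exact: Cb_cst.
have le1 (x : R) : `|x| <= 1 -> `|x| <= 1 + D.
  have C0 : 0 <= C := le_trans ler01 C1.
  by move=> x1; rewrite (le_trans x1)// lerDl !mulr_ge0// exprn_ge0.
have leD : D <= 1 + D by rewrite lerDr.
have leD1 : 1 <= 1 + D by have := le1 1; rewrite normr1; apply.
exists (1 + D) => //.
split; (split=> [x|]).
- by rewrite le1// cos_max.
- exists (fun x => - c * sin (c * x)) => //.
  by apply: Cb_le leD _; apply: Cb_mul => //; apply: cst; rewrite normrN.
- by rewrite le1// sin_max.
- exists (fun x => c * cos (c * x)) => //.
  by apply: Cb_le leD _; apply: Cb_mul => //; exact: cst.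
Qed.

Lemma bsmooth_smooth1 f k : bsmooth f -> smooth1 k f.
Proof. by move=> /(_ k.+1)[C /Cb_smooth1]. Qed.

End bounded_smooth.

(** * Smoothness in the plane *)

Section plane_smooth.
Variable R : realType.
Implicit Types (F G : R * R -> R) (k : nat).

Lemma is_derive_lineP F (p v : R * R) d :
  is_derive p v F d <-> is_derive (0 : R) 1 (fun h : R => F (h *: v + p)) d.
Proof.
have E : 'D_v F p = 'D_1 (fun h : R => F (h *: v + p)) 0.
  rewrite /derive; congr (lim (_ @ 0^')); apply/funext => h /=.
  by rewrite addr0 scale0r add0r /GRing.scale/= mulr1.
split=> -[dF dE]; split.
- exact: (derivable1P _ _ _).1 dF.
- by rewrite -E.
- exact: (derivable1P _ _ _).2 dF.
- by rewrite E.
Qed.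

(** [Ck_on] refers to directional derivatives taken as limits; here explicit partial derivatives may
    be supplied instead. The closure properties of [Ck_on] rest on this form. *)
Lemma Ck_onP k F : (forall p, {for p, continuous F}) ->
  (if k is k'.+1 then exists F1 F2 : R * R -> R,
     [/\ forall p : R * R, is_derive p (1, 0) F (F1 p),
         forall p : R * R, is_derive p (0, 1) F (F2 p),
         Ck_on k' setT F1 & Ck_on k' setT F2]
   else True) -> Ck_on k setT F.
Proof.
case: k => [|k] cF; first by move=> _; split.
move=> [F1 [F2 [h1 h2 C1 C2]]]; split=> //; split.
- by move=> p _; have [] := h1 p; have [] := h2 p.
- by rewrite (_ : 'D_(1, 0) F = F1)//; apply/funext => p; have [] := h1 p.
- by rewrite (_ : 'D_(0, 1) F = F2)//; apply/funext => p; have [] := h2 p.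
Qed.

Lemma Ck_on_continuous k F : Ck_on k setT F -> continuous F.
Proof. by case: k => [|k] [cF _] p; exact: cF. Qed.

Lemma Ck_on_derive k F : Ck_on k.+1 setT F ->
  [/\ forall p : R * R, is_derive p (1, 0) F ('D_(1, 0) F p),
      forall p : R * R, is_derive p (0, 1) F ('D_(0, 1) F p),
      Ck_on k setT ('D_(1, 0) F) & Ck_on k setT ('D_(0, 1) F)].
Proof.
by move=> [cF [dF C1 C2]]; split=> // p; have [] := dF p Logic.I;
  move=> *; exact: derivableP.
Qed.

Lemma Ck_on_lower k F : Ck_on k.+1 setT F -> Ck_on k setT F.
Proof.
elim: k F => [|k IH] F CF.
  by apply: Ck_onP => // p; exact: Ck_on_continuous CF p.
have [h1 h2 C1 C2] := Ck_on_derive CF.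
apply: Ck_onP; first by move=> p; exact: Ck_on_continuous CF p.
by do 2?eexists; split; [exact: h1|exact: h2|exact: IH|exact: IH].
Qed.

Lemma Ck_on_cst k c : Ck_on k setT (fun _ : R * R => c).
Proof.
elim: k c => [|k IH] c; apply: Ck_onP => //.
- by move=> p; exact: cst_continuous.
- by move=> p; exact: cst_continuous.
- by exists (fun _ => 0), (fun _ => 0); split=> // p; exact: is_derive_cst.
Qed.

Lemma Ck_on_add k F G : Ck_on k setT F -> Ck_on k setT G ->
  Ck_on k setT (fun p => F p + G p).
Proof.
elim: k F G => [|k IH] F G CF CG; apply: Ck_onP => //.
- by move=> p; apply: cvgD;
    [exact: Ck_on_continuous CF p|exact: Ck_on_continuous CG p].
- by move=> p; apply: cvgD;
    [exact: Ck_on_continuous CF p|exact: Ck_on_continuous CG p].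
have [F1 F2 CF1 CF2] := Ck_on_derive CF.
have [G1 G2 CG1 CG2] := Ck_on_derive CG.
do 2!eexists; split; [| |exact: IH CF1 CG1|exact: IH CF2 CG2] => p;
  exact: is_deriveD.
Qed.

Lemma Ck_on_mul k F G : Ck_on k setT F -> Ck_on k setT G ->
  Ck_on k setT (fun p => F p * G p).
Proof.
elim: k F G => [|k IH] F G CF CG; apply: Ck_onP => //.
- by move=> p; apply: cvgM;
    [exact: Ck_on_continuous CF p|exact: Ck_on_continuous CG p].
- by move=> p; apply: cvgM;
    [exact: Ck_on_continuous CF p|exact: Ck_on_continuous CG p].
have [F1 F2 CF1 CF2] := Ck_on_derive CF.
have [G1 G2 CG1 CG2] := Ck_on_derive CG.
exists (fun p => F p * 'D_(1, 0) G p + G p * 'D_(1, 0) F p),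
       (fun p => F p * 'D_(0, 1) G p + G p * 'D_(0, 1) F p).
split=> [p|p||]; [exact: is_deriveM|exact: is_deriveM| |];
  by apply: Ck_on_add; apply: IH => //; exact: Ck_on_lower.
Qed.

Lemma is_derive_compR (f : R -> R) F (p v : R * R) (d e : R) :
  is_derive (F p) 1 f d -> is_derive p v F e ->
  is_derive p v (fun q => f (F q)) (d * e).
Proof.
move=> fd /is_derive_lineP Fe; apply/is_derive_lineP.
have fd' : is_derive (F (0 *: v + p)) 1 f d by rewrite scale0r add0r.
exact: is_derive1_comp.
Qed.

Lemma Ck_on_inv k F : (forall p, F p != 0) -> Ck_on k setT F ->
  Ck_on k setT (fun p => (F p)^-1).
Proof.
move=> F0.
elim: k => [|k IH] CF; apply: Ck_onP => //.
- by move=> p; apply: cvgV => //; exact: Ck_on_continuous CF p.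
- by move=> p; apply: cvgV => //; exact: Ck_on_continuous CF p.
have [F1 F2 CF1 CF2] := Ck_on_derive CF.
have CV := IH (Ck_on_lower CF).
exists (fun p => -1 * ((F p)^-1 * (F p)^-1 * 'D_(1, 0) F p)),
       (fun p => -1 * ((F p)^-1 * (F p)^-1 * 'D_(0, 1) F p)).
have dinv p : is_derive (F p) 1 (fun x : R => x^-1) (- (F p ^- 2)).
  have := @is_deriveV R id (F p) 1 1 (F0 p) (is_derive_id _ _).
  by move/is_derive_eq; apply; rewrite /GRing.scale/= mulr1.
split=> [p|p||].
- have := is_derive_compR (dinv p) (F1 p); move/is_derive_eq; apply.
  by rewrite mulN1r mulNr -expr2 exprVn.
- have := is_derive_compR (dinv p) (F2 p); move/is_derive_eq; apply.
  by rewrite mulN1r mulNr -expr2 exprVn.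
- by do !apply: Ck_on_mul => //; exact: Ck_on_cst.
- by do !apply: Ck_on_mul => //; exact: Ck_on_cst.
Qed.

Lemma Ck_on_atan k F : Ck_on k setT F -> Ck_on k setT (fun p => atan (F p)).
Proof.
elim: k => [|k IH] CF; apply: Ck_onP => //.
- by move=> p; apply: continuous_comp; [exact: Ck_on_continuous CF p
    |exact: continuous_atan].
- by move=> p; apply: continuous_comp; [exact: Ck_on_continuous CF p
    |exact: continuous_atan].
have [F1 F2 CF1 CF2] := Ck_on_derive CF.
exists (fun p => (1 + F p * F p)^-1 * 'D_(1, 0) F p),
       (fun p => (1 + F p * F p)^-1 * 'D_(0, 1) F p).
have dat p := is_derive1_atan (F p).
have C1 : Ck_on k setT (fun p => (1 + F p * F p)^-1).
  apply: Ck_on_inv => [p|].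
    by rewrite gt_eqF// ltr_wpDr// -expr2 sqr_ge0.
  apply: Ck_on_add; first exact: Ck_on_cst.
  by apply: Ck_on_mul; exact: Ck_on_lower.
split=> [p|p||]; [exact: is_derive_compR|exact: is_derive_compR| |];
  exact: Ck_on_mul.
Qed.

Lemma Ck_on_fst k (f : R -> R) : smooth1 k f -> Ck_on k setT (fun p => f p.1).
Proof.
elim: k f => [|k IH] f sf; apply: Ck_onP => //.
- by move=> p; apply: continuous_comp; [exact: cvg_fst|exact: sf].
- by move=> p; apply: continuous_comp; [exact: cvg_fst
    |exact: smooth1_continuous sf _].
have [df fdf dfs] := sf.
exists (fun p => df p.1), (fun _ => 0); split=> [p|p||].
- apply/is_derive_lineP => /=.
  rewrite (_ : (fun h : R => _) = (fun h => f (h + p.1))).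
    by apply: is_derive1_shift; rewrite add0r.
  by apply/funext => h; rewrite /GRing.scale/= mulr1.
- apply/is_derive_lineP => /=.
  rewrite (_ : (fun h : R => _) = (fun h => f p.1)); first exact: is_derive_cst.
  by apply/funext => h; rewrite /GRing.scale/= mulr0 add0r.
- exact: IH.
- exact: Ck_on_cst.
Qed.

Lemma Ck_on_snd k (f : R -> R) : smooth1 k f -> Ck_on k setT (fun p => f p.2).
Proof.
elim: k f => [|k IH] f sf; apply: Ck_onP => //.
- by move=> p; apply: continuous_comp; [exact: cvg_snd|exact: sf].
- by move=> p; apply: continuous_comp; [exact: cvg_snd
    |exact: smooth1_continuous sf _].
have [df fdf dfs] := sf.
exists (fun _ => 0), (fun p => df p.2); split=> [p|p||].
- apply/is_derive_lineP => /=.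
  rewrite (_ : (fun h : R => _) = (fun h => f p.2)); first exact: is_derive_cst.
  by apply/funext => h; rewrite /GRing.scale/= mulr0 add0r.
- apply/is_derive_lineP => /=.
  rewrite (_ : (fun h : R => _) = (fun h => f (h + p.2))).
    by apply: is_derive1_shift; rewrite add0r.
  by apply/funext => h; rewrite /GRing.scale/= mulr1.
- exact: Ck_on_cst.
- exact: IH.
Qed.

Lemma smooth1_id k c : smooth1 k (fun x : R => x + c).
Proof.
have sc j (d : R) : smooth1 j (fun _ : R => d).
  by apply: bsmooth_smooth1; exact: bsmooth_cst.
case: k => [|k].
  by move=> x; apply: cvgD; [exact: cvg_id|exact: cvg_cst].
exists (fun _ => 1) => // x.
by apply: is_derive_eq; rewrite addr0.
Qed.

End plane_smooth.

(** * The projective action of SL(2,R) on the circle *)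

Section projective.
Variable R : realType.
Notation circle := (circle R).
Notation pr := (@circle_proj R).
Implicit Types (v w : R * R) (t y : R) (c : circle).

Lemma sin_norm_le (x : R) : `|sin x| <= `|x|.
Proof.
have := @Cb_MVT R 1 sin 0 x; rewrite sin0 !subr0 mul1r; apply.
split=> [y|]; first exact: sin_max.
exists cos => [y|]; first exact: is_derive_sin.
by split=> // y; exact: cos_max.
Qed.

Lemma norm_sin_addpi (x : R) (m : int) : `|sin (x + pi * m%:~R)| = `|sin x|.
Proof.
have nat_case (z : R) n : `|sin (z + pi * n%:R)| = `|sin z|.
  elim: n => [|n IH]; first by rewrite mulr0 addr0.
  by rewrite -addn1 natrD mulrDr mulr1 addrA sinDpi normrN.
case: m => n; first exact: nat_case.
by rewrite -(nat_case (x + _) n.+1) NegzE mulrNz mulrN subrK.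
Qed.

Lemma sin_lower t : `|t| <= 2^-1 -> `|t| <= `|sin (pi * t)|.
Proof.
wlog t0 : t / 0 <= t => [H|].
  have [/H//|/ltW t0] := leP 0 t.
  by rewrite -normrN -[`|sin _|]normrN -sinN -mulrN; apply: H; rewrite oppr_ge0.
rewrite ger0_norm// => t2.
have p0 := @pi_gt0 R; have p2 := @pi_ge2 R.
set x := pi * t.
have x0 : 0 <= x by rewrite mulr_ge0// ltW.
have xp : x <= pi / 2 by rewrite ler_pM2l.
have sx0 : 0 <= sin x by apply: sin_ge0_pi; rewrite x0/=; lra.
have cx0 : 0 <= cos x by apply: cos_ge0_pihalf; rewrite xp andbT; lra.
rewrite ger0_norm//.
(* If cos x < 1/2, then sin x > 1/2 >= t by Pythagoras. Otherwise sin x = x cos z with cos z >= cos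
   x >= 1/2, and pi >= 2. *)
have [c2|c2] := leP 2^-1 (cos x); last first.
  have := cos2Dsin2 x; nra.
have cs : {within `[0, x], continuous (@sin R)}.
  exact/continuous_subspaceT/continuous_sin.
have [z] := MVT_segment x0 (fun z _ => @is_derive_sin R z) cs.
rewrite in_itv/= => /andP[z0 zx]; rewrite sin0 !subr0 => ->.
have : cos x <= cos z.
  by rewrite leNgt ltr_cos ?in_itv/= ?x0 ?z0 -?leNgt//=; lra.
rewrite /x => cz; have : 2^-1 * 2 <= cos z * pi by rewrite ler_pM//; lra.
by rewrite mulrA mulVf// => h; rewrite ler_peMl.
Qed.

Lemma circle_proj_int t (m : int) : pr (t + m%:~R) = pr t.
Proof. by apply/circle_projP; rewrite addrAC subrr add0r intr_int. Qed.

(** The right side is the cross product of unit vectors on the two lines. Together with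
    [sin_le_circle_dist] it turns metric estimates on R/Z into estimates of cross products. *)
Lemma circle_dist_le_sin t y : mdist (pr t) (pr y) <= `|sin (pi * (t - y))|.
Proof.
set z := t - y.
pose m : int := Num.floor (z + 2^-1).
have m1 := floor_le (z + 2^-1); have m2 := floorD1_gt (z + 2^-1).
have zm : `|z - m%:~R| <= 2^-1.
  rewrite ler_norml; move: m2; rewrite intrD/= -/m mulr1z => m2.
  by move: m1; rewrite -/m => m1; apply/andP; split; lra.
have -> : pr t = pr (t - m%:~R).
  by rewrite -[in RHS](circle_proj_int _ m) subrK.
have -> : `|sin (pi * z)| = `|sin (pi * (z - m%:~R))|.
  by rewrite -[in RHS](norm_sin_addpi _ m) -mulrDr subrK.
apply: le_trans (sin_lower zm); apply: le_trans (circle_dist_le _ _) _.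
by rewrite addrAC.
Qed.

Lemma circle_mdist_le1 (x y : circle) : mdist x y <= 1.
Proof.
have [a <-] := circle_proj_surj x; have [b <-] := circle_proj_surj y.
exact: le_trans (circle_dist_le_sin _ _) (sin_max _).
Qed.

(** Other lifts change the difference by an integer, which leaves the absolute sine unchanged; then
    |sin u| <= |u| and pi <= 4. *)
Lemma sin_le_circle_dist t y : `|sin (pi * (t - y))| <= 4 * mdist (pr t) (pr y).
Proof.
rewrite -ler_pdivrMl// -[leRHS]/(circle_dist (pr t) (pr y)).
apply: lb_le_inf.
  by exists `|t - y|, t, y.
move=> _ [a [b [/esym/circle_projP ta /esym/circle_projP yb ->]]].
have /intrP[m mE] : (t - y) - (a - b) \is a Num.int.
  have -> : (t - y) - (a - b) = (t - a) - (y - b) by ring.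
  exact: rpredB.
have -> : t - y = a - b + m%:~R by rewrite -mE; ring.
rewrite mulrDr norm_sin_addpi ler_pdivrMl//.
apply: le_trans (sin_norm_le _) _.
rewrite normrM ler_wpM2r// ger0_norm ?pi_ge0//.
by have := @pihalf_lt2 R; lra.
Qed.

(** * Two-by-two matrices acting on lines *)

Record mat := Mat { e11 : R; e12 : R; e21 : R; e22 : R }.
Implicit Types M N : mat.

Definition mulm M N := Mat
  (e11 M * e11 N + e12 M * e21 N) (e11 M * e12 N + e12 M * e22 N)
  (e21 M * e11 N + e22 M * e21 N) (e21 M * e12 N + e22 M * e22 N).
Definition subm M N :=
  Mat (e11 M - e11 N) (e12 M - e12 N) (e21 M - e21 N) (e22 M - e22 N).
(** The inverse when the determinant is one; being linear in the entries, it keeps their bounds and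
    their smoothness. *)
Definition adjm M := Mat (e22 M) (- e12 M) (- e21 M) (e11 M).
Definition onem := Mat 1 0 0 1.
Definition detm M := e11 M * e22 M - e12 M * e21 M.
Definition app M v : R * R :=
  (e11 M * v.1 + e12 M * v.2, e21 M * v.1 + e22 M * v.2).
Definition diagm s := Mat s 0 0 s^-1.
Definition rotm t := Mat (cos t) (- sin t) (sin t) (cos t).

Lemma mat_eq M N : e11 M = e11 N -> e12 M = e12 N -> e21 M = e21 N ->
  e22 M = e22 N -> M = N.
Proof. by case: M N => ? ? ? ? [? ? ? ?] /= -> -> -> ->. Qed.

Lemma mulmA : associative mulm.
Proof. by move=> M N P; apply: mat_eq => /=; ring. Qed.
Lemma mulm1 M : mulm M onem = M.
Proof. by apply: mat_eq => /=; ring. Qed.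
Lemma detmM M N : detm (mulm M N) = detm M * detm N.
Proof. by rewrite /detm/=; ring. Qed.
Lemma detm_adj M : detm (adjm M) = detm M.
Proof. by rewrite /detm/=; ring. Qed.
Lemma detm1 : detm onem = 1. Proof. by rewrite /detm/=; ring. Qed.
Lemma detm_diag s : s != 0 -> detm (diagm s) = 1.
Proof. by move=> s0; rewrite /detm/= mulfV// mulr0 subr0. Qed.
Lemma detm_rot t : detm (rotm t) = 1.
Proof. by rewrite /detm/= -(cos2Dsin2 t); ring. Qed.
Lemma adjmM M N : adjm (mulm M N) = mulm (adjm N) (adjm M).
Proof. by apply: mat_eq => /=; ring. Qed.
Lemma mulVm M : detm M = 1 -> mulm (adjm M) M = onem.
Proof. by rewrite /detm => d1; apply: mat_eq => /=; rewrite -?d1; ring. Qed.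
Lemma mulmV M : detm M = 1 -> mulm M (adjm M) = onem.
Proof. by rewrite /detm => d1; apply: mat_eq => /=; rewrite -?d1; ring. Qed.
Lemma adjmK : involutive adjm.
Proof. by move=> M; apply: mat_eq => /=; rewrite ?opprK. Qed.

Lemma appM M N v : app (mulm M N) v = app M (app N v).
Proof. by congr pair => /=; ring. Qed.

(* The point [t] of R/Z stands for the line spanned by [dirv t]. *)
Definition dirv t : R * R := (cos (pi * t), sin (pi * t)).
Definition crossv v w : R := v.1 * w.2 - v.2 * w.1.
Definition dotv v w : R := v.1 * w.1 + v.2 * w.2.
Definition nrm2 v : R := v.1 ^+ 2 + v.2 ^+ 2.
Definition scalev r v : R * R := (r * v.1, r * v.2).

(** For nonzero [w], the representative in (-1/2, 1/2] of its line; the zero vector gets the default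
    1/2. *)
Definition angle w : R :=
  if w.1 == 0 then 2^-1 else atan (w.2 / w.1) / pi.

Lemma nrm2_dirv t : nrm2 (dirv t) = 1.
Proof. exact: cos2Dsin2. Qed.

Lemma cross_dirv t y : crossv (dirv t) (dirv y) = sin (pi * (y - t)).
Proof. by rewrite /crossv/= mulrBr sinB; ring. Qed.

Lemma angle_dirv w : exists r, w = scalev r (dirv (angle w)).
Proof.
have p0 := lt0r_neq0 (@pi_gt0 R).
case: w => w1 w2; rewrite /angle/=; case: eqP => [->|/eqP w10].
  by exists w2; rewrite /scalev/= cos_pihalf sin_pihalf mulr0 mulr1.
set th := atan _.
have cth : cos th != 0.
  by rewrite cos_atan invr_neq0// gt_eqF// sqrtr_gt0 ltr_wpDr// sqr_ge0.
exists (w1 / cos th); rewrite /scalev/dirv/= mulrCA divff// mulr1 divfK//.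
congr pair; rewrite -mulrA [_ * sin _]mulrC -[sin th / cos th]/(tan th) atanK.
by rewrite mulrC divfK.
Qed.

Lemma angle_scale r w : r != 0 -> angle (scalev r w) = angle w.
Proof.
move=> r0; rewrite /angle/= mulf_eq0 (negbTE r0)/=; case: eqP => // w0.
by rewrite -mulf_div divff// mul1r.
Qed.

Lemma nrm2_scale r t : nrm2 (scalev r (dirv t)) = r ^+ 2.
Proof. by rewrite /nrm2/= !exprMn -mulrDr cos2Dsin2 mulr1. Qed.

(* Both sides compare the angle between two lines: the cross product of [v] and
   [w] is the product of their lengths with the sine of that angle. *)
Lemma angle_dist k v w : 0 < k -> k <= nrm2 v -> k <= nrm2 w ->
  mdist (pr (angle v)) (pr (angle w)) * k <= `|crossv v w|.
Proof.
have [r vE] := angle_dirv v; have [s wE] := angle_dirv w.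
set a := angle v in vE *; set b := angle w in wE *.
move=> k0; rewrite vE wE !nrm2_scale => kr ks.
have -> : crossv (scalev r (dirv a)) (scalev s (dirv b)) =
    r * s * sin (pi * (b - a)).
  by rewrite -cross_dirv /crossv/=; ring.
rewrite normrM mulrC [mdist _ _]metric_sym.
apply: ler_pM (circle_dist_le_sin _ _); [exact: ltW|exact: mdist_ge0|].
rewrite -(@ler_pXn2r _ 2)// ?nnegrE ?normr_ge0 ?(ltW k0)//.
by rewrite -normrX ger0_norm ?sqr_ge0// exprMn expr2 ler_pM// ltW.
Qed.

Lemma angle_cross0 t w : crossv (dirv t) w = 0 -> 0 < nrm2 w ->
  pr (angle w) = pr t.
Proof.
move=> c0 w0; have [r wE] := angle_dirv w.
move: w0 c0; rewrite wE nrm2_scale -wE exprn_even_gt0//= => r0.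
rewrite wE.
have -> : crossv (dirv t) (scalev r (dirv (angle w))) =
    r * sin (pi * (angle w - t)).
  by rewrite -cross_dirv /crossv/=; ring.
move=> /eqP; rewrite mulf_eq0 (negbTE r0)/= => /eqP s0.
apply: (@mdist_positivity R circle); apply/eqP; rewrite eq_le mdist_ge0 andbT.
by rewrite -wE (le_trans (circle_dist_le_sin _ _))// s0 normr0.
Qed.

Definition act M c : circle := pr (angle (app M (dirv (repr c)))).

(** Another representative multiplies [dirv] by cos (pi m), which is nonzero, and [angle] ignores
    nonzero factors. *)
Lemma act_proj M t : act M (pr t) = pr (angle (app M (dirv t))).
Proof.
have /circle_projP/intrP[m mE] : pr (repr (pr t)) = pr t by exact: reprK.
suff [r r0 E] : exists2 r, r != 0 & dirv (repr (pr t)) = scalev r (dirv t).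
  rewrite /act E; have -> : app M (scalev r (dirv t)) =
      scalev r (app M (dirv t)) by congr pair => /=; ring.
  by rewrite angle_scale.
have -> : repr (pr t) = t + m%:~R by rewrite -mE; ring.
exists (cos (pi * m%:~R)).
  have := cos2Dsin2 (pi * m%:~R : R).
  have := norm_sin_addpi 0 m; rewrite add0r sin0 normr0 => /normr0_eq0 ->.
  by rewrite expr0n/= addr0 => h; apply/eqP => c0; move: h; rewrite c0 expr0n/=
    => /esym/eqP; rewrite oner_eq0.
have := norm_sin_addpi 0 m; rewrite add0r sin0 normr0 => /normr0_eq0 s0.
by rewrite /dirv/scalev/= mulrDr cosD sinD s0; congr pair; ring.
Qed.

Definition bndm K M : Prop :=
  [/\ `|e11 M| <= K, `|e12 M| <= K, `|e21 M| <= K & `|e22 M| <= K].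

Lemma norm_comb (x y a b K L : R) : `|x| <= K -> `|y| <= K -> `|a| <= L ->
  `|b| <= L -> `|x * a + y * b| <= 2 * (K * L).
Proof.
move=> xK yK aL bL; rewrite (le_trans (ler_normD _ _))// !normrM.
by rewrite mulr2n mulrDl !mul1r; apply: lerD; apply: ler_pM.
Qed.

Lemma bndmM K L M N : bndm K M -> bndm L N -> bndm (2 * (K * L)) (mulm M N).
Proof. by move=> [? ? ? ?] [? ? ? ?]; split; exact: norm_comb. Qed.

Lemma bndm_adj K M : bndm K M -> bndm K (adjm M).
Proof. by move=> [? ? ? ?]; split; rewrite /= ?normrN. Qed.

Lemma bndm_le K L M : K <= L -> bndm K M -> bndm L M.
Proof. by move=> KL [? ? ? ?]; split; exact: le_trans KL. Qed.

(** The inverse of M is its adjugate, whose entries obey the same bound; hence M shrinks lengths at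
    most by the factor 2 K. *)
Lemma nrm2_app K M v : detm M = 1 -> bndm K M ->
  nrm2 v <= 4 * K ^+ 2 * nrm2 (app M v).
Proof.
move=> d1 [aK bK cK dK].
have vE : v = app (adjm M) (app M v).
  rewrite -appM mulVm//; case: v => v1 v2; rewrite /app/=.
  by rewrite !mul1r !mul0r addr0 add0r.
set w := app M v in vE *.
have sq (x : R) : `|x| <= K -> x ^+ 2 <= K ^+ 2.
  by move=> xK; rewrite -(real_normK (num_real x)) lerXn2r ?nnegrE// (le_trans _
    xK).
have := sq _ aK; have := sq _ bK; have := sq _ cK; have := sq _ dK.
rewrite vE; move: {vE}w => [w1 w2]; rewrite /nrm2/=.
have comb x y : x ^+ 2 <= K ^+ 2 -> y ^+ 2 <= K ^+ 2 ->
    (x * w1 + y * w2) ^+ 2 <= 2 * K ^+ 2 * (w1 ^+ 2 + w2 ^+ 2).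
  move=> xK yK.
  have h1 : x ^+ 2 * w1 ^+ 2 <= K ^+ 2 * w1 ^+ 2 by rewrite ler_wpM2r// sqr_ge0.
  have h2 : y ^+ 2 * w2 ^+ 2 <= K ^+ 2 * w2 ^+ 2 by rewrite ler_wpM2r// sqr_ge0.
  have := sqr_ge0 (x * w1 - y * w2); move: h1 h2; nra.
move=> d2 c2 b2 a2.
have h1 := comb (e22 M) (- e12 M); have h2 := comb (- e21 M) (e11 M).
rewrite !sqrrN in h1 h2.
have := h1 d2 b2; have := h2 c2 a2; lra.
Qed.

(** Passing through [angle] only rescales the vector N v; the determinant guarantees, through
    [nrm2_app], that the scale is nonzero. *)
Lemma act_mul M N c : detm N = 1 -> act M (act N c) = act (mulm M N) c.
Proof.
move=> d1; have [t <-] := circle_proj_surj c; rewrite !act_proj appM.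
have [r rE] := angle_dirv (app N (dirv t)).
rewrite [in RHS]rE; have -> : app M (scalev r (dirv (angle (app N (dirv t))))) =
  scalev r (app M (dirv (angle (app N (dirv t))))) by congr pair => /=; ring.
rewrite angle_scale//; apply/eqP => r0.
have K : bndm (`|e11 N| + `|e12 N| + `|e21 N| + `|e22 N|) N.
  have := normr_ge0 (e11 N); have := normr_ge0 (e12 N).
  have := normr_ge0 (e21 N); have := normr_ge0 (e22 N); split; lra.
have := nrm2_app (dirv t) d1 K; rewrite rE r0 nrm2_dirv nrm2_scale expr0n/=
  mulr0.
by rewrite ler10.
Qed.

Lemma angle_dirvK t : pr (angle (dirv t)) = pr t.
Proof.
apply: angle_cross0; last by rewrite nrm2_dirv.
by rewrite cross_dirv subrr mulr0 sin0.
Qed.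

Lemma act_rot t c : act (rotm (pi * t)) c = c + pr t.
Proof.
have [y <-] := circle_proj_surj c; rewrite act_proj -circle_projD.
rewrite -(angle_dirvK (y + t)) /app /dirv/=; congr (pr (angle (_, _)));
  by rewrite mulrDr ?cosD ?sinD; ring.
Qed.

Lemma act1 c : act onem c = c.
Proof.
have -> : onem = rotm (pi * 0) by rewrite /rotm mulr0 cos0 sin0 oppr0.
by rewrite act_rot -[RHS]addr0; congr (_ + _); exact: raddf0.
Qed.

Lemma act_adjK M : detm M = 1 -> cancel (act M) (act (adjm M)).
Proof. by move=> d1 c; rewrite act_mul// mulVm// act1. Qed.

(** Determinant one preserves cross products and lengths shrink at most by 2 K, so the sine grows at
    most by 4 K^2; the remaining 4 comes from [sin_le_circle_dist]. *)
Lemma act_lip K M (c c' : circle) : detm M = 1 -> bndm K M ->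
  mdist (act M c) (act M c') <= 16 * K ^+ 2 * mdist c c'.
Proof.
move=> d1 MK; have [t <-] := circle_proj_surj c;
  have [y <-] := circle_proj_surj c'.
rewrite !act_proj.
have low z : 1 <= 4 * K ^+ 2 * nrm2 (app M (dirv z)).
  by rewrite -[leLHS](nrm2_dirv z) nrm2_app.
have K0 : 0 < 4 * K ^+ 2.
  rewrite mulr_gt0// lt0r sqr_ge0 andbT; apply/eqP => K0.
  by have := low 0; rewrite K0 mulr0 mul0r ler10.
have low' z : (4 * K ^+ 2)^-1 <= nrm2 (app M (dirv z)).
  by rewrite -[leLHS]mulr1 ler_pdivrMl.
have := angle_dist _ (low' t) (low' y); rewrite invr_gt0 => /(_ K0).
rewrite ler_pdivrMr// => /le_trans; apply.
have -> : crossv (app M (dirv t)) (app M (dirv y)) =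
    detm M * crossv (dirv t) (dirv y) by rewrite /crossv/detm/=; ring.
rewrite d1 mul1r cross_dirv metric_sym.
apply: (@le_trans _ _ (4 * mdist (pr y) (pr t) * (4 * K ^+ 2))); last lra.
by rewrite ler_wpM2r ?(ltW K0)// sin_le_circle_dist.
Qed.

(** The cross product of M u and N u is that of M u and (N - M) u, hence at most 8 K e; dividing by
    the lengths costs 4 K^2. *)
Lemma act_near K e M N c : detm M = 1 -> detm N = 1 -> bndm K M -> bndm K N ->
  bndm e (subm N M) -> mdist (act M c) (act N c) <= 32 * K ^+ 3 * e.
Proof.
move=> d1 d1' MK NK MNe; have [t <-] := circle_proj_surj c; rewrite !act_proj.
have low P : detm P = 1 -> bndm K P -> 1 <= 4 * K ^+ 2 * nrm2 (app P (dirv t)).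
  by move=> *; rewrite -[leLHS](nrm2_dirv t) nrm2_app.
have K0 : 0 < 4 * K ^+ 2.
  rewrite mulr_gt0// lt0r sqr_ge0 andbT; apply/eqP => K0.
  by have := low _ d1 MK; rewrite K0 mulr0 mul0r ler10.
have low' P : detm P = 1 -> bndm K P ->
    (4 * K ^+ 2)^-1 <= nrm2 (app P (dirv t)).
  by move=> dP PK; rewrite -[leLHS]mulr1 ler_pdivrMl// low.
have := angle_dist _ (low' _ d1 MK) (low' _ d1' NK); rewrite invr_gt0 =>
  /(_ K0).
rewrite ler_pdivrMr// => /le_trans; apply.
have -> : crossv (app M (dirv t)) (app N (dirv t)) =
    crossv (app M (dirv t)) (app (subm N M) (dirv t)).
  by rewrite /crossv/=; ring.
have [cu su] : `|(dirv t).1| <= 1 /\ `|(dirv t).2| <= 1.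
  by rewrite cos_max sin_max.
have h P L : bndm L P -> `|(app P (dirv t)).1| <= 2 * L /\
    `|(app P (dirv t)).2| <= 2 * L.
  by move=> [? ? ? ?]; rewrite -[L]mulr1; split; exact: norm_comb.
have [m1 m2] := h _ _ MK; have [s1 s2] := h _ _ MNe.
have -> : 32 * K ^+ 3 * e = 2 * (2 * K * (2 * e)) * (4 * K ^+ 2) by ring.
rewrite ler_wpM2r ?(ltW K0)// /crossv -mulNr.
by apply: norm_comb => //; rewrite normrN.
Qed.

Lemma act_diag s d t : 0 < s -> 0 < d -> d <= mdist (pr t) (pr 2^-1) ->
  mdist (act (diagm s) (pr t)) (pr 0) <= (s ^+ 2 * d)^-1.
Proof.
move=> s0 d0 dt; rewrite act_proj.
have cd : d <= `|cos (pi * t)|.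
  have := circle_dist_le_sin t 2^-1; rewrite mulrBr sinBpihalf normrN.
  exact: le_trans.
have [r rE] := angle_dirv (app (diagm s) (dirv t)).
set a := angle _ in rE *.
have /pair_equal_spec[/= r1 r2] := rE.
rewrite !mul0r addr0 add0r in r1 r2.
have h1 : s * d <= `|r|.
  rewrite (@le_trans _ _ `|r * cos (pi * a)|)//.
    by rewrite -r1 normrM gtr0_norm// ler_pM2l.
  by rewrite normrM ler_piMr// cos_max.
have h2 : `|r| * `|sin (pi * a)| <= s^-1.
  by rewrite -normrM -r2 normrM gtr0_norm ?invr_gt0// ler_piMr ?sin_max//
    invr_ge0 ltW.
have := circle_dist_le_sin a 0; rewrite subr0 => /le_trans; apply.
have sd0 : 0 < s * d by rewrite mulr_gt0.
have : s * d * `|sin (pi * a)| <= s^-1.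
  by apply: le_trans h2; rewrite ler_wpM2r.
rewrite -ler_pdivlMl// => /le_trans; apply.
by rewrite expr2 !invfM; rewrite mulrAC.
Qed.

(* Close to the identity, [M] turns the line of [dirv t] by less than a right
   angle, so the turning angle is the arctangent of cross product over dot
   product; this gives a lift of [act M] by elementary smooth functions. *)
Definition lift M t : R :=
  t + pi^-1 * atan (crossv (dirv t) (app M (dirv t)) *
                    (dotv (dirv t) (app M (dirv t)))^-1).

Lemma dotv_near1 M t : bndm 8^-1 (subm M onem) ->
  2^-1 <= dotv (dirv t) (app M (dirv t)).
Proof.
move=> [aK bK cK dK]; rewrite /dotv/=.
have := cos2Dsin2 (pi * t); set x := cos _; set y := sin _ => xy.
move: aK bK cK dK; rewrite /= !ler_norml => /andP[a1 a2] /andP[b1 b2]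
  /andP[c1 c2] /andP[d1 d2].
have h1 : 0 <= (e11 M - 1 + 8^-1) * x ^+ 2 by rewrite mulr_ge0 ?sqr_ge0//; lra.
have h2 : 0 <= (e22 M - 1 + 8^-1) * y ^+ 2 by rewrite mulr_ge0 ?sqr_ge0//; lra.
have xy2 : `|x * y| <= 2^-1.
  rewrite ler_norml; have := sqr_ge0 (x + y); have := sqr_ge0 (x - y).
  by rewrite sqrrB sqrrD => *; apply/andP; split; lra.
have bc : `|(e12 M + e21 M) * (x * y)| <= 4^-1 * 2^-1.
  rewrite normrM ler_pM// ler_norml; apply/andP; split; lra.
move: bc; rewrite ler_norml => /andP[bc _].
have -> : x * (e11 M * x + e12 M * y) + y * (e21 M * x + e22 M * y) =
  (e11 M - 1 + 8^-1) * x ^+ 2 + (e22 M - 1 + 8^-1) * y ^+ 2 +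
  (e12 M + e21 M) * (x * y) + (1 - 8^-1) * (x ^+ 2 + y ^+ 2) by ring.
rewrite xy; lra.
Qed.

(** After turning by [th] the cross product with w is cos th * cross - sin th * dot, which vanishes
    for tan th = cross / dot; so the two lines agree. *)
Lemma act_lift M t : bndm 8^-1 (subm M onem) -> act M (pr t) = pr (lift M t).
Proof.
move=> /dotv_near1 - /(_ t) dM; rewrite act_proj.
set w := app M (dirv t) in dM *.
have dw0 : dotv (dirv t) w != 0 by rewrite gt_eqF//; lra.
have w0 : 0 < nrm2 w.
  rewrite lt0r; apply/andP; split; last by rewrite /nrm2 addr_ge0// sqr_ge0.
  apply: contra dw0; rewrite /nrm2 paddr_eq0 ?sqr_ge0// !sqrf_eq0.
  by move=> /andP[/eqP w1 /eqP w2]; rewrite /dotv w1 w2 !mulr0 addr0.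
apply: angle_cross0 => //; rewrite /lift -/w.
set th := atan _.
have cth : cos th != 0.
  by rewrite cos_atan invr_neq0// gt_eqF// sqrtr_gt0 ltr_wpDr// sqr_ge0.
have -> : crossv (dirv (t + pi^-1 * th)) w =
    cos th * crossv (dirv t) w - sin th * dotv (dirv t) w.
  have E : pi * (t + pi^-1 * th) = pi * t + th :> R.
    by rewrite mulrDr mulVKf// lt0r_neq0// pi_gt0.
  by rewrite /crossv/dotv/dirv/= E cosD sinD; ring.
have -> : sin th = cos th * tan th by rewrite /tan mulrCA divff// mulr1.
by rewrite /th atanK -mulrA divfK// subrr.
Qed.

End projective.

(** * Skew products given by matrix cocycles *)

Section matrix_functions.
Variable R : realType.
Notation mat := (mat R).
Notation circle := (circle R).
Notation pr := (@circle_proj R).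
Implicit Types (M N : mat) (B : R -> mat) (i j : bool).

(** Boolean indices, with [true] for the first row or column, let one quantified statement cover all
    four entries. *)
Definition ent i j M : R :=
  if i then if j then e11 M else e12 M else if j then e21 M else e22 M.

Lemma entM i j M N : ent i j (mulm M N) =
  ent i true M * ent true j N + ent i false M * ent false j N.
Proof. by case: i j => [] []. Qed.

Lemma ent_adj i j M : ent i j (adjm M) = (-1) ^+ (i != j) * ent (~~ j) (~~ i) M.
Proof. by case: i j => [] [] /=; rewrite ?expr0 ?expr1 ?mul1r ?mulN1r. Qed.

Lemma entB i j M N : ent i j (subm M N) = ent i j M - ent i j N.
Proof. by case: i j => [] []. Qed.

Lemma ent_eq M N : (forall i j, ent i j M = ent i j N) -> M = N.
Proof.
by move=> E; apply: mat_eq; [exact: (E true true)|exact: (E true false)|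
  exact: (E false true)|exact: (E false false)].
Qed.

Lemma bndmP K M : bndm K M <-> forall i j, `|ent i j M| <= K.
Proof.
split=> [[? ? ? ?] [] []//|E]; split.
- exact: (E true true).
- exact: (E true false).
- exact: (E false true).
- exact: (E false false).
Qed.

Definition msmooth B := forall i j, bsmooth (fun x => ent i j (B x)).

Lemma bsmooth_eq (f g : R -> R) : f =1 g -> bsmooth f -> bsmooth g.
Proof. by move=> /funext ->. Qed.

Lemma msmooth_mul B B' : msmooth B -> msmooth B' ->
  msmooth (fun x => mulm (B x) (B' x)).
Proof.
move=> sB sB' i j.
apply: bsmooth_eq (bsmooth_add (bsmooth_mul (sB i true) (sB' true j))
  (bsmooth_mul (sB i false) (sB' false j))) => x.
by rewrite entM.
Qed.

Lemma msmooth_adj B : msmooth B -> msmooth (fun x => adjm (B x)).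
Proof.
move=> sB i j.
apply: bsmooth_eq (bsmooth_mul (bsmooth_cst ((-1) ^+ (i != j)))
  (sB (~~ j) (~~ i))) => x.
by rewrite ent_adj.
Qed.

Lemma msmooth_shift B t : msmooth B -> msmooth (fun x => B (x + t)).
Proof. by move=> sB i j; exact: (bsmooth_shift t (sB i j)). Qed.

Lemma msmooth_cst M : msmooth (fun _ => M).
Proof. by move=> i j; exact: bsmooth_cst. Qed.

Lemma msmooth_rot c : msmooth (fun x => rotm (c * x)).
Proof.
have [hc hs] := @bsmooth_cos_sin R c; move=> [] [] //=.
apply: bsmooth_eq (bsmooth_mul (bsmooth_cst (-1)) hs) => x.
by rewrite /= mulN1r.
Qed.

Lemma ex_bound4 (P : bool -> bool -> R -> Prop) :
  (forall i j C D, C <= D -> P i j C -> P i j D) ->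
  (forall i j, exists C, P i j C) ->
  exists2 C, 1 <= C & forall i j, P i j C.
Proof.
move=> mono exC.
have [a Pa] := exC true true; have [b Pb] := exC true false.
have [c Pc] := exC false true; have [d Pd] := exC false false.
have := ler_norm a; have := ler_norm b; have := ler_norm c; have := ler_norm d.
have := normr_ge0 a; have := normr_ge0 b; have := normr_ge0 c;
  have := normr_ge0 d.
move=> *; exists (1 + `|a| + `|b| + `|c| + `|d|); first lra.
by move=> [] []; [apply: mono Pa|apply: mono Pb|apply: mono Pc|apply: mono Pd];
  lra.
Qed.

Lemma msmooth_Cb B k : msmooth B ->
  exists2 C, 1 <= C & forall i j, Cb k C (fun x => ent i j (B x)).
Proof.
move=> sB; apply: ex_bound4; last by move=> i j; exact: sB.
by move=> i j C D CD; exact: Cb_le.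
Qed.

Lemma msmooth_bnd B : msmooth B -> exists2 K, 1 <= K & forall x, bndm K (B x).
Proof.
move=> /(msmooth_Cb 0)[C C1 BC]; exists C => // x; apply/bndmP => i j.
exact: Cb_bound (BC i j).
Qed.

Lemma msmooth_lip B : msmooth B ->
  exists2 K, 1 <= K & forall x y, bndm (K * `|x - y|) (subm (B x) (B y)).
Proof.
move=> /(msmooth_Cb 1)[C C1 BC]; exists C => // x y; apply/bndmP => i j.
by rewrite entB; exact: Cb_MVT (BC i j).
Qed.

(* The conjugated rotation depends on the rotation number in a Lipschitz way
   in every C^k norm: this is what makes the sequence of diffeomorphisms
   converge. *)
Lemma msmooth_conj_near B k : msmooth B -> exists2 C, 1 <= C & forall s t i j,
  Cb k (C * `|t - s|) (fun x => ent i j (mulm (B (x + t)) (adjm (B x))) -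
                                ent i j (mulm (B (x + s)) (adjm (B x)))).
Proof.
move=> sB.
have [C C1 BC] := msmooth_Cb k.+1 sB.
have [D D1 BD] := msmooth_Cb k (msmooth_adj sB).
exists (2 * (2 ^+ k * (C * D))).
  have : 1 * 1 <= C * D by rewrite ler_pM.
  have : 1 <= 2 ^+ k :> R by rewrite exprn_ege1// ler1n.
  by nra.
move=> s t i j.
have h l := Cb_mul (Cb_shiftB s t (BC i l)) (BD l j).
have := Cb_add (h true) (h false).
set f := (X in Cb _ _ X); set g := (X in _ -> Cb _ _ X).
have -> : f = g by apply/funext => x; rewrite /f/g !entM; ring.
by apply: Cb_le; rewrite le_eqVlt; apply/orP; left; apply/eqP; ring.
Qed.

End matrix_functions.

Section skew.
Variable R : realType.
Notation mat := (mat R).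
Notation circle := (circle R).
Notation pr := (@circle_proj R).

Definition skew (t : R) (M : R -> mat) (p : torus2 R) : torus2 R :=
  (p.1 + pr t, act (M (repr p.1)) p.2).

Record cocycle (M : R -> mat) : Prop := Cocycle {
  cocycle_per : forall x (m : int), M (x + m%:~R) = M x;
  cocycle_det : forall x, detm (M x) = 1;
  cocycle_bnd : exists2 K, 1 <= K & forall x, bndm K (M x);
  cocycle_lip : exists2 K, 1 <= K &
    forall x y, bndm (K * `|x - y|) (subm (M x) (M y)) }.

Lemma cocycle_repr M a : cocycle M -> M (repr (pr a)) = M a.
Proof.
move=> cM; have E : pr (repr (pr a)) = pr a by exact: reprK.
have /circle_projP/intrP[m mE] := E.
have -> : repr (pr a) = a + m%:~R by rewrite -mE; ring.
exact: cocycle_per.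
Qed.

Lemma skew_proj t M a c : cocycle M -> skew t M (pr a, c) = (pr (a + t),
  act (M a) c).
Proof. by move=> cM; rewrite /skew/= cocycle_repr// circle_projD. Qed.

(** This is the cocycle of the inverse skew product, which lies over the opposite rotation; so
    continuity and smoothness of the inverse follow from the same lemmas. *)
Lemma cocycle_inv t M : cocycle M -> cocycle (fun a => adjm (M (a - t))).
Proof.
move=> cM; split=> [x m|x||].
- by rewrite addrAC (cocycle_per cM).
- by rewrite detm_adj (cocycle_det cM).
- have [K K1 MK] := cocycle_bnd cM; exists K => // x; exact: bndm_adj.
have [K K1 MK] := cocycle_lip cM; exists K => // x y.
have := MK (x - t) (y - t).
have -> : x - t - (y - t) = x - y by ring.
by move=> /bndm_adj; congr bndm; apply: mat_eq => /=; ring.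
Qed.

Lemma skewK t M : cocycle M ->
  cancel (skew t M) (skew (- t) (fun a => adjm (M (a - t)))).
Proof.
move=> cM [x y]; have [a <-] := circle_proj_surj x.
rewrite skew_proj// skew_proj; last exact: cocycle_inv.
by rewrite addrK act_adjK// (cocycle_det cM).
Qed.

Lemma skewVK t M : cocycle M ->
  cancel (skew (- t) (fun a => adjm (M (a - t)))) (skew t M).
Proof.
move=> cM [x y]; have [a <-] := circle_proj_surj x.
rewrite skew_proj; last exact: cocycle_inv.
rewrite skew_proj// subrK -{1}[M _]adjmK act_adjK// detm_adj.
exact: (cocycle_det cM).
Qed.

(** The metric is an infimum over lifts, so a bound valid for all lifts descends to the circle. The
    slack D carries the contribution of the fibre coordinate. *)
Lemma circle_dist_lipP (F : circle -> circle -> R) C D : 0 < C ->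
  (forall a b, F (pr a) (pr b) <= C * `|a - b| + D) ->
  forall x y, F x y <= C * mdist x y + D.
Proof.
move=> C0 FC x y; rewrite -lerBlDr -ler_pdivrMl// -[leRHS]/(circle_dist x y).
apply: lb_le_inf.
  have [a <-] := circle_proj_surj x; have [b <-] := circle_proj_surj y.
  by exists `|a - b|, a, b.
by move=> _ [a [b [<- <- ->]]]; rewrite ler_pdivrMl// lerBlDr FC.
Qed.

Lemma act_cocycle_lip M : cocycle M -> exists2 L, 1 <= L &
  forall x y c c' : circle, mdist (act (M (repr x)) c) (act (M (repr y)) c') <=
    L * (mdist x y + mdist c c').
Proof.
move=> cM; have [K K1 MK] := cocycle_bnd cM; have [L L1 ML] := cocycle_lip cM.
have K3 : 1 <= K ^+ 3 by rewrite exprn_ege1.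
have K2 : 1 <= K ^+ 2 by rewrite exprn_ege1.
have KL : 1 * 1 <= K ^+ 3 * L by rewrite ler_pM.
exists (32 * (K ^+ 3 * L) + 16 * K ^+ 2); first lra.
move=> x y c c'.
have h : mdist (act (M (repr x)) c) (act (M (repr y)) c') <=
    32 * (K ^+ 3 * L) * mdist x y + 16 * K ^+ 2 * mdist c c'.
  apply: (circle_dist_lipP (F := fun x y =>
    mdist (act (M (repr x)) c) (act (M (repr y)) c'))); first lra.
  move=> a b; rewrite !cocycle_repr//.
  apply: le_trans (metric_triangle _ (act (M b) c) _) _; apply: lerD.
    have := act_near c (cocycle_det cM a) (cocycle_det cM b) (MK a) (MK b) (ML b
      a).
    by rewrite distrC !mulrA.
  by apply: act_lip => //; exact: (cocycle_det cM).
have d1 := mdist_ge0 x y; have d2 := mdist_ge0 c c'.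
apply: le_trans h _; nra.
Qed.

Lemma torus_mdist (p q : torus2 R) : mdist p q =
  Num.max (mdist p.1 q.1) (mdist p.2 q.2).
Proof. by []. Qed.

Lemma skew_lip t M : cocycle M -> exists2 L, 1 <= L &
  forall p q : torus2 R, mdist (skew t M p) (skew t M q) <= L * mdist p q.
Proof.
move=> cM; have [L L1 ML] := act_cocycle_lip cM; exists (2 * L); first lra.
move=> p q; rewrite !torus_mdist ge_max; set d := Num.max _ _.
have d1 : mdist p.1 q.1 <= d by rewrite le_max lexx.
have d2 : mdist p.2 q.2 <= d by rewrite le_max lexx orbT.
have d0 := mdist_ge0 p.1 q.1.
apply/andP; split; first by rewrite /skew/= circle_mdistD; nra.
apply: le_trans (ML _ _ _ _) _; nra.
Qed.

Lemma lip_continuous (X Y : metricType R) (f : X -> Y) L : 0 < L ->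
  (forall p q, mdist (f p) (f q) <= L * mdist p q) -> continuous f.
Proof.
move=> L0 fL p; apply/metricType_numDomainType.cvgrPdist_lt => e e0.
have eL : 0 < e / L by rewrite divr_gt0.
have := @metricType_numDomainType.cvgr_dist_lt R X _ _ (nbhs_filter p) id p
  cvg_id _ eL.
apply: filterS => q pq; apply: le_lt_trans (fL _ _) _.
by rewrite -ltr_pdivlMl// mulrC.
Qed.

Lemma skew_continuous t M : cocycle M -> continuous (skew t M).
Proof.
move=> cM; have [L L1 ML] := skew_lip t cM.
by apply: (@lip_continuous _ _ _ L) => //; lra.
Qed.

Definition skew_homeo t M (cM : cocycle M) : homeo (torus2 R) :=
  Homeo (@skewK t M cM) (@skewVK t M cM) (@skew_continuous t M cM)
    (@skew_continuous (- t) _ (cocycle_inv t cM)).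

(** A single chart suffices: [lift] is defined on the whole plane and composed of smooth functions,
    its denominator being at least 1/2 by [dotv_near1]. *)
Lemma skew_smooth t M : cocycle M -> (forall x,
  bndm 8^-1 (subm (M x) (onem R))) ->
  (forall k i j, smooth1 k (fun x => ent i j (M x))) -> torus_smooth (skew t M).
Proof.
move=> cM M1 sM p; exists setT, (fun p => (p.1 + t, lift (M p.1) p.2)).
split=> //; first exact: openT.
  move=> k; split; first by apply: (@Ck_on_fst R k (fun x => x + t));
    exact: smooth1_id.
  have [bc bs] := @bsmooth_cos_sin R pi.
  have sc := Ck_on_snd (bsmooth_smooth1 k bc).
  have ss := Ck_on_snd (bsmooth_smooth1 k bs).
  have m11 := Ck_on_fst (sM k true true);
    have m12 := Ck_on_fst (sM k true false).
  have m21 := Ck_on_fst (sM k false true);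
    have m22 := Ck_on_fst (sM k false false).
  rewrite (_ : snd \o _ = fun q : R * R => lift (M q.1) q.2)// /lift.
  apply: Ck_on_add.
    apply: (@Ck_on_snd R k id).
    by rewrite (_ : id = fun x => x + 0);
      [exact: smooth1_id|apply/funext => x; rewrite addr0].
  apply: Ck_on_mul; first exact: Ck_on_cst.
  apply: Ck_on_atan; apply: Ck_on_mul.
    rewrite /crossv/=; apply: Ck_on_add.
      by apply: Ck_on_mul => //; apply: Ck_on_add; exact: Ck_on_mul.
    rewrite (_ : (fun q : R * R => - _) = (fun q => -1 * (sin (pi * q.2) *
      (e11 (M q.1) * cos (pi * q.2) + e12 (M q.1) * sin (pi * q.2))))).
      apply: Ck_on_mul; first exact: Ck_on_cst.
      by apply: Ck_on_mul => //; apply: Ck_on_add; exact: Ck_on_mul.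
    by apply/funext => q; rewrite mulN1r.
  apply: Ck_on_inv => [q|].
    by have := dotv_near1 q.2 (M1 q.1); case: eqP => // ->;
      rewrite leNgt invr_gt0 ltr0n.
  rewrite /dotv/=; apply: Ck_on_add;
    by apply: Ck_on_mul => //; apply: Ck_on_add; exact: Ck_on_mul.
by move=> z _; rewrite /torus2_proj/= skew_proj// act_lift.
Qed.

Lemma bndm_adj1 e (M : mat) : bndm e (subm M (onem R)) ->
  bndm e (subm (adjm M) (onem R)).
Proof.
by case: M => a b c d [] /=; rewrite !subr0 => *; split;
  rewrite /= ?subr0 ?normrN.
Qed.

Lemma skew_diffeo t M (cM : cocycle M) :
  (forall x, bndm 8^-1 (subm (M x) (onem R))) ->
  (forall k i j, smooth1 k (fun x => ent i j (M x))) ->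
  torus_diffeo (skew_homeo t cM).
Proof.
move=> M1 sM; split; first exact: skew_smooth.
apply: skew_smooth; first exact: cocycle_inv.
  by move=> x; exact: bndm_adj1.
move=> k i j.
have cst_mul l c (f : R -> R) : smooth1 l f -> smooth1 l (fun x =>
  c * f (x - t)).
  elim: l f => [|l IH] f.
    move=> cf x; apply: cvgM; first exact: cvg_cst.
    apply: (@continuous_comp _ _ _ (fun x => x - t) f); last exact: cf.
    by apply: cvgB; [exact: cvg_id|exact: cvg_cst].
  move=> [df fdf dfs]; exists (fun x => c * df (x - t)) => [x|]; last exact: IH.
  by have := is_deriveZ c (is_derive1_shift (fdf (x - t))).
rewrite (_ : (fun x => _) = (fun x => (-1) ^+ (i !=
  j) * ent (~~ j) (~~ i) (M (x - t)))).
  exact: (cst_mul k _ _ (sM k (~~ j) (~~ i))).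
by apply/funext => x; rewrite ent_adj.
Qed.

End skew.

(** * The inductive step of the construction *)

Section counting.
Variable R : realType.
Notation circle := (circle R).
Notation pr := (@circle_proj R).

Lemma ex_nat_ge (x : R) : exists2 n : nat, (0 < n)%N & x <= n%:R.
Proof.
exists (Num.trunc `|x|).+1 => //; apply: le_trans (ler_norm x) _.
by apply: ltW; have /andP[] := truncn_itv (normr_ge0 x).
Qed.

Lemma sum_pred_le1 (P : pred nat) J :
  (forall b b', (b < J)%N -> (b' < J)%N -> P b -> P b' -> b = b') ->
  \sum_(0 <= b < J) (P b)%:R <= 1 :> R.
Proof.
elim: J => [|J IH] H; first by rewrite big_geq.
rewrite big_nat_recr//=.
have [PJ|PJ] := boolP (P J); last first.
  rewrite addr0; apply: IH => b b' bJ b'J; apply: H; exact: ltnW.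
rewrite big_nat big1 ?add0r// => b /andP[_ bJ].
have [Pb|//] := boolP (P b).
by have := H _ _ (ltnW bJ) (ltnSn J) Pb PJ => bE; rewrite bE ltnn in bJ.
Qed.

Lemma sum_nat_mul (F : nat -> R) J l :
  \sum_(0 <= i < J * l) F i =
  \sum_(0 <= a < l) \sum_(0 <= b < J) F (b * l + a)%N.
Proof.
rewrite exchange_big_nat/=; elim: J => [|J IH]; first by rewrite !big_geq.
rewrite mulSnr (@big_cat_nat _ _ _ (J * l))//= ?leq_addr// IH big_nat_recr//=.
congr (_ + _); have := @big_addn _ 0 +%R 0 (J * l + l) (J * l) predT F.
by rewrite add0n addKn => ->; apply: eq_bigr => i _; rewrite addnC.
Qed.

(** Any two lifts differ by an integer over J, and this integer is nonzero because b and b' are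
    distinct modulo J. *)
Lemma circle_dist_frac J (u : R) (b b' : nat) : (b < J)%N -> (b' < J)%N ->
  b != b' -> J%:R^-1 <= mdist (pr (u + b%:R / J%:R)) (pr (u + b'%:R / J%:R)).
Proof.
move=> bJ b'J bb'; have J0 : 0 < J%:R :> R by rewrite ltr0n (leq_trans _ bJ).
rewrite -[leRHS]/(circle_dist _ _); apply: lb_le_inf.
  by eexists; exists (u + b%:R / J%:R), (u + b'%:R / J%:R).
move=> _ [x [y [/circle_projP/intrP[m mE] /circle_projP/intrP[m' m'E] ->]]].
have -> : x - y = ((b%:Z - b'%:Z + (m - m') * J%:Z)%:~R) / J%:R.
  rewrite rmorphD rmorphM !rmorphB/= -!pmulrn -mE -m'E.
  by field; rewrite gt_eqF.
rewrite normrM [`|_^-1|]gtr0_norm ?invr_gt0// ler_peMl ?invr_ge0 ?(ltW J0)//.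
rewrite norm_intr_ge1 ?intr_int// intr_eq0; move: bb'; apply: contra.
rewrite -eqz_nat => /eqP E.
have [m0|m0] := eqVneq (m - m') 0; first by move: E; rewrite m0; lia.
exfalso; have : (m - m' <= -1) || (1 <= m - m') by lia.
by move=> /orP[h|h]; nia.
Qed.

(* Writing i = b l + a, for fixed [a] the [J] points indexed by [b] are [1/J]
   apart, so at most one of them falls into the bad arc of length [1/J]. *)
Lemma sum_bad_arc (J l : nat) (F : nat -> R) (e c : R) :
  (0 < J)%N -> (0 < l)%N -> 0 <= e -> (forall i, F i <= 1) ->
  (forall i, (2 * J%:R)^-1 <= mdist (pr (c + i%:R / (J * l)%:R)) (pr 2^-1) ->
    F i <= e) ->
  \sum_(0 <= i < J * l) F i <= l%:R + (J * l)%:R * e.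
Proof.
move=> J0 l0 e0 F1 Fe; rewrite sum_nat_mul.
have JR : 0 < J%:R :> R by rewrite ltr0n.
have lR : 0 < l%:R :> R by rewrite ltr0n.
suff H a : \sum_(0 <= b < J) F (b * l + a)%N <= 1 + J%:R * e.
  apply: le_trans (ler_sum _ (fun a _ => H a)) _.
  by rewrite sumr_const_nat subn0 -mulr_natr natrM; nra.
pose bad b := mdist (pr (c + a%:R / (J * l)%:R + b%:R / J%:R)) (pr 2^-1) <
  (2 * J%:R)^-1 :> R.
apply: (@le_trans _ _ (\sum_(0 <= b < J) ((bad b)%:R + e))).
  apply: ler_sum => b _; have [|nb] := boolP (bad b).
    by move=> _; rewrite (le_trans (F1 _))// lerDl.
  rewrite add0r Fe// leNgt; move: nb; rewrite /bad;
    congr (~~ (mdist (pr _) _ < _)).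
  rewrite natrD !natrM; field; rewrite !gt_eqF//.
rewrite big_split/=; apply: lerD;
  last by rewrite sumr_const_nat subn0 mulr_natl.
apply: sum_pred_le1 => b b' bJ b'J hb hb'.
apply/eqP/negPn/negP => bb'.
have := circle_dist_frac (c + a%:R / (J * l)%:R) bJ b'J bb'.
rewrite leNgt => /negP; apply.
apply: le_lt_trans (metric_triangle _ (pr 2^-1) _) _.
have E : (2 * J%:R)^-1 + (2 * J%:R)^-1 = J%:R^-1 :> R by field; rewrite gt_eqF.
by rewrite -[ltRHS]E; apply: ltrD; rewrite // metric_sym.
Qed.

Lemma cos_sin_add2pi (x : R) (m : int) :
  cos (x + pi * (2 * m%:~R)) = cos x /\ sin (x + pi * (2 * m%:~R)) = sin x.
Proof.
have nat_case (z : R) n : cos (z + pi * (2 * n%:R)) = cos z /\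
    sin (z + pi * (2 * n%:R)) = sin z.
  elim: n => [|n [IH1 IH2]]; first by rewrite !mulr0 addr0.
  have -> : z + pi * (2 * n.+1%:R) = z + pi * (2 * n%:R) + pi *+ 2.
    by rewrite -natr1 -mulr_natr; ring.
  by rewrite cosD2pi sinD2pi.
case: m => n; first exact: nat_case.
have [<- <-] := nat_case (x + pi * (2 * (Negz n)%:~R)) n.+1.
by rewrite NegzE mulrNz !mulrN subrK.
Qed.

End counting.

(** * Stages and the passage to the next stage *)

Section step.
Variable R : realType.
Notation mat := (mat R).
Notation circle := (circle R).
Notation pr := (@circle_proj R).

(* A stage of the construction: the conjugating cocycle [sB], the rotation
   number [sbeta], a positive integer [sq] such that [sq * sbeta] is an
   integer, the tolerance [stheta] left to all later stages, and the time
   window [sW] during which the later stages must respect it. *)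
Record state := State {
  sB : R -> mat; sq : nat; sbeta : R; stheta : R; sW : nat }.

Definition conjm (B : R -> mat) (t x : R) : mat := mulm (B (x +
  t)) (adjm (B x)).

Definition iterm (s : state) (i : nat) (x : R) : mat :=
  conjm (sB s) (i%:R * sbeta s) x.

Record good (s : state) : Prop := Good {
  good_per : forall x (m : int), sB s (x + m%:~R) = sB s x;
  good_det : forall x, detm (sB s x) = 1;
  good_smooth : msmooth (sB s);
  good_q : (0 < sq s)%N;
  good_int : (sq s)%:R * sbeta s \is a Num.int;
  good_theta : 0 < stheta s }.

(** The base 4 leaves room for Markov's inequality: a function of mean at most 4^-n exceeds 2^-n on
    a set of measure at most 2^-n, which is summable. *)
Definition eps (n : nat) : R := 4^-1 ^+ n.

(* The properties reached at a stage are stated for all matrices and base points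
   within the tolerance of that stage, so that they pass to the limit. *)
Definition near_orbit (s : state) (i : nat) (x : R) (M : mat) (t : R) : Prop :=
  [/\ detm M = 1, bndm (stheta s) (subm M (iterm s i x)) &
      `|t - (x + i%:R * sbeta s)| <= stheta s].

(** [step_iterm], [step_beta], [step_theta] and [step_W] make every iterate converge within the
    tolerance; [step_smooth] gives smoothness of the limit; [step_mean] keeps orbits near the graph
    of the previous stage; [step_dense], along multiples of m, gives minimality of iterates;
    [step_q] gives irrationality. *)
Record step (n : nat) (s s' : state) : Prop := Step {
  step_iterm : forall i x a b, (i <= sW s)%N ->
    `|ent a b (iterm s' i x) - ent a b (iterm s i x)| <= stheta s / 2;
  step_smooth : forall a b, Cb n (stheta s / 2)
    (fun x => ent a b (iterm s' 1 x) - ent a b (iterm s 1 x));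
  step_beta : sbeta s < sbeta s' /\
    (sbeta s' - sbeta s) * (sW s).+1%:R <= stheta s / 2;
  step_theta : stheta s' <= stheta s / 2;
  step_W : (sW s < sW s')%N;
  step_mean : exists N, [/\ (0 < N)%N, (N <= sW s')%N &
    forall x c (M : nat -> mat) (t : nat -> R),
      (forall i, (i < N)%N -> near_orbit s' i x (M i) (t i)) ->
      \sum_(0 <= i < N) mdist (act (M i) c) (act (sB s (t i)) (pr 0)) <=
        N%:R * eps n];
  step_dense : forall m, (0 < m)%N -> (m <= n.+1)%N -> forall x c xs ys,
    exists2 i, (m * i <= sW s')%N & forall M t, near_orbit s' (m * i) x M t ->
      mdist (pr t) xs <= eps n /\ mdist (act M c) ys <= eps n;
  step_q : stheta s' * (sq s')%:R <= n.+1%:R^-1 }.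

Lemma eps_gt0 n : 0 < eps n. Proof. by rewrite exprn_gt0. Qed.

Lemma mul_inv_le (C b : R) (N : nat) : (0 < N)%N -> 0 < b -> C / b <= N%:R ->
  C * N%:R^-1 <= b.
Proof.
move=> N0 b0; rewrite ler_pdivrMr// => h.
by rewrite ler_pdivrMr ?ltr0n// mulrC.
Qed.

Section construction.
Variables (B : R -> mat) (s : R) (Q : nat).
Hypothesis B_per : forall (x : R) (m : int), B (x + m%:~R) = B x.
Hypothesis B_det : forall x, detm (B x) = 1.
Hypothesis B_smooth : msmooth B.
Hypothesis s0 : 0 < s.

(* In each fibre, [diagm s] pushes everything but a small arc around its
   repelling point 1/2 close to 0, and the fast rotation by [2 Q x] moves
   that arc once around the circle while [x] runs through an interval of
   length [1/(2Q)]. Hence, for any fixed point of the fibre, few [x] are bad. *)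
Definition nextB (x : R) : mat :=
  mulm (B x) (mulm (diagm s) (rotm (pi * (2 * Q%:R) * x))).

Lemma nextB_rot (x t : R) : Q%:R * t \is a Num.int ->
  rotm (pi * (2 * Q%:R) * (x + t)) = rotm (pi * (2 * Q%:R) * x).
Proof.
move=> /intrP[m tm]; have -> : pi * (2 * Q%:R) * (x + t) =
    pi * (2 * Q%:R) * x + pi * (2 * m%:~R) by rewrite -tm; ring.
rewrite /rotm; by have [-> ->] := cos_sin_add2pi (pi * (2 * Q%:R) * x) m.
Qed.


Lemma nextB_det x : detm (nextB x) = 1.
Proof. by rewrite !detmM B_det detm_rot detm_diag ?gt_eqF// !mulr1. Qed.

Lemma nextB_smooth : msmooth nextB.
Proof.
apply: msmooth_mul => //; apply: msmooth_mul; first exact: msmooth_cst.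
exact: msmooth_rot.
Qed.

Lemma nextB_per x (m : int) : nextB (x + m%:~R) = nextB x.
Proof. by rewrite /nextB B_per nextB_rot// rpredM// ?natr_int// intr_int. Qed.

Lemma conj_nextB x t : Q%:R * t \is a Num.int -> conjm nextB t x = conjm B t x.
Proof.
move=> tQ; rewrite /conjm /nextB nextB_rot// adjmM.
set P := mulm (diagm s) _; have dP : detm P = 1.
  by rewrite detmM detm_rot detm_diag ?gt_eqF// mulr1.
by rewrite mulmA -(mulmA _ P) mulmV// mulm1.
Qed.

Lemma act_conj B1 t x c : (forall x, detm (B1 x) = 1) ->
  act (conjm B1 t x) c = act (B1 (x + t)) (act (adjm (B1 x)) c).
Proof. by move=> d1; rewrite act_mul// detm_adj d1. Qed.

Lemma act_nextB x c :
  act (nextB x) c = act (B x) (act (diagm s) (c + pr (2 * Q%:R * x))).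
Proof.
rewrite -act_rot mulrA !act_mul ?detmM ?detm_rot ?detm_diag ?gt_eqF ?mulr1//.
by rewrite /nextB mulmA.
Qed.

(** Since 2 Q b is an integer, a step by b' moves the fast angle 2 Q x by exactly 1/(J l) modulo 1.
    Outside an arc of length 1/J, [act_diag] leaves 2 J / s^2, and [act_lip] for B multiplies it by
    16 K^2. *)
Lemma nextB_mean (K b : R) (J l : nat) x c : (0 < Q)%N -> (0 < J)%N ->
  (0 < l)%N ->
  (forall x, bndm K (B x)) -> 2 * Q%:R * b \is a Num.int ->
  forall b', b' = b + (2 * Q%:R * (J * l)%:R)^-1 ->
  \sum_(0 <= i < J * l) mdist (act (nextB (x + i%:R * b')) c)
     (act (B (x + i%:R * b')) (pr 0)) <=
  l%:R + (J * l)%:R * (16 * K ^+ 2 * (2 * J%:R / s ^+ 2)).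
Proof.
move=> Q0 J0 l0 BK bQ b' b'E; have [y <-] := circle_proj_surj c.
have JR : 0 < J%:R :> R by rewrite ltr0n.
have lR : 0 < l%:R :> R by rewrite ltr0n.
have QR : 0 < Q%:R :> R by rewrite ltr0n.
apply: (@sum_bad_arc R J l _ _ (y + 2 * Q%:R * x)) => //.
- apply: mulr_ge0; first by rewrite mulr_ge0 ?sqr_ge0.
  by rewrite divr_ge0 ?sqr_ge0// mulr_ge0// ltW.
- by move=> i; exact: circle_mdist_le1.
move=> i hi; rewrite act_nextB.
apply: le_trans (act_lip _ _ (B_det _) (BK _)) _.
apply: ler_wpM2l; first by rewrite mulr_ge0// sqr_ge0.
have -> : pr y + pr (2 * Q%:R * (x + i%:R * b')) =
    pr (y + 2 * Q%:R * x + i%:R / (J * l)%:R).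
  rewrite -circle_projD; apply/circle_projP.
  suff -> : y + 2 * Q%:R * (x + i%:R * b') -
     (y + 2 * Q%:R * x + i%:R / (J * l)%:R) = i%:R * (2 * Q%:R * b).
    by rewrite rpredM// natr_int.
  by rewrite b'E natrM; field; rewrite !gt_eqF.
apply: le_trans (act_diag s0 _ hi) _; first by rewrite invr_gt0 mulr_gt0.
by rewrite invfM invrK mulrC.
Qed.

Lemma circle_dist_shift_le (a h : R) : mdist (pr (a + h)) (pr a) <= `|h|.
Proof. by apply: le_trans (circle_dist_le _ _) _; rewrite addrAC subrr add0r.
Qed.

(* Multiples of [2 Q] are taken as times because [2 Q b'] equals [1/L] modulo
   integers, so that the base points move by steps of [m/L]. *)
Lemma nextB_dense (K La K' La' b : R) (L m : nat) x c xs ys :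
  (0 < Q)%N -> (0 < L)%N -> (0 < m)%N ->
  0 <= K -> 0 <= La -> 0 <= K' -> 0 <= La' ->
  (forall x, bndm K (B x)) ->
  (forall x y, bndm (La * `|x - y|) (subm (B x) (B y))) ->
  (forall x, bndm K' (nextB x)) ->
  (forall x y, bndm (La' * `|x - y|) (subm (nextB x) (nextB y))) ->
  2 * Q%:R * b \is a Num.int ->
  let b' := b + (2 * Q%:R * L%:R)^-1 in
  let h := (2 * Q%:R)^-1 in let rho := m%:R / L%:R in
  exists2 i, (m * i <= 2 * Q * L)%N &
    mdist (pr (x + (m * i)%:R * b')) xs <= h + rho /\
    mdist (act (nextB (x + (m * i)%:R * b')) c) ys <=
      32 * K' ^+ 3 * (La' * rho) + 32 * K ^+ 3 * (La * h).
Proof.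
move=> Q0 L0 m0 K0 La0 K'0 La'0 BK BL BK' BL' bQ b' h rho.
have LR : 0 < L%:R :> R by rewrite ltr0n.
have mR : 0 < m%:R :> R by rewrite ltr0n.
have QR : 0 < Q%:R :> R by rewrite ltr0n.
have [a aE] := circle_proj_surj xs.
(* Working backwards from the target: B a follows [diagm s] and together they carry [w] to ys, so
   the fast rotation has to carry c to [w]. *)
pose zs := act (adjm (B a)) ys.
have ysE : ys = act (B a) zs by rewrite /zs -{1}[B a]adjmK act_adjK// detm_adj.
have ds : detm (diagm s) = 1 by rewrite detm_diag ?gt_eqF.
pose w := act (adjm (diagm s)) zs.
have zsE : zs = act (diagm s) w.
  by rewrite /w -{1}[diagm s]adjmK act_adjK// detm_adj.
have [r rE] := circle_proj_surj (w - c).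
pose fr (z : R) : R := z - (Num.floor z)%:~R.
have fr0 z : 0 <= fr z by rewrite subr_ge0 floor_le.
have fr1 z : fr z < 1.
  by rewrite ltrBlDr addrC -[1]/(1%:~R) -intrD floorD1_gt.
(* The smallest shift to the right of a for which 2 Q (a + h0) equals r modulo 1; it is at most one
   turn of the fast rotation. *)
pose h0 := fr (r - 2 * Q%:R * a) / (2 * Q%:R).
have h00 : 0 <= h0 by rewrite divr_ge0// mulr_ge0// ltW.
have h0h : h0 <= h by rewrite ler_pdivrMr ?mulr_gt0// mulVf ?gt_eqF ?mulr_gt0//
  ltW.
pose xx := a + h0.
have xxE : pr (2 * Q%:R * xx) = w - c.
  rewrite -rE; apply/circle_projP.
  have -> : 2 * Q%:R * xx - r = - (Num.floor (r - 2 * Q%:R * a))%:~R.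
    by rewrite /xx /h0 /fr; field; rewrite gt_eqF.
  by rewrite rpredN intr_int.
(* The way from x to xx along the circle. Every 2 Q m steps advance by m/L modulo 1, so k such
   blocks stop short of xx by a remainder [rh] of at most m/L. *)
pose tau := fr (xx - x).
pose k := Num.trunc (tau * L%:R / m%:R).
have tk : 0 <= tau * L%:R / m%:R by rewrite divr_ge0 ?(ltW mR)// mulr_ge0 ?(ltW
  LR)//; exact: fr0.
have /andP[k1 k2] := truncn_itv tk; rewrite -/k in k1 k2.
have k3 : k%:R * m%:R <= tau * L%:R by rewrite -ler_pdivlMr.
have k4 : tau * L%:R < k%:R * m%:R + m%:R.
  have -> : k%:R * m%:R + m%:R = k.+1%:R * m%:R :> R by rewrite -natr1; ring.
  by rewrite -ltr_pdivrMr.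
exists (2 * Q * k)%N.
  rewrite mulnCA leq_mul2l; apply/orP; right.
  rewrite -(ler_nat R) natrM mulrC (le_trans k3)// ler_piMl ?(ltW LR)//.
  exact/ltW/fr1.
pose rh := tau - k%:R * m%:R / L%:R.
have rh0 : 0 <= rh by rewrite subr_ge0 ler_pdivrMr.
have rhr : rh <= rho.
  rewrite /rh /rho lerBlDl -mulrDl ler_pdivlMr//; exact: ltW.
have [j jE] : exists j : int, x + (m * (2 * Q * k))%:R * b' = xx - rh + j%:~R.
  have /intrP[u uE] := bQ.
  exists ((m * k)%:Z * u - Num.floor (xx - x)).
  rewrite intrB intrM -uE /rh /tau /fr /b' -pmulrn !natrM.
  by field; rewrite !gt_eqF.
rewrite jE circle_proj_int nextB_per; split.
  rewrite -aE; have -> : xx - rh = a + (h0 - rh) by rewrite /xx addrA.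
  apply: le_trans (circle_dist_shift_le _ _) _.
  rewrite ler_norml; move: h00 h0h rh0 rhr.
  move: (h) (rho) (h0) (rh) => ? ? ? ? ? ? ? ?; apply/andP; split; lra.
apply: le_trans (metric_triangle _ (act (nextB xx) c) _) _; apply: lerD.
  apply: (@le_trans _ _ (32 * K' ^+ 3 * (La' * `|xx - (xx - rh)|))).
    apply: act_near; rewrite ?nextB_det//.
  rewrite ler_wpM2l ?mulr_ge0 ?exprn_ge0// ler_wpM2l//.
  by rewrite opprB addrC subrK ger0_norm.
rewrite act_nextB xxE addrC subrK -zsE ysE.
apply: (@le_trans _ _ (32 * K ^+ 3 * (La * `|a - xx|))).
  by apply: act_near.
rewrite ler_wpM2l ?mulr_ge0 ?exprn_ge0// ler_wpM2l//.
by rewrite /xx opprD addNKr normrN ger0_norm.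
Qed.

End construction.

(** One integer for finitely many demands C / N <= b; the parameters of the inductive step are
    chosen through it. *)
Lemma ex_nat_small (l : seq (R * R)) : all (fun p => 0 < p.2) l ->
  exists2 N : nat, (0 < N)%N & all (fun p => p.1 * N%:R^-1 <= p.2) l.
Proof.
move=> l0; suff [N N0 H] : exists2 N : nat, (0 < N)%N &
    all (fun p : R * R => p.1 / p.2 <= N%:R) l.
  exists N => //; apply/allP => p pl; apply: mul_inv_le => //.
    exact: (allP l0).
  exact: (allP H).
elim: l l0 => [|p l IH] /=; first by exists 1%N.
move=> /andP[p0 /IH[N N0 H]]; have [M M0 hM] := ex_nat_ge (p.1 / p.2).
exists (maxn M N); first by rewrite leq_max M0.
apply/andP; split; first by rewrite (le_trans hM)// ler_nat leq_maxl.
by apply: sub_all H => z /le_trans; apply; rewrite ler_nat leq_maxr.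
Qed.

Lemma bndm_near (e K : R) (M N : mat) : bndm e (subm M N) -> bndm K N ->
  bndm (e + K) M.
Proof.
move=> /bndmP h /bndmP k; apply/bndmP => i j.
have -> : ent i j M = (ent i j M - ent i j N) + ent i j N by rewrite subrK.
by rewrite (le_trans (ler_normD _ _))// lerD// -entB.
Qed.

(** The order of the choices matters: [J] bounds the share of bad times, [S] makes the contraction
    beat J and K^2, [j] makes the turns of the fast rotation short. Only then is [B'] known; its
    constants determine [l], hence the increment [d] of the rotation number, and finally the
    tolerance 1/N. *)
Lemma step_exists n (s : state) : good s -> exists s', good s' /\ step n s s'.
Proof.
case: s => B q b th W [/= per det sm q0 bq th0].
have [K K1 BK] := msmooth_bnd sm; have [La La1 BL] := msmooth_lip sm.
have e0 := eps_gt0 n; set e := eps n in e0.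
have e4 : 0 < e / 4 by rewrite divr_gt0.
have Kpos : 0 <= K by lra.
have Lapos : 0 <= La by lra.
have [|J J0 /=] := @ex_nat_small [:: (1, e / 4)]; first by rewrite /= e4.
rewrite andbT mul1r => hJ.
have JR : 0 < J%:R :> R by rewrite ltr0n.
have [|S S0 /=] := @ex_nat_small [:: (16 * K ^+ 2 * (2 * J%:R), e / 4)].
  by rewrite /= e4.
rewrite andbT => hS.
have S1 : 1 <= S%:R :> R by rewrite ler1n.
have SR : 0 < S%:R :> R by rewrite ltr0n.
have hS' : 16 * K ^+ 2 * (2 * J%:R / S%:R ^+ 2) <= e / 4.
  apply: le_trans hS; rewrite [leLHS]mulrA ler_wpM2l//.
    by rewrite !mulr_ge0 ?sqr_ge0// ltW.
  by rewrite lef_pV2 ?posrE ?exprn_gt0// expr2 ler_peMl// ltW.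
have [|j j0 /=] := @ex_nat_small [:: (1, e / 4); (32 * K ^+ 3 * La, e / 4)].
  by rewrite /= e4.
rewrite andbT mul1r => /andP[hj1 hj2].
have jR : 0 < j%:R :> R by rewrite ltr0n.
pose Q := (q * j)%N.
have Q0 : (0 < Q)%N by rewrite muln_gt0 q0.
have QR : 0 < Q%:R :> R by rewrite ltr0n.
have hQj : (2 * Q%:R)^-1 <= j%:R^-1 :> R.
  rewrite lef_pV2 ?posrE ?mulr_gt0// -natrM ler_nat /Q mulnA leq_pmull//.
  by rewrite muln_gt0.
have bQ : Q%:R * b \is a Num.int.
  by rewrite /Q natrM [_ * j%:R]mulrC -mulrA rpredM// natr_int.
have bQ2 : 2 * Q%:R * b \is a Num.int by rewrite -mulrA rpredM// natr_int.
pose B' := nextB B S%:R Q.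
have sm' : msmooth B' by exact: nextB_smooth.
have det' x : detm (B' x) = 1 by exact: nextB_det.
have [K' K'1 BK'] := msmooth_bnd sm'; have [La' La'1 BL'] := msmooth_lip sm'.
have [C C1 hC] := msmooth_conj_near n sm'.
have K'pos : 0 <= K' by lra.
have La'pos : 0 <= La' by lra.
have th2 : 0 < th / 2 by rewrite divr_gt0.
have [|l l0 /=] := @ex_nat_small [:: (C * W.+1%:R, th / 2); (n.+1%:R, e / 4);
    (32 * K' ^+ 3 * (La' * n.+1%:R), e / 4)].
  by rewrite /= e4 th2.
rewrite andbT => /and3P[hl1 hl2 hl3].
pose L := (J * l)%N.
have L0 : (0 < L)%N by rewrite muln_gt0 J0.
have LR : 0 < L%:R :> R by rewrite ltr0n.
have lR : 0 < l%:R :> R by rewrite ltr0n.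
have hLl : L%:R^-1 <= l%:R^-1 :> R.
  by rewrite lef_pV2 ?posrE// ler_nat leq_pmull.
have QLE : (2 * Q * L)%:R = 2 * Q%:R * L%:R :> R.
  by rewrite (natrM _ (2 * Q)) (natrM _ 2).
pose d : R := (2 * Q%:R * L%:R)^-1.
have d0 : 0 < d by rewrite invr_gt0 !mulr_gt0.
have dl : d <= l%:R^-1.
  rewrite lef_pV2 ?posrE ?mulr_gt0// -!natrM ler_nat /L mulnA leq_pmull//.
  by rewrite !muln_gt0/= ?q0 ?j0 ?J0.
pose b' := b + d.
(* Bounds every matrix within the tolerance th' <= 1 of an iterate, whose own entries are at most 2
   K'^2. *)
pose K2 : R := 2 * (K' * K') + 1.
have th1 : 0 < n.+1%:R^-1 :> R by rewrite invr_gt0.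
have [|N N0 /=] := @ex_nat_small [:: (1, th / 2); ((2 * Q * L)%:R, n.+1%:R^-1);
    (32 * K2 ^+ 3, e / 4); (32 * K ^+ 3 * La, e / 4); (1, e / 4)].
  by rewrite /= e4 th2 th1.
rewrite !mul1r andbT => /and5P[hN1 hN2 hN3 hN4 hN5].
pose th' : R := N%:R^-1.
have th'0 : 0 < th' by rewrite invr_gt0 ltr0n.
have th'1 : th' <= 1 by rewrite invf_le1 ?ltr0n// ler1n.
(* As Q b is an integer, so is (2 Q L) b'. The window grows by 2 Q L, enough for the mean, taken
   over L times, and for density, reached by time 2 Q L. *)
pose s' := State B' (2 * Q * L) b' th' (W + 2 * Q * L).
have itE i x : iterm (State B q b th W) i x = conjm B' (i%:R * b) x.
  by rewrite /iterm/= /B' conj_nextB// mulrCA rpredM// natr_int.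
have bnd_it i x : bndm (2 * (K' * K')) (iterm s' i x).
  by apply: bndmM => //; exact: bndm_adj.
have small i : (i <= W)%N -> C * `|i%:R * b' - i%:R * b| <= th / 2.
  move=> iW; rewrite -mulrBr /b' addrAC subrr add0r ger0_norm; last first.
    by rewrite mulr_ge0// ltW.
  apply: le_trans hl1; rewrite mulrA; apply: ler_pM => //.
  - by rewrite mulr_ge0//; lra.
  - exact: ltW.
  - by rewrite ler_wpM2l ?ler_nat ?(leqW iW)//; lra.
have nearP i x M t c : near_orbit s' i x M t ->
  mdist (act (iterm s' i x) c) (act M c) <= e / 4.
  move=> [dM hM _]; apply: le_trans hN3.
  apply: act_near => //.
  - by rewrite /iterm/conjm detmM detm_adj !det' mulr1.
  - by apply: bndm_le (bnd_it i x); rewrite /K2; lra.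
  - apply: bndm_le (bndm_near hM (bnd_it i x)); rewrite /K2 addrC lerD2l//.
have nearB i x M t : near_orbit s' i x M t ->
  mdist (act (B (x + i%:R * b')) (pr 0)) (act (B t) (pr 0)) <= e / 4.
  move=> [_ _ ht]; apply: le_trans hN4.
  apply: le_trans (act_near _ (det _) (det _) (BK _) (BK _) (BL _ _)) _.
  rewrite -[leRHS]mulrA ler_wpM2l ?ler_wpM2l//.
  by rewrite mulr_ge0// exprn_ge0.
exists s'; split; split => //=.
- by move=> x m; exact: nextB_per.
- by rewrite !muln_gt0/= ?q0 ?j0 ?J0 ?l0.
- rewrite /b' mulrDr rpredD//.
    have -> : (2 * Q * L)%:R * b = L%:R * (2 * Q%:R * b) by rewrite QLE; ring.
    by rewrite rpredM// natr_int.
  rewrite /d QLE mulfV ?rpred1//.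
  by apply: lt0r_neq0; rewrite !mulr_gt0.
- move=> i x a a' iW; rewrite itE /iterm/=.
  have := Cb_bound x (hC (i%:R * b) (i%:R * b') a a').
  by move=> /le_trans; apply; exact: small.
- move=> a a'; have := hC (1%:R * b) (1%:R * b') a a'.
  move=> h; have : Cb n (th / 2) (fun x => ent a a' (iterm s' 1 x) -
      ent a a' (conjm B' (1%:R * b) x)).
    (* When W is 0 the window misses time 1; the factor [W.+1] in [hl1] covers this case. *)
    apply: Cb_le h; case: (posnP W) => [W0|W0]; last exact: small.
    apply: le_trans hl1; rewrite W0 mulr1 -mulrBr mul1r /b' addrAC subrr add0r.
    by rewrite gtr0_norm// ler_wpM2l//; lra.
  by under [X in _ -> Cb _ _ X]eq_fun do rewrite itE.
- split; first by rewrite ltrDl.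
  rewrite /b' addrAC subrr add0r; apply: le_trans hl1; rewrite mulrC.
  rewrite -mulrA; apply: (@le_trans _ _ (W.+1%:R * l%:R^-1)).
    by rewrite ler_wpM2l.
  by rewrite ler_peMl// mulr_ge0// invr_ge0.
- by rewrite -[X in (X < _)%N]addn0 ltn_add2l !muln_gt0/= ?q0 ?j0 ?J0 ?l0.
- exists L; split => //;
    first by rewrite (leq_trans _ (leq_addl _ _))// leq_pmull// muln_gt0.
  move=> x c M t hMt.
  pose c0 := act (adjm (B' x)) c.
  have iE i : act (iterm s' i x) c = act (B' (x + i%:R * b')) c0.
    by rewrite act_conj.
  (* Four quarters of [e]: the perturbed matrix, the perturbed base point, the bad times, and the
     contraction at the other times. *)
  apply: (@le_trans _ _ (\sum_(0 <= i < L) (e / 4 + e / 4 +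
      mdist (act (B' (x + i%:R * b')) c0) (act (B (x + i%:R * b')) (pr 0))))).
    rewrite big_nat [leRHS]big_nat; apply: ler_sum => i /andP[_ iL].
    have h1 := nearP _ _ _ _ c (hMt i iL); have h2 := nearB _ _ _ _ (hMt i iL).
    rewrite iE metric_sym in h1.
    apply: le_trans (metric_triangle _ (act (B' (x + i%:R * b')) c0) _) _.
    rewrite -addrA; apply: lerD => //; rewrite addrC.
    by apply: le_trans (metric_triangle _ (act (B (x + i%:R * b')) (pr 0)) _) _;
      exact: lerD.
  rewrite big_split/= sumr_const_nat subn0 -[(_ + _) *+ L]mulr_natl.
  have hl : l%:R <= L%:R * (e / 4).
    have -> : L%:R = J%:R * l%:R :> R by rewrite natrM.
    by rewrite mulrAC ler_peMl ?(ltW lR)// -ler_pdivrMl// mulr1.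
  have hL : L%:R * (16 * K ^+ 2 * (2 * J%:R / S%:R ^+ 2)) <= L%:R * (e / 4).
    by rewrite ler_wpM2l// ltW.
  have hsum := @nextB_mean B S%:R Q det SR K b J l x c0 Q0 J0 l0 BK bQ2 b'
    erefl.
  apply: le_trans (lerD (lexx _) hsum) _.
  rewrite -/L -/e; move: hl hL; move: (L%:R * (16 * _ * _)) => y.
  by move=> *; lra.
- move=> m m0 mn x c xs ys; pose c0 := act (adjm (B' x)) c.
  have iE i : act (iterm s' i x) c = act (B' (x + i%:R * b')) c0.
    by rewrite act_conj.
  have [i iL [h1 h2]] := @nextB_dense B S%:R Q per det SR K La K' La' b L m x c0
    xs ys Q0 L0 m0 Kpos Lapos K'pos La'pos BK BL BK' BL' bQ2.
  rewrite -/d -/b' in h1 h2.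
  exists i; first by rewrite (leq_trans iL)// leq_addl.
  move=> M t hMt; have [_ _ ht] := hMt; rewrite /= in ht.
  have hm : m%:R / L%:R <= n.+1%:R * l%:R^-1 :> R.
    by apply: ler_pM => //; rewrite ?invr_ge0 ?ler_nat ?ltW.
  have m0' : 0 <= m%:R / L%:R :> R by rewrite divr_ge0 // ltW.
  split.
    have e' : mdist (pr t) (pr (x + (m * i)%:R * b')) <= e / 4.
      have := circle_dist_shift_le (x + (m * i)%:R * b') (t - (x +
        (m * i)%:R * b')).
      by rewrite addrC subrK => /le_trans; apply; exact: le_trans hN5.
    apply: le_trans (metric_triangle _ (pr (x + (m * i)%:R * b')) _) _.
    move: e' h1; rewrite -/e; move: (mdist _ _) (mdist _ _) => ? ?; lra.
  have h3 := nearP _ _ _ _ c hMt; rewrite iE metric_sym in h3.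
  apply: le_trans (metric_triangle _ (act (B' (x + (m * i)%:R * b')) c0) _) _.
  have h4 : 32 * K' ^+ 3 * (La' * (m%:R / L%:R)) <= e / 4.
    apply: le_trans hl3; rewrite -[leRHS]mulrA -(mulrA La').
    by rewrite ler_wpM2l ?ler_wpM2l// mulr_ge0// exprn_ge0.
  have h5 : 32 * K ^+ 3 * (La * (2 * Q%:R)^-1) <= e / 4.
    apply: le_trans hj2; rewrite -[leRHS]mulrA.
    by rewrite ler_wpM2l ?ler_wpM2l// mulr_ge0// exprn_ge0.
  move: h2 h3 h4 h5; rewrite -/e.
  move: (_ * (La' * _)) (_ * (La * _)) (mdist _ _) (mdist _ _) => ? ? ? ?; lra.
- by rewrite mulrC.
Qed.

End step.

(** * The limit diffeomorphism *)

(* [gam n] is the continuous graph obtained at stage [n] as the image of the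
   zero section under the conjugacy. *)
Record anosov_katok (R : realType) (phi : homeo (torus2 R)) (alpha : R)
    (gam : nat -> circle R -> circle R) (bt : nat -> R) : Prop := AnosovKatok {
  ak_diffeo : torus_diffeo phi;
  ak_irrational : irrational alpha;
  ak_skew : skew_product_over alpha phi;
  ak_lip : forall n, exists2 L, 1 <= L &
    forall x y, mdist (gam n x) (gam n y) <= L * mdist x y;
  ak_mean : forall n, exists2 N : nat, (0 < N)%N & forall p,
    \sum_(0 <= i < N) mdist (iter i phi p).2 (gam n (iter i phi p).1) <=
      N%:R * eps R n;
  ak_dense : forall n m, (0 < m)%N -> (m <= n.+1)%N -> forall p q,
    exists i, mdist (iter (m * i) phi p) q <= eps R n;
  ak_cauchy : forall n, exists2 N : nat, (0 < N)%N & exists tau : nat ->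
    circle R,
    forall x, \sum_(0 <= i < N) mdist (gam n.+1 (x + tau i)) (gam n (x +
      tau i)) <=
      N%:R * eps R n;
  ak_near : exists2 d : nat -> R, d @ \oo --> 0 & forall n x,
    mdist (phi (x, gam n x))
      ((x + circle_proj (bt n), gam n (x + circle_proj (bt n))) : torus2 R) <=
        d n }.

Section limit.
Variable R : realType.
Notation mat := (mat R).
Notation circle := (circle R).
Notation pr := (@circle_proj R).

Definition graph_of (s : state R) (c : circle) : circle :=
  act (sB s (repr c)) (pr 0).

Lemma good_cocycle (s : state R) : good s -> cocycle (sB s).
Proof.
move=> gs; split.
- exact: good_per gs.
- exact: good_det gs.
- exact: msmooth_bnd (good_smooth gs).
- exact: msmooth_lip (good_smooth gs).
Qed.

Lemma graph_of_proj s a : good s -> graph_of s (pr a) = act (sB s a) (pr 0).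
Proof. by move=> gs; rewrite /graph_of cocycle_repr//; exact: good_cocycle. Qed.

Lemma graph_of_lip s : good s -> exists2 L, 1 <= L &
  forall x y, mdist (graph_of s x) (graph_of s y) <= L * mdist x y.
Proof.
move=> /good_cocycle/act_cocycle_lip[L L1 hL]; exists L => // x y.
by apply: le_trans (hL _ _ _ _) _; rewrite mdistxx addr0.
Qed.

Lemma ex_steps : exists S : nat -> state R,
  [/\ forall x, sB (S 0%N) x = onem R, stheta (S 0%N) = 8^-1,
      forall n, good (S n) & forall n, step n (S n) (S n.+1)].
Proof.
have /choice[F hF] : forall p : nat * state R, exists s',
    good p.2 -> good s' /\ step p.1 p.2 s'.
  move=> [n s]; have [gs|gs] := pselect (good s); last by exists s.
  by have [s' hs'] := step_exists n gs; exists s'.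
(* 1/8 is the closeness to the identity required by [act_lift]; as the first tolerance it is
   inherited by the limit. *)
pose s0 := State (fun _ => onem R) 1 0 8^-1 0.
pose S := fix S n := if n is n'.+1 then F (n', S n') else s0.
have gS n : good (S n).
  elim: n => [|n IH]; last by have [] := hF (n, S n) IH.
  split => //=.
  - by move=> x; exact: detm1.
  - exact: msmooth_cst.
  - by rewrite mulr0 rpred0.
exists S; split => // n.
by have [] := hF (n, S n) (gS n).
Qed.

Variable S : nat -> state R.
Hypothesis S0B : forall x, sB (S 0%N) x = onem R.
Hypothesis S0t : stheta (S 0%N) = 8^-1.
Hypothesis gS : forall n, good (S n).
Hypothesis hS : forall n, step n (S n) (S n.+1).

Let th n := stheta (S n).
Let bt n := sbeta (S n).

Let th_gt0 n : 0 < th n. Proof. exact: good_theta (gS n). Qed.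
Let th_ge0 n : 0 <= th n. Proof. exact: ltW. Qed.
Let th_half n : th n.+1 <= th n / 2. Proof. exact: step_theta (hS n). Qed.
Let th_cvg : th @ \oo --> 0. Proof. exact: halving_cvg0. Qed.

Let W_mono n m : (n <= m)%N -> (sW (S n) <= sW (S m))%N.
Proof.
move=> /subnK <-; elim: (m - n)%N => [|j IH]; first by rewrite add0n.
by rewrite (leq_trans IH)// addSn ltnW// (step_W (hS _)).
Qed.

Let W_ge n : (n <= sW (S n))%N.
Proof. by elim: n => // n IH; rewrite (leq_ltn_trans IH)// (step_W (hS n)). Qed.

Let bt_step n i : (i <= sW (S n))%N ->
  `|i%:R * bt n.+1 - i%:R * bt n| <= th n / 2.
Proof.
move=> iW; have [b0 b1] := step_beta (hS n).
rewrite -mulrBr ger0_norm; last by rewrite mulr_ge0// subr_ge0 ltW.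
apply: le_trans b1; rewrite mulrC ler_wpM2l ?subr_ge0 ?ltW//.
by rewrite ltr_nat ltnS.
Qed.

(** The strict increase of the rotation numbers keeps alpha different from each of them, which the
    proof of irrationality requires. *)
Lemma ex_alpha : exists alpha : R,
  [/\ bt @ \oo --> alpha, forall n, bt n < alpha,
      forall n, `|alpha - bt n| <= th n &
      forall n i, (i <= sW (S n))%N -> `|i%:R * alpha - i%:R * bt n| <= th n].
Proof.
have h n : `|bt n.+1 - bt n| <= th n / 2.
  have [b0 b1] := step_beta (hS n); rewrite gtr0_norm ?subr_gt0//.
  by apply: le_trans b1; rewrite ler_peMr ?subr_ge0 ?(ltW b0)// ler1n.
have [alpha ha ha'] := halving_limit th_ge0 th_half (fun n (_ : (0 <= n)%N) =>
  h n).
exists alpha; split => //.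
- move=> n; apply: (@lt_le_trans _ _ (bt n.+1));
    first by case: (step_beta (hS n)).
  rewrite -(norm_cvg_lim ha); apply: nondecreasing_cvgn_le.
    by apply/nondecreasing_seqP => k; apply: ltW; case: (step_beta (hS k)).
  by apply/cvg_ex; exists alpha.
- by move=> n; exact: ha'.
move=> n i iW.
have [|l hl hl'] := @halving_limit R (fun k => i%:R * bt k) th n th_ge0 th_half.
  by move=> k nk; apply: bt_step; exact: leq_trans iW (W_mono nk).
have hl2 : (fun k => i%:R * bt k) @ \oo --> i%:R * alpha.
  by apply: cvgM => //; exact: cvg_cst.
by rewrite (norm_cvg_unique hl2 hl); exact: hl'.
Qed.

(** For alpha with denominator d, the number d q (alpha - beta) at stage d + 1 is a positive
    integer, yet by [step_q] at most d / (d + 1). *)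
Lemma irrational_alpha (alpha : R) : (forall n, bt n < alpha) ->
  (forall n, `|alpha - bt n| <= th n) -> irrational alpha.
Proof.
move=> ba hab [r _ rE].
pose d := `|denq r|%N.
have dE : denq r = d%:Z by rewrite /d gez0_abs// ltW// denq_gt0.
have d0 : (0 < d)%N by rewrite absz_gt0 denq_neq0.
have dR : 0 < d%:R :> R by rewrite ltr0n.
have da : d%:R * alpha \is a Num.int.
  rewrite -rE /ratr dE -[X in X * _]pmulrn mulrCA.
  by rewrite -pmulrn divff ?mulr1 ?intr_int// gt_eqF.
pose s := S d.+1.
have q0 : 0 < (sq s)%:R :> R by rewrite ltr0n (good_q (gS _)).
have ab0 : 0 < alpha - bt d.+1 by rewrite subr_gt0.
pose D := d%:R * (sq s)%:R * (alpha - bt d.+1).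
have DI : D \is a Num.int.
  have -> : D = (sq s)%:R * (d%:R * alpha) - d%:R * ((sq s)%:R * bt d.+1).
    by rewrite /D; ring.
  by apply: rpredB; apply: rpredM; rewrite ?natr_int//; exact: good_int (gS _).
have D0 : 0 < D by rewrite !mulr_gt0.
have D1 : D < 1.
  have h1 : alpha - bt d.+1 <= th d.+1.
    by apply: le_trans (hab _); exact: ler_norm.
  apply: (@le_lt_trans _ _ (d%:R * (th d.+1 * (sq s)%:R))).
    by rewrite /D -mulrA ler_wpM2l ?(ltW dR)// mulrC ler_wpM2r// ltW.
  apply: (@le_lt_trans _ _ (d%:R * d.+1%:R^-1)).
    by rewrite ler_wpM2l ?(ltW dR)//; exact: step_q (hS d).
  by rewrite ltr_pdivrMr// mul1r ltr_nat.
have := norm_intr_ge1 DI; rewrite gtr0_norm// leNgt D1.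
by move=> H; have := H (lt0r_neq0 D0).
Qed.

Let it n i x a b : R := ent a b (iterm (S n) i x).

Let it_step n i x a b : (i <= n)%N -> `|it n.+1 i x a b - it n i x a b| <=
  th n / 2.
Proof. by move=> iN; apply: (step_iterm (hS n)); exact: leq_trans (W_ge n). Qed.

Let ent_inj4 (f : bool -> bool -> R) : exists M : mat, forall a b, ent a b M =
  f a b.
Proof.
by exists (Mat (f true true) (f true false) (f false true) (f false false)) =>
  -[] [].
Qed.

Lemma ex_limit_cocycle : exists Mi : nat -> R -> mat, forall i x a b,
  (fun n => it n i x a b) @ \oo --> ent a b (Mi i x) /\
  forall n, (i <= sW (S n))%N -> `|ent a b (Mi i x) - it n i x a b| <= th n.
Proof.
suff H (p : nat * R) : exists M : mat, forall a b,
    (fun n => it n p.1 p.2 a b) @ \oo --> ent a b M /\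
    forall n, (p.1 <= sW (S n))%N -> `|ent a b M - it n p.1 p.2 a b| <= th n.
  have /choice[F hF] := H; exists (fun i x => F (i, x)) => i x.
  exact: (hF (i, x)).
case: p => i x /=.
have /choice[f hf] : forall ab : bool * bool, exists l : R,
    (fun n => it n i x ab.1 ab.2) @ \oo --> l /\
    forall n, (i <= sW (S n))%N -> `|l - it n i x ab.1 ab.2| <= th n.
  move=> [a b] /=.
  have [|l hl _] := @halving_limit R (fun n =>
    it n i x a b) th i th_ge0 th_half.
    by move=> n; exact: it_step.
  exists l; split => // n iW.
  have [|l' hl' hl2] := @halving_limit R (fun n =>
    it n i x a b) th n th_ge0 th_half.
    by move=> k nk; apply: (step_iterm (hS k)); exact: leq_trans iW (W_mono nk).
  by rewrite (norm_cvg_unique hl hl'); exact: hl2.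
have [M hM] := ent_inj4 (fun a b => f (a, b)).
by exists M => a b; rewrite hM; exact: (hf (a, b)).
Qed.

Section with_cocycle.
Variables (alpha : R) (Mi : nat -> R -> mat).
Hypothesis a_cvg : bt @ \oo --> alpha.
Hypothesis a_near : forall n, `|alpha - bt n| <= th n.
Hypothesis a_iter : forall n i, (i <= sW (S n))%N ->
  `|i%:R * alpha - i%:R * bt n| <= th n.
Hypothesis Mi_cvg : forall i x a b, (fun n => it n i x a b) @ \oo -->
  ent a b (Mi i x).
Hypothesis Mi_near : forall i x a b n, (i <= sW (S n))%N ->
  `|ent a b (Mi i x) - it n i x a b| <= th n.

Let M := Mi 1.

Let M_smooth k a b : smooth1 k (fun x => ent a b (M x)).
Proof.
apply: (@smooth1_limit R k (fun n x => it n 1 x a b) th _ k) => //.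
- move=> n; apply: bsmooth_smooth1.
  apply: (@msmooth_mul R (fun x => sB (S n) (x + 1%:R * bt n)) (fun x =>
    adjm (sB (S n) x))).
    by apply: msmooth_shift; exact: good_smooth (gS n).
  by apply: msmooth_adj; exact: good_smooth (gS n).
- by move=> n kn; apply: Cb_lower kn _; exact: (step_smooth (hS n)).
Qed.

Let it_per n i x (m : int) a b : it n i (x + m%:~R) a b = it n i x a b.
Proof.
rewrite /it /iterm /conjm addrAC; congr (ent a b (mulm _ (adjm _)));
  exact: (good_per (gS n)).
Qed.

Let Mi_per i x (m : int) : Mi i (x + m%:~R) = Mi i x.
Proof.
apply: ent_eq => a b; have h := @Mi_cvg i (x + m%:~R) a b.
apply: norm_cvg_unique h _.
rewrite (_ : (fun n => it n i (x + m%:~R) a b) = fun n => it n i x a b).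
  exact: Mi_cvg.
by apply/funext => n; exact: it_per.
Qed.

Let Mi_det i x : detm (Mi i x) = 1.
Proof.
have h : (fun n => detm (iterm (S n) i x)) @ \oo --> detm (Mi i x).
  apply: cvgB; apply: cvgM.
  - exact: (@Mi_cvg i x true true).
  - exact: (@Mi_cvg i x false false).
  - exact: (@Mi_cvg i x true false).
  - exact: (@Mi_cvg i x false true).
apply: norm_cvg_unique h _.
rewrite (_ : (fun n => detm _) = fun _ => 1); first exact: cvg_cst.
apply/funext => n; rewrite /iterm /conjm detmM detm_adj.
by rewrite !(good_det (gS n)) mulr1.
Qed.

Let M_near n x : bndm (th n) (subm (M x) (iterm (S n) 1 x)).
Proof.
apply/bndmP => a b; rewrite entB.
case: n => [|n]; last by apply: Mi_near; exact: leq_trans (W_ge n.+1).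
have h1 : `|ent a b (M x) - it 1 1 x a b| <= th 1 by apply: Mi_near;
  exact: W_ge.
have h0 := Cb_bound x (step_smooth (hS 0) a b).
rewrite -(subrK (it 1 1 x a b) (ent a b (M x))) -addrA.
rewrite (le_trans (ler_normD _ _))// (splitr (th 0)); apply: lerD => //.
exact: le_trans h1 (th_half 0).
Qed.

Let M_near1 x : bndm 8^-1 (subm (M x) (onem R)).
Proof.
have := M_near 0 x; rewrite -S0t; congr (bndm _ (subm _ _)).
by rewrite /iterm /conjm !S0B mulmV// detm1.
Qed.

Let iterm_bnd n x : bndm 3 (iterm (S n) 1 x).
Proof.
have th1 : th n <= 1.
  elim: n => [|n IH]; first by rewrite /th S0t; lra.
  have := th_half n; lra.
have /bndmP hM := M_near n x; have /bndmP h1 := M_near1 x.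
have /bndmP h0 : bndm 1 (onem R) by split; rewrite /= ?normr1 ?normr0.
apply/bndmP => a b; have := hM a b; have := h1 a b; have := h0 a b.
rewrite !entB !ler_norml => /andP[? ?] /andP[? ?] /andP[? ?].
by apply/andP; split; lra.
Qed.

Let M_bnd x : bndm 2 (M x).
Proof.
have /bndm_near/(_ (_ : bndm 1 (onem R))) := M_near1 x.
have b1 : bndm 1 (onem R) by split; rewrite /= ?normr1 ?normr0.
by move=> /(_ b1); apply: bndm_le; lra.
Qed.

Let M_lip : exists2 K, 1 <= K & forall x y,
  bndm (K * `|x - y|) (subm (M x) (M y)).
Proof.
have sm1 : msmooth (iterm (S 1) 1).
  apply: (@msmooth_mul R (fun x => sB (S 1) (x + 1%:R * bt 1)) (fun x =>
    adjm (sB (S 1) x))).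
    by apply: msmooth_shift; exact: good_smooth (gS 1).
  by apply: msmooth_adj; exact: good_smooth (gS 1).
have [K K1 hK] := msmooth_lip sm1.
exists (K + th 1); first by have := th_ge0 1; lra.
move=> x y; apply/bndmP => a b; rewrite entB.
pose u n := it n 1 x a b - it n 1 y a b.
have e0 n : 0 <= th n * `|x - y| by rewrite mulr_ge0.
have eh n : th n.+1 * `|x - y| <= th n * `|x - y| / 2.
  by rewrite mulrAC ler_wpM2r.
have [|l hl hl'] := @halving_limit R u (fun n => th n * `|x - y|) 1 e0 eh.
  move=> n n1; have := Cb_MVT y x (Cb_lower n1 (step_smooth (hS n) a b)).
  rewrite mulrAC; congr (`|_| <= _); rewrite /u /it; ring.
have lE : l = ent a b (M x) - ent a b (M y).
  by apply: norm_cvg_unique hl _; apply: cvgB; exact: Mi_cvg.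
rewrite -lE; have h1 := hl' 1 (leqnn 1).
have /bndmP/(_ a b) := hK x y; rewrite entB -/(u 1) => h2.
rewrite -[l](subrK (u 1)) (le_trans (ler_normD _ _))// addrC mulrDl.
exact: lerD.
Qed.

Let cM : cocycle M.
Proof.
split; [exact: Mi_per|exact: Mi_det| |exact: M_lip].
by exists 2; [lra|exact: M_bnd].
Qed.

Let M_cont a b : continuous (fun x => ent a b (M x)).
Proof. exact: (M_smooth 0). Qed.

Let Mi_succ i x : Mi i.+1 x = mulm (M (x + i%:R * alpha)) (Mi i x).
Proof.
have h1 a b : (fun n => it n 1 (x + i%:R * bt n) a b) @ \oo -->
    ent a b (M (x + i%:R * alpha)).
  have h2 : (fun n => ent a b (M (x + i%:R * bt n))) @ \oo -->
      ent a b (M (x + i%:R * alpha)).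
    apply: (@cvg_comp _ _ _ (fun n => x + i%:R * bt n) (fun x =>
      ent a b (M x)) _
      (nbhs (x + i%:R * alpha))); last exact: M_cont.
    have h0 : (fun n => i%:R * bt n) @ \oo --> i%:R * alpha.
      by apply: cvgM; [exact: cvg_cst|exact: a_cvg].
    by apply: cvgD h0; exact: cvg_cst.
  have h3 : (fun n => it n 1 (x + i%:R * bt n) a b - ent a b (M (x +
    i%:R * bt n)))
      @ \oo --> 0.
    apply/cvgrPdist_le => e e0.
    have /cvgrPdist_le/(_ _ e0)[N _ hN] := th_cvg.
    exists (maxn 1 N) => // n /=; rewrite geq_max => /andP[n1 Nn].
    have := hN n Nn; rewrite !sub0r !normrN ger0_norm//; apply: le_trans.
    by rewrite distrC; apply: Mi_near; exact: leq_trans (W_ge n).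
  rewrite (_ : (fun n => it n 1 _ a b) = fun n =>
      (it n 1 (x + i%:R * bt n) a b - ent a b (M (x + i%:R * bt n))) +
      ent a b (M (x + i%:R * bt n))).
    by rewrite -[X in _ --> X]add0r; exact: (cvgD h3 h2).
  by apply/funext => n; rewrite subrK.
have E n : iterm (S n) i.+1 x = mulm (iterm (S n) 1 (x +
  i%:R * bt n)) (iterm (S n) i x).
  rewrite /iterm /conjm mulmA -(mulmA _ (adjm _)) mulVm ?(good_det (gS n))//
    mulm1.
  congr (mulm (sB _ _) _); rewrite -natr1 -/(bt n); ring.
apply: ent_eq => a b; have h := @Mi_cvg i.+1 x a b.
apply: norm_cvg_unique h _; rewrite entM.
rewrite (_ : (fun n => it n i.+1 x a b) = fun n =>
    it n 1 (x + i%:R * bt n) a true * it n i x true b +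
    it n 1 (x + i%:R * bt n) a false * it n i x false b).
  apply: cvgD.
    by apply: cvgM; [exact: h1|exact: Mi_cvg].
  by apply: cvgM; [exact: h1|exact: Mi_cvg].
by apply/funext => n; rewrite /it E entM.
Qed.

Let Mi0 x : Mi 0 x = onem R.
Proof.
apply: ent_eq => a b; have h := @Mi_cvg 0 x a b.
apply: norm_cvg_unique h _.
rewrite (_ : (fun n => _) = fun _ => ent a b (onem R)); first exact: cvg_cst.
apply/funext => n.
by rewrite /it /iterm /conjm mul0r addr0 mulmV// (good_det (gS n)).
Qed.

Let phi := skew_homeo alpha cM.

Let phi_iter i x c : iter i phi (pr x, c) = (pr (x + i%:R * alpha),
  act (Mi i x) c).
Proof.
elim: i => [|i IH]; first by rewrite mul0r addr0 Mi0 act1.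
rewrite iterS IH -[LHS]/(skew alpha M _) skew_proj// Mi_succ act_mul//.
by congr (pr _, _); rewrite -natr1; ring.
Qed.

Let near_phi n i x : (i <= sW (S n))%N ->
  near_orbit (S n) i x (Mi i x) (x + i%:R * alpha).
Proof.
move=> iW; split => //.
  by apply/bndmP => a b; rewrite entB; exact: Mi_near.
have -> : x + i%:R * alpha - (x + i%:R * sbeta (S n)) =
    i%:R * alpha - i%:R * bt n by rewrite /bt; ring.
exact: a_iter.
Qed.

Lemma anosov_katok_limit : (forall n, bt n < alpha) ->
  exists phi : homeo (torus2 R), anosov_katok phi alpha (fun n =>
    graph_of (S n)) bt.
Proof.
move=> a_gt; exists phi; split.
- exact: skew_diffeo.
- exact: irrational_alpha a_gt a_near.
- by exists (fun x y => act (M (repr x)) y).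
- by move=> n; exact: graph_of_lip.
- move=> n; have [N [N0 NW hN]] := step_mean (hS n); exists N => // -[x c].
  have [a <-] := circle_proj_surj x.
  have := hN a c (fun i => Mi i a) (fun i => a + i%:R * alpha).
  move=> /(_ (fun i iN => near_phi a (leq_trans (ltnW iN) NW))).
  congr (_ <= _); apply: eq_bigr => i _.
  by rewrite phi_iter/= graph_of_proj.
- move=> n m m0 mn [x c] [xs ys]; have [a <-] := circle_proj_surj x.
  have [i iW hi] := step_dense (hS n) m0 mn a c xs ys.
  have [h1 h2] := hi _ _ (near_phi a iW); exists i.
  rewrite phi_iter torus_mdist ge_max; apply/andP; split; [exact: h1|exact: h2].
- move=> n; have [N [N0 NW hN]] := step_mean (hS n); exists N => //.
  exists (fun i => pr (i%:R * bt n.+1)) => x; have [a <-] := circle_proj_surj x.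
  pose c := act (sB (S n.+1) a) (pr 0).
  have := hN a c (fun i => iterm (S n.+1) i a) (fun i => a + i%:R * bt n.+1).
  have no i : (i < N)%N ->
      near_orbit (S n.+1) i a (iterm (S n.+1) i a) (a + i%:R * bt n.+1).
    move=> _; split.
    - by rewrite /iterm /conjm detmM detm_adj !(good_det (gS _)) mulr1.
    - by apply/bndmP => u v; rewrite entB subrr normr0; exact: th_ge0.
    - by rewrite subrr normr0; exact: th_ge0.
  move=> /(_ no); congr (_ <= _); apply: eq_bigr => i _.
  rewrite -circle_projD !graph_of_proj//; congr (mdist _ _).
  rewrite /iterm act_conj; last exact: good_det.
  by rewrite /c act_adjK// (good_det (gS _)).
- exists (fun n => 864 * th n).
    rewrite -[X in _ --> X](mulr0 864); apply: cvgM; first exact: cvg_cst.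
    exact: th_cvg.
  move=> n x; have [a <-] := circle_proj_surj x.
  rewrite -[phi _]/(skew alpha M _) skew_proj// -circle_projD !graph_of_proj//.
  rewrite torus_mdist ge_max /=; apply/andP; split.
    apply: le_trans (circle_dist_le _ _) _.
    have -> : a + alpha - (a + bt n) = alpha - bt n by ring.
    apply: le_trans (a_near n) _; have := th_ge0 n; lra.
  have E : act (sB (S n) (a + bt n)) (pr 0) =
      act (iterm (S n) 1 a) (act (sB (S n) a) (pr 0)).
    rewrite /iterm act_conj; last exact: good_det.
    by rewrite act_adjK ?(good_det (gS n))// mul1r.
  rewrite E metric_sym.
  have dI : detm (iterm (S n) 1 a) = 1.
    by rewrite /iterm /conjm detmM detm_adj !(good_det (gS _)) mulr1.
  have bM : bndm 3 (M a) by apply: bndm_le (M_bnd a); lra.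
  have dM : detm (M a) = 1 by exact: Mi_det.
  apply: le_trans (act_near _ dI dM (iterm_bnd n a) bM (M_near n a)) _.
  by rewrite le_eqVlt; apply/orP; left; apply/eqP; ring.
Qed.

End with_cocycle.

End limit.

Theorem anosov_katok_exists (R : realType) :
  exists (phi : homeo (torus2 R)) (alpha : R) gam bt,
    anosov_katok phi alpha gam bt.
Proof.
have [S [S0B S0t gS hS]] := ex_steps R.
have [alpha [h1 h2 h3 h4]] := ex_alpha gS hS.
have [Mi hMi] := ex_limit_cocycle gS hS.
have [phi hphi] := anosov_katok_limit S0B S0t gS hS h1 h3 h4
  (fun i x a b => (hMi i x a b).1) (fun i x a b => (hMi i x a b).2) h2.
by exists phi, alpha; do 2!eexists; exact: hphi.
Qed.

(** * Minimality, mean equicontinuity and the maximal equicontinuous factor *)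

Section compact_metric.
Variable R : realType.

Lemma compact_uniform (X : metricType R) (Y : pseudoMetricType R) (f : X -> Y) :
  compact [set: X] -> continuous f -> forall e, 0 < e ->
  exists2 d : R, 0 < d & forall x y : X, mdist x y < d -> ball (f x) e (f y).
Proof.
move=> /compact_near_coveringP cX cf e e0.
have e2 : 0 < e / 2 by rewrite divr_gt0.
pose P (d : R) (x : X) := forall y : X, mdist x y < d -> ball (f x) e (f y).
have H : \forall d \near (0 : R)^'+, [set: X] `<=` P d.
  apply: cX => x0 _.
  have : nbhs x0 (f @^-1` (ball (f x0) (e / 2))) by apply: cf;
    exact: nbhsx_ballx.
  move=> /nbhs_ballP[r /= r0 hr].
  exists (ball x0 (r / 2), [set d | d <= r / 2]).
    split; first by apply: nbhsx_ballx; rewrite divr_gt0.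
    by apply: nbhs_right_le; rewrite divr_gt0.
  move=> [x d] [/= xr dr] y xy.
  rewrite [e]splitr; apply: (ball_triangle (y := f x0)).
    apply: ball_sym; apply: hr; apply: le_ball xr; lra.
  apply: hr; rewrite [r]splitr; apply: ball_triangle xr _.
  by rewrite ballEmdist/=; exact: lt_le_trans dr.
have [d [d0 hd]] : exists d : R, 0 < d /\ ([set: X] `<=` P d).
  apply: (@filter_ex _ (0 : R)^'+).
  by apply: filterS2 (nbhs_right_gt 0) H => d d0 hd; split.
by exists d => // x y; apply: hd.
Qed.

End compact_metric.

Section dynamics_of_limit.
Variable R : realType.
Notation circle := (circle R).
Notation pr := (@circle_proj R).
Variables (phi : homeo (torus2 R)) (alpha : R) (gam : nat -> circle -> circle)
  (bt : nat -> R).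
Hypothesis AK : anosov_katok phi alpha gam bt.

Lemma ex_eps_small (e : R) m : 0 < e -> exists2 n, (m <= n)%N & eps R n < e.
Proof.
move=> e0; have [N N0 hN] := ex_nat_ge (e^-1).
exists (maxn N m); first exact: leq_maxr.
rewrite /eps exprVn invf_plt ?posrE ?exprn_gt0//.
apply: le_lt_trans hN _; rewrite -natrX ltr_nat.
by rewrite (leq_ltn_trans (leq_maxl N m))// ltn_expl.
Qed.

Lemma AK_fst p : (phi p).1 = p.1 + pr alpha.
Proof. by have [fib h] := ak_skew AK; case: p => x y; rewrite h. Qed.

Lemma AK_iter_fst i p : (iter i phi p).1 = p.1 + pr (i%:R * alpha).
Proof.
elim: i => [|i IH].
  by rewrite mul0r -[LHS]addr0; congr (_ + _); exact/esym/raddf0.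
rewrite iterS AK_fst IH -addrA -circle_projD; congr (_ + pr _).
by rewrite -natr1; ring.
Qed.

Lemma AK_iter_tds m i (p : torus2_tds phi) :
  homeo_zpow (tds_map (tds_iter m (torus2_tds phi))) (Posz i) p =
    iter (m * i) phi p.
Proof. by rewrite mulnC /= iterM. Qed.

Lemma AK_minimal m : (0 < m)%N -> minimal (tds_iter m (torus2_tds phi)).
Proof.
move=> m0 x O [q Oq] oO.
have [e /= e0 qe] : exists2 e : R, 0 < e & ball q e `<=` O.
  by apply/nbhs_ballP; exact: open_nbhs_nbhs.
have [n mn ne] := ex_eps_small m e0.
have [i hi] := ak_dense AK m0 (leqW mn) x q.
exists (iter (m * i) phi x); split; last by exists (Posz i) => //;
  exact: AK_iter_tds.
apply: qe; rewrite ballEmdist/= metric_sym.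
exact: le_lt_trans ne.
Qed.

Lemma sum_block (F : nat -> R) (N : nat) (e : R) : (0 < N)%N -> 0 <= e ->
  (forall i, F i <= 1) ->
  (forall j, \sum_(0 <= i < N) F (j + i)%N <= N%:R * e) ->
  forall K, \sum_(0 <= i < K) F i <= K%:R * e + N%:R.
Proof.
move=> N0 e0 F1 hF K.
suff H : forall k K j, (K <= k)%N -> \sum_(0 <= i < K) F (j + i)%N <= K%:R * e +
  N%:R.
  exact: (H K K 0%N (leqnn K)).
elim=> [|k IH] {}K j; first by rewrite leqn0 => /eqP ->;
  rewrite big_geq// mul0r add0r.
move=> Kk; have [NK|KN] := leqP N K; last first.
  apply: (@le_trans _ _ (\sum_(0 <= i < K) 1)); first by apply: ler_sum.
  rewrite sumr_const_nat subn0 -[leLHS]add0r lerD ?mulr_ge0//.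
  by rewrite ler_nat ltnW.
rewrite (@big_cat_nat _ _ _ N)//=.
have := @big_addn _ 0 +%R 0 K N predT (fun i => F (j + i)%N).
rewrite add0n => ->.
have -> : \sum_(0 <= i < K - N) F (j + (i + N))%N =
    \sum_(0 <= i < K - N) F (j + N + i)%N.
  by apply: eq_bigr => i _; rewrite -addnA (addnC N).
have KNk : (K - N <=
  k)%N by rewrite leq_subLR (leq_trans Kk)// addnC -addn1 leq_add2l.
have := IH (K - N)%N (j + N)%N KNk; have := hF j.
rewrite natrB// => h1 h2.
apply: le_trans (lerD h1 h2) _; lra.
Qed.

Let dev n p := mdist p.2 (gam n p.1).

Lemma AK_mean_sum n : exists2 N : nat, (0 < N)%N & forall p K,
  \sum_(0 <= i < K) mdist (iter i phi p).2 (gam n (iter i phi p).1) <=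
    K%:R * eps R n + N%:R.
Proof.
have [N N0 hN] := ak_mean AK n; exists N => // p K.
apply: (sum_block N0 _ (F := fun i => dev n (iter i phi p))).
- exact: ltW (eps_gt0 R n).
- by move=> i; exact: circle_mdist_le1.
- move=> j; have := hN (iter j phi p); congr (_ <= _); apply: eq_bigr => i _.
  by rewrite -iterD addnC.
Qed.

Lemma AK_iter_dist n : exists2 L, 1 <= L & forall p q i,
  mdist (iter i phi p) (iter i phi q) <=
    L * mdist p.1 q.1 + dev n (iter i phi p) + dev n (iter i phi q).
Proof.
have [L L1 hL] := ak_lip AK n; exists L => // p q i.
have d0 : 0 <= dev n (iter i phi p) by exact: mdist_ge0.
have d1 : 0 <= dev n (iter i phi q) by exact: mdist_ge0.
have d2 := mdist_ge0 p.1 q.1.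
have E : mdist (iter i phi p).1 (iter i phi q).1 = mdist p.1 q.1.
  by rewrite !AK_iter_fst circle_mdistD.
rewrite torus_mdist ge_max; apply/andP; split.
  rewrite E -addrA; apply: (@le_trans _ _ (L * mdist p.1 q.1)); last first.
    by rewrite lerDl addr_ge0.
  by rewrite ler_peMl.
apply: le_trans (metric_triangle _ (gam n (iter i phi p).1) _) _.
rewrite -addrA addrCA; apply: lerD => //.
apply: le_trans (metric_triangle _ (gam n (iter i phi q).1) _) _.
apply: lerD; first by rewrite -E; exact: hL.
by rewrite metric_sym.
Qed.

Lemma AK_mean_equicontinuous : mean_equicontinuous (torus2_tds phi).
Proof.
move=> e e0; have e16 : 0 < e / 16 by rewrite divr_gt0.
have [n _ en] := ex_eps_small 0 e16.
have [N N0 hN] := AK_mean_sum n; have [L L1 hL] := AK_iter_dist n.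
have L0 : 0 < L by lra.
exists (e / (8 * L)); first by rewrite divr_gt0// mulr_gt0.
move=> p q pq.
have [K0 K00 hK0] := ex_nat_ge (16 * N%:R / e).
pose u K := K%:R^-1 * \sum_(0 <= i < K) mdist (iter i phi p) (iter i phi q).
have uK K : (K0 <= K)%N -> u K <= e / 2.
  move=> K0K; have KR : 0 < K%:R :> R by rewrite ltr0n (leq_trans K00).
  rewrite /u ler_pdivrMl//.
  have h1 : \sum_(0 <= i < K) mdist (iter i phi p) (iter i phi q) <=
      \sum_(0 <= i < K) (e / 8 + dev n (iter i phi p) + dev n (iter i phi q)).
    apply: ler_sum => i _; apply: le_trans (hL p q i) _.
    rewrite !lerD2r; apply: (@le_trans _ _ (L * mdist p q)).
      by rewrite ler_pM2l// torus_mdist le_max lexx.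
    have -> : e / 8 = L * (e / (8 * L)) by field; rewrite gt_eqF.
    by rewrite ler_pM2l// ltW.
  apply: le_trans h1 _; rewrite !big_split/= sumr_const_nat subn0 -[_ *+
    K]mulr_natl.
  have h2 := hN p K; have h3 := hN q K.
  have h4 : K%:R * eps R n <= K%:R * (e / 16) by rewrite ler_pM2l// ltW.
  have h5 : 16 * N%:R <= K%:R * e.
    by rewrite -ler_pdivrMr// (le_trans hK0)// ler_nat.
  have h6 : 0 <= N%:R :> R by [].
  rewrite /dev; move: h2 h3 h4 h5 h6.
  set A := \sum_(0 <= i < K) _; set B := \sum_(0 <= i < K) mdist _ _.
  move: (K%:R * eps R n) => z; lra.
apply: (@le_lt_trans _ _ (e / 2)%:E); last by rewrite lte_fin; lra.
rewrite /limn_esup /limf_esup; apply: ereal_inf_le.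
exists (ereal_sup ((fun K => (u K)%:E) @` [set K | (K0 <= K)%N])).
  by exists [set K | (K0 <= K)%N] => //; exists K0.
by apply: ge_ereal_sup => _ [K K0K <-]; rewrite lee_fin uK.
Qed.

Lemma AK_fst_factor : factor_map (fst : torus2_tds phi -> rotation_tds alpha).
Proof.
split.
- by move=> p; exact: cvg_fst.
- by apply/seteqP; split => // x _; exists (x, 0).
- by move=> p; rewrite AK_fst.
Qed.

Lemma iter_inv_cancel (X : topologicalType) (h : homeo X) i x :
  iter i h (iter i (homeo_inv h) x) = x.
Proof. exact: (iter_cancel i (homeo_invK h)). Qed.

(* Backward times are needed because equicontinuity of a factor only controls
   the future: points of a fibre that were close in the past have images in the
   factor that are close now. *)
Lemma AK_backward_close (p q : torus2 R) (d : R) : 0 < d -> p.1 = q.1 ->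
  exists i, mdist (iter i (homeo_inv phi) p) (iter i (homeo_inv phi) q) < d.
Proof.
move=> d0 pq; have d4 : 0 < d / 4 by rewrite divr_gt0.
have [n _ en] := ex_eps_small 0 d4.
have [N N0 hN] := ak_mean AK n; have [L L1 hL] := AK_iter_dist n.
pose p' := iter N (homeo_inv phi) p; pose q' := iter N (homeo_inv phi) q.
have p'E : iter N phi p' = p by exact: iter_inv_cancel.
have q'E : iter N phi q' = q by exact: iter_inv_cancel.
have p'q' : p'.1 = q'.1.
  have := AK_iter_fst N p'; rewrite p'E pq -q'E AK_iter_fst.
  by move/addIr.
have : exists2 i, (i < N)%N & mdist (iter i phi p') (iter i phi q') < d.
  apply: contrapT => H.
  have h i : (i < N)%N -> d <= dev n (iter i phi p') + dev n (iter i phi q').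
    move=> iN; rewrite leNgt; apply/negP => hd; apply: H; exists i => //.
    apply: le_lt_trans (hL p' q' i) _.
    by rewrite p'q' mdistxx mulr0 add0r.
  have : \sum_(0 <= i < N) d <=
      \sum_(0 <= i < N) (dev n (iter i phi p') + dev n (iter i phi q')).
    by rewrite big_nat [leRHS]big_nat; apply: ler_sum => i /andP[_]; exact: h.
  rewrite big_split/= sumr_const_nat subn0 -mulr_natl leNgt => /negP; apply.
  apply: le_lt_trans (lerD (hN p') (hN q')) _.
  by rewrite -mulrDr ltr_pM2l ?ltr0n//; lra.
move=> [i iN hi]; exists (N - i)%N.
have back r : iter (N - i) (homeo_inv phi) (iter N phi r) = iter i phi r.
  by rewrite -{2}(subnK (ltnW iN)) iterD (iter_cancel _ (homeo_funK phi)).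
by rewrite -p'E -q'E !back.
Qed.

Lemma AK_max_factor :
  max_equicontinuous_factor (fst : torus2_tds phi -> rotation_tds alpha).
Proof.
split; first exact: AK_fst_factor.
  move=> e e0; exists e => // x y xy n.
  have E z : iter n (tds_map (rotation_tds alpha)) z = z + pr (n%:R * alpha).
    elim: n => [|n IH].
      by rewrite mul0r -[LHS]addr0; congr (_ + _); exact/esym/raddf0.
    rewrite iterS IH -[LHS]addrA -circle_projD; congr (_ + pr _).
    by rewrite -natr1; ring.
  by rewrite !E circle_mdistD.
move=> Z q [cq sq hq] eZ.
have iterq i p : q (iter i phi p) = iter i (tds_map Z) (q p).
  by elim: i => // i IH; rewrite !iterS -IH -hq.
have q_fiber (p p' : torus2 R) : p.1 = p'.1 -> q p = q p'.
  move=> pp'; apply: (@mdist_positivity R Z); apply/eqP.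
  rewrite eq_le mdist_ge0 andbT; apply/ler_addgt0Pl => e e0; rewrite addr0.
  have [d d0 hd] := eZ e e0.
  have [d' d'0 hd'] := compact_uniform (@torus2_compact R) cq d0.
  have [i hi] := AK_backward_close d'0 pp'.
  have /hd/(_ i) : mdist (q (iter i (homeo_inv phi) p))
      (q (iter i (homeo_inv phi) p')) < d.
    by have := hd' _ _ hi; rewrite ballEmdist.
  by rewrite -!iterq !iter_inv_cancel => /ltW.
exists (fun x : circle => q (x, 0)); split; last first.
  move=> r [_ qr]; apply/funext => x.
  by have := congr1 (fun f => f (x, 0)) qr.
split; last by apply/funext => p; exact: q_fiber.
split.
- move=> x; apply: (@continuous_comp _ _ _ (fun x => (x, 0) : torus2 R) q).
    apply: (@lip_continuous R circle (torus2 R) _ 1) => // u v.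
    by rewrite torus_mdist ge_max mdistxx mul1r lexx mdist_ge0.
  exact: cq.
- apply/seteqP; split => // z _.
  have : range q z by rewrite sq.
  by move=> [p _ <-]; exists p.1 => //; exact: q_fiber.
- move=> x; rewrite -hq; apply: q_fiber.
  by rewrite AK_fst.
Qed.

End dynamics_of_limit.

(** * Invariant measures *)

Section bounded_integrals.
Context d (T : measurableType d) (R : realType).
Implicit Types (P Q : probability T R) (f g : T -> R).

Definition bounded_mfun f : Prop :=
  measurable_fun setT f /\ exists C, forall x, `|f x| <= C.

Definition Ex P f : R := \int[P]_x f x.

Lemma bounded_mfun_integrable P f : bounded_mfun f ->
  P.-integrable setT (EFin \o f).
Proof.
move=> [mf [C fC]]; apply: measurable_bounded_integrable => //.
  exact: (le_lt_trans (probability_le1 P measurableT) (ltry 1)).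
exists C; split; first exact: num_real.
by move=> M CM x _; exact: (le_trans (fC x) (ltW CM)).
Qed.

Lemma bounded_mfunD f g : bounded_mfun f -> bounded_mfun g ->
  bounded_mfun (fun x => f x + g x).
Proof.
move=> [mf [C fC]] [mg [D gD]]; split; first exact: measurable_funD.
by exists (C + D) => x; rewrite (le_trans (ler_normD _ _))// lerD.
Qed.

Lemma bounded_mfunZ c f : bounded_mfun f -> bounded_mfun (fun x => c * f x).
Proof.
move=> [mf [C fC]]; split; first exact: measurable_funM.
by exists (`|c| * C) => x; rewrite normrM ler_wpM2l.
Qed.

Lemma bounded_mfun_cst c : bounded_mfun (fun=> c).
Proof. by split; [exact: measurable_cst|exists `|c|]. Qed.

Lemma bounded_mfun_sum N (F : nat -> T -> R) : (forall i, bounded_mfun (F i)) ->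
  bounded_mfun (fun x => \sum_(0 <= i < N) F i x).
Proof.
move=> bF; elim: N => [|N IH].
  rewrite (_ : (fun x => _) = fun=> 0); first exact: bounded_mfun_cst.
  by apply/funext => x; rewrite big_geq.
rewrite (_ : (fun x => _) = fun x => \sum_(0 <= i < N) F i x + F N x).
  exact: bounded_mfunD.
by apply/funext => x; rewrite big_nat_recr.
Qed.

Lemma ExD P f g : bounded_mfun f -> bounded_mfun g ->
  Ex P (fun x => f x + g x) = Ex P f + Ex P g.
Proof. by move=> bf bg; apply: RintegralD => //; exact: bounded_mfun_integrable.
Qed.

Lemma ExZ P c f : bounded_mfun f -> Ex P (fun x => c * f x) = c * Ex P f.
Proof. by move=> bf; apply: RintegralZl => //; exact: bounded_mfun_integrable.
Qed.

Lemma Ex_cst P c : Ex P (fun=> c) = c.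
Proof.
rewrite /Ex Rintegral_cst// [X in fine X](_ : _ = 1%E) ?mulr1//.
exact: probability_setT.
Qed.

Lemma ExB P f g : bounded_mfun f -> bounded_mfun g ->
  Ex P (fun x => f x - g x) = Ex P f - Ex P g.
Proof. by move=> bf bg; apply: RintegralB => //; exact: bounded_mfun_integrable.
Qed.

Lemma Ex_sum P N (F : nat -> T -> R) : (forall i, bounded_mfun (F i)) ->
  Ex P (fun x => \sum_(0 <= i < N) F i x) = \sum_(0 <= i < N) Ex P (F i).
Proof.
move=> bF; elim: N => [|N IH].
  rewrite [RHS]big_geq//; apply: etrans (Ex_cst P 0); congr (Ex P _).
  by apply/funext => x; rewrite big_geq.
rewrite big_nat_recr//= -IH -ExD//; last exact: bounded_mfun_sum.
by congr (Ex P _); apply/funext => x; rewrite big_nat_recr.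
Qed.

Lemma le_Ex P f g : bounded_mfun f -> bounded_mfun g ->
  (forall x, f x <= g x) ->
  Ex P f <= Ex P g.
Proof.
by move=> bf bg fg; apply: le_Rintegral => //; exact: bounded_mfun_integrable.
Qed.

Lemma Ex_le P f c : bounded_mfun f -> (forall x, f x <= c) -> Ex P f <= c.
Proof.
by move=> bf fc; rewrite -[leRHS](Ex_cst P); apply: le_Ex => //;
  exact: bounded_mfun_cst.
Qed.

Lemma Ex_near P f g h : bounded_mfun f -> bounded_mfun g -> bounded_mfun h ->
  (forall x, `|f x - g x| <= h x) -> `|Ex P f - Ex P g| <= Ex P h.
Proof.
move=> bf bg bh fgh; rewrite ler_norml -ExB//.
have bfg : bounded_mfun (fun x => f x - g x).
  rewrite (_ : (fun x => _) = fun x => f x + -1 * g x).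
    by apply: bounded_mfunD => //; exact: bounded_mfunZ.
  by apply/funext => x; rewrite mulN1r.
apply/andP; split; last first.
  by apply: le_Ex => // x; rewrite (le_trans (ler_norm _))// fgh.
rewrite -mulN1r -ExZ//; apply: le_Ex => //; first exact: bounded_mfunZ.
by move=> x; rewrite mulN1r lerNl; apply: le_trans (fgh x);
  rewrite -normrN ler_norm.
Qed.

Lemma Ex_cvg P (F : nat -> T -> R) f C (E : set T) : measurable E ->
  P E = 0%E ->
  (forall n, measurable_fun setT (F n)) -> measurable_fun setT f ->
  (forall n x, `|F n x| <= C) ->
  (forall x, ~ E x -> (fun n => F n x) @ \oo --> f x) ->
  (fun n => Ex P (F n)) @ \oo --> Ex P f.
Proof.
move=> mE PE mF mf FC Ff.
have iC : P.-integrable setT (EFin \o cst C).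
  exact: bounded_mfun_integrable (bounded_mfun_cst C).
have ae : {ae P, forall x, setT x -> (EFin \o F ^~ x) @ \oo --> (EFin \o f) x}.
  exists E; split => // x /= h; apply: contrapT => nE; apply: h => _.
  by apply: cvg_EFin; [exact: nearW|exact: Ff].
have ae2 : {ae P, forall x, forall n, setT x ->
  (`|(EFin \o F n) x| <= (EFin \o cst C) x)%E}.
  by apply: aeW => x n _; rewrite /= lee_fin FC.
have [if_ _ cv] := dominated_convergence measurableT
  (fun n => measurableT_comp (@EFin_measurable R setT) (mF n))
  (measurableT_comp (@EFin_measurable R setT) mf) ae iC ae2.
apply: (@fine_cvg _ _ _ _ (fun n => \int[P]_x (F n x)%:E)%E).
by rewrite fineK//; exact: integrable_fin_num if_.
Qed.

End bounded_integrals.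

Section borel_metric.
Variable R : realType.

Lemma continuous_borel (X Y : ptopologicalType) (f : X -> Y) : continuous f ->
  measurable_fun setT (f : borel X -> borel Y).
Proof.
move=> cf; apply: (@measurability _ _ (borel X) (borel Y) _ _ (@open Y)) => //.
move=> _ [A oA <-]; rewrite setTI; apply: sub_sigma_algebra.
by apply: open_comp => // x _; exact: cf.
Qed.

Lemma continuous_borel_real (X : ptopologicalType) (f : X ->
  R) : continuous f ->
  measurable_fun setT (f : borel X -> R).
Proof.
move=> cf; apply: (measurability _ (RGenOInfty.measurableE R)).
move=> _ [_ [x ->] <-]; rewrite setTI; apply: sub_sigma_algebra.
by apply: open_comp => // y _; exact: cf.
Qed.

Definition lip_real (X : metricType R) (L : R) (f : X -> R) : Prop :=
  forall x y, `|f x - f y| <= L * mdist x y.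

Lemma lip_real_continuous (X : metricType R) L (f : X -> R) : 0 <= L ->
  lip_real L f -> continuous f.
Proof.
move=> L0 fL p; apply/cvgrPdist_lt => e e0.
have L1 : 0 < L + 1 by lra.
have eL : 0 < e / (L + 1) by rewrite divr_gt0.
have := @metricType_numDomainType.cvgr_dist_lt R X _ _ (nbhs_filter p) id p
  cvg_id _ eL.
apply: filterS => q pq; apply: le_lt_trans (fL _ _) _.
apply: (@le_lt_trans _ _ ((L + 1) * mdist p q)).
  by rewrite ler_wpM2r ?mdist_ge0//; lra.
by rewrite -ltr_pdivlMl// mulrC.
Qed.

Definition dist_to (X : metricType R) (F : set X) (x : X) : R :=
  inf [set mdist x y | y in F].

Lemma dist_to_lip (X : metricType R) (F : set X) : F !=set0 ->
  lip_real 1 (dist_to F).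
Proof.
move=> F0; have H x y : dist_to F x <= mdist x y + dist_to F y.
  rewrite -lerBlDl; apply: lb_le_inf.
    by have [z Fz] := F0; exists (mdist y z), z.
  move=> _ [z Fz <-]; rewrite lerBlDl.
  apply: le_trans (metric_triangle x y z).
  apply: ge_inf; last by exists z.
  by exists 0 => _ [w _ <-]; exact: mdist_ge0.
move=> x y; rewrite mul1r ler_norml.
have := H x y; have := H y x; rewrite (metric_sym y x) => h1 h2.
by apply/andP; split; lra.
Qed.

Lemma lip_determines (X : pmetricType R) (P Q : probability (borel X) R) :
  (forall (f : X -> R) L, 0 <= L -> lip_real L f -> (forall x, 0 <= f x <= 1) ->
    Ex P (f : borel X -> R) = Ex Q (f : borel X -> R)) ->
  forall A : set (borel X), measurable A -> P A = Q A.
Proof.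
move=> H A mA.
have mO (U : set X) : open U -> measurable (U : set (borel X)).
  by move=> oU; exact: sub_sigma_algebra.
apply: (@g_sigma_algebra_measure_unique _ R (borel X) (@open X) mO (fun=>
  setT)) => //.
- by move=> _; exact: openT.
- by apply/seteqP; split => // x _; exists 0%N.
- by move=> U V oU oV; exact: openI.
- move=> U oU.
  have [UT|/existsNP[z Uz]] := pselect (forall x, U x).
    have -> : U = setT by apply/seteqP; split.
    by apply: etrans (probability_setT P) _; exact/esym/probability_setT.
  pose D := dist_to (~` U).
  have DL : lip_real 1 D by apply: dist_to_lip; exists z.
  have D0 x : 0 <= D x.
    apply: lb_le_inf; first by exists (mdist x z), z.
    by move=> _ [w _ <-]; exact: mdist_ge0.
  pose f (k : nat) x := Num.min 1 (k%:R * D x).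
  have fL k : lip_real k%:R (f k).
    move=> x y; apply: (@le_trans _ _ `|k%:R * D x - k%:R * D y|).
      rewrite /f; case: (leP 1 (k%:R * D x)); case: (leP 1 (k%:R * D y)) =>
        h1 h2;
        rewrite ?subrr ?normr0//.
      - by rewrite ger0_norm ?ger0_norm//; lra.
      - by rewrite ler0_norm ?ler0_norm//; lra.
    by rewrite -mulrBr normrM ger0_norm// ler_wpM2l// -[leRHS]mul1r; exact: DL.
  have f01 k x : 0 <= f k x <= 1.
    by rewrite /f ge_min lexx/= andbT le_min ler01 mulr_ge0.
  have mU := mO _ oU.
  have cv S : (fun k => Ex S (f k : borel X -> R)) @ \oo -->
      Ex S (\1_(U : set (borel X)) : borel X -> R).
    apply: (@Ex_cvg _ (borel X) R S (fun k => f k) _ 1 set0) => //.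
    - by move=> k; apply: continuous_borel_real;
        exact: lip_real_continuous (fL k).
    - by move=> k x; have /andP[f0 f1] := f01 k x; rewrite ger0_norm.
    move=> x _; have [Ux|Ux] := pselect (U x).
      have [e /= e0 xe] : exists2 e : R, 0 < e & ball x e `<=` U.
        by apply/nbhs_ballP; exact: open_nbhs_nbhs.
      have De : e <= D x.
        apply: lb_le_inf; first by exists (mdist x z), z.
        move=> _ [y Uy <-]; rewrite leNgt; apply/negP => xy; apply: Uy.
        by apply: xe; rewrite ballEmdist.
      have [N N0 hN] := ex_nat_ge (e^-1).
      have E k : (N <= k)%N -> f k x = 1.
        move=> Nk; rewrite /f; apply/min_idPl.
        have kN : e^-1 <= k%:R by apply: le_trans hN _; rewrite ler_nat.
        rewrite -ler_pdivrMr ?(lt_le_trans e0)// div1r (le_trans _ kN)//.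
        by rewrite lef_pV2 ?posrE// (lt_le_trans e0).
      rewrite indicE mem_set//=; apply: cvg_near_cst.
      by exists N => // k /= Nk; rewrite E.
    have Dx : D x = 0.
      apply/eqP; rewrite eq_le D0 andbT; apply: ge_inf.
        by exists 0 => _ [w _ <-]; exact: mdist_ge0.
      by exists x => //; exact: mdistxx.
    rewrite indicE memNset//=; apply: cvg_near_cst; apply: nearW => k.
    by rewrite /f Dx mulr0; apply/min_idPr.
  have ExU S : Ex S (\1_(U : set (borel X)) : borel X -> R) = fine (S U).
    by rewrite /Ex /Rintegral integral_indic// setIT.
  have E : fine (P U) = fine (Q U).
    rewrite -!ExU; apply: norm_cvg_unique (cv P) _.
    rewrite (_ : (fun k => _) = fun k => Ex Q (f k : borel X -> R));
      first exact: cv.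
    by apply/funext => k; exact: (H _ _ _ (fL k)).
  rewrite -[LHS]fineK; last exact: fin_num_measure.
  rewrite -[RHS]fineK; last exact: fin_num_measure.
  by rewrite E.
- by move=> k; rewrite (le_lt_trans (probability_le1 P _))// ltry.
Qed.

End borel_metric.

Section circle_integral.
Variable R : realType.
Notation circle := (circle R).
Notation pr := (@circle_proj R).
Notation leb := (@lebesgue_measure R).
Notation lambda := (@circle_lebesgue R).

(* With a primitive [F] of [G], the integral is F(1+t) - F(t), whose derivative
   in [t] vanishes by periodicity. *)
Lemma shift_integral (G : R -> R) (t : R) : continuous G ->
  (forall x, G (x + 1) = G x) -> 0 <= t <= 1 ->
  (\int[leb]_(x in `[0%R, 1%R]) (G (x + t))%:E =
    \int[leb]_(x in `[0%R, 1%R]) (G x)%:E)%E.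
Proof.
move=> cG pG /andP[t0 t1].
pose F (u : R) := \int[leb]_(s in `[-1, u]) G s.
have dF (u : R) : -1 < u -> u < 4 -> is_derive u 1 F (G u).
  move=> u1 u4.
  have iG : leb.-integrable `[-1, 4] (EFin \o G).
    by apply: continuous_compact_integrable;
      [exact: segment_compact|exact: continuous_subspaceT].
  have [h1 h2] := continuous_FTC1_closed u4 iG u1 (cG u).
  exact: (DeriveDef h1 (etrans (esym (derive1E F u)) h2)).
have shiftE (s : R) : 0 <= s -> s <= 1 ->
    (\int[leb]_(x in `[0%R, 1%R]) (G (x + s))%:E)%E = (F (1 + s) - F s)%:E.
  move=> s0 s1; have dFs (x : R) : 0 <= x -> x <= 1 ->
      is_derive x 1 (fun y => F (y + s)) (G (x + s)).
    by move=> x0 x1; apply: is_derive1_shift; apply: dF; lra.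
  have cFs (x : R) : 0 <= x -> x <= 1 -> {for x, continuous (fun y =>
    F (y + s))}.
    move=> x0 x1; apply: differentiable_continuous.
    by apply/derivable1_diffP; have [] := dFs x x0 x1.
  rewrite (@continuous_FTC2 R (fun x => G (x + s)) (fun y => F (y + s)) 0 1)//.
  - by rewrite add0r EFinB.
  - apply: continuous_subspaceT => x.
    apply: (@continuous_comp _ _ _ (fun x => x + s) G); last exact: cG.
    by apply: cvgD; [exact: cvg_id|exact: cvg_cst].
  - split.
    + by move=> x; rewrite in_itv/= => /andP[x0 x1];
        have [] := dFs x (ltW x0) (ltW x1).
    + by apply: cvg_at_right_filter; exact: cFs.
    + by apply: cvg_at_left_filter; exact: cFs.
  - move=> x; rewrite in_itv/= => /andP[x0 x1]; rewrite derive1E.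
    by have [] := dFs x (ltW x0) (ltW x1).
rewrite shiftE//.
have -> : (\int[leb]_(x in `[0%R, 1%R]) (G x)%:E)%E = (F (1 + 0) - F 0)%:E.
  by rewrite -shiftE//; apply: eq_integral => x _; rewrite addr0.
congr EFin.
have dH (x : R) : 0 <= x -> x <= t -> is_derive x 1 (fun y =>
  F (y + 1) - F y) 0.
  move=> x0 xt.
  have h1 : is_derive x 1 (fun y => F (y + 1)) (G x).
    by rewrite -pG; apply: is_derive1_shift; apply: dF; lra.
  have h2 : is_derive x 1 F (G x) by apply: dF; lra.
  by apply: is_derive_eq; rewrite subrr.
have cH : {within `[0, t], continuous (fun y => F (y + 1) - F y)}.
  apply: continuous_in_subspaceT => x; rewrite inE/= in_itv/= => /andP[x0 xt].
  apply: differentiable_continuous.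
  by apply/derivable1_diffP; have [] := dH x x0 xt.
have dH' (x : R) : x \in `]0, t[ -> is_derive x 1 (fun y => F (y + 1) - F y) 0.
  by rewrite in_itv/= => /andP[x0 xt]; apply: dH; exact: ltW.
have [c _ /eqP] := MVT_segment t0 dH' cH.
by rewrite mul0r subr_eq0 !(addrC 1) => /eqP.
Qed.

Lemma circle_integral (f : circle -> R) : continuous f ->
  (forall x, 0 <= f x) ->
  (\int[lambda]_x (f x)%:E = \int[leb]_(x in `[0%R, 1%R]) (f (pr x))%:E)%E.
Proof.
move=> cf f0.
have mf : measurable_fun setT (EFin \o f : borel circle -> \bar R).
  apply: (measurableT_comp (@EFin_measurable R setT)).
  exact: (@continuous_borel_real R circle f cf).
have mI : measurable (`[0%R, 1%R[%classic : set (measurableTypeR R)).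
  exact: measurable_itv.
have mfp : measurable_fun setT (fun x : measurableTypeR R => (f (pr x))%:E).
  exact: measurableT_comp mf (@measurable_circle_proj R).
pose nu := mrestr leb mI.
have f0' : {in setT, forall y : borel circle, (0%R <= (EFin \o f) y)%E}.
  by move=> y _; rewrite lee_fin f0.
apply: etrans _ (etrans (ge0_integral_pushforward (@measurable_circle_proj R) nu
  measurableT mf f0') _).
  by apply: eq_measure_integral; first exact: measurable_circle_proj.
rewrite preimage_setT.
rewrite -integral_itv_bndo_bndc; last exact: measurable_funTS.
pose I01 : set (measurableTypeR R) := `[0%R, 1%R[%classic.
pose g (x : measurableTypeR R) := ((f (pr x))%:E : \bar R).
have E : (\int[nu]_(x in I01 `|` ~` I01) g x =
    \int[nu]_(x in I01) g x + \int[nu]_(x in ~` I01) g x)%E.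
  apply: ge0_integral_setU.
  - exact: mI.
  - exact: measurableC.
  - by rewrite setUv; exact: mfp.
  - by move=> x _; rewrite lee_fin f0.
  - by apply/disj_set2P; rewrite setICr.
rewrite setUv in E; apply: etrans E _.
rewrite [X in (_ + X)%E](_ : _ = 0%E) ?adde0.
  apply: eq_measure_integral => A mA AI.
  by rewrite /nu /= /mrestr setIidl.
apply: null_set_integral; [exact: measurableC|exact: measurable_funTS|].
apply: etrans (measure0 leb); congr (leb _); exact: setICl.
Qed.

Lemma circle_lebesgue_shift (f : circle -> R) (t : circle) : continuous f ->
  (forall x, 0 <= f x) ->
  Ex lambda (fun x => f (x + t)) = Ex lambda (f : borel circle -> R).
Proof.
move=> cf f0; have [s0 s0t] := circle_proj_surj t.
pose s := s0 - (Num.floor s0)%:~R.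
have st : pr s = t by rewrite -s0t /s -mulrNz circle_proj_int.
have s01 : 0 <= s <= 1.
  rewrite subr_ge0 floor_le lerBlDl ltW//.
  by rewrite -[1]/(1%:~R) -intrD floorD1_gt.
have cft : continuous (fun x : circle => f (x + t)).
  by move=> x; apply: (@continuous_comp _ _ _ (rotate t) f);
    [exact: rotate_continuous|exact: cf].
rewrite /Ex /Rintegral; congr fine.
rewrite [LHS]circle_integral// [RHS]circle_integral//.
rewrite -(@shift_integral (fun x => f (pr x)) s)//.
- by apply: eq_integral => x _; rewrite -st circle_projD.
- by move=> x; apply: (@continuous_comp _ _ _ pr f);
    [exact: circle_proj_continuous|exact: cf].
- by move=> x; rewrite -[1]/(1%:~R) circle_proj_int.
Qed.

End circle_integral.

Section averages.
Variable R : realType.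
Notation circle := (circle R).
Notation pr := (@circle_proj R).
Notation lambda := (@circle_lebesgue R).

Lemma bounded_continuous (X : ptopologicalType) (f : X -> R) C : continuous f ->
  (forall x, `|f x| <= C) -> bounded_mfun (f : borel X -> R).
Proof. by move=> cf fC; split; [exact: continuous_borel_real|exists C]. Qed.

Let S (g : circle -> R) (q : nat) (x : circle) : R :=
  \sum_(0 <= j < q) g (x + pr (j%:R / q%:R)).

(* [S g q] is invariant under the rotation by 1/q, hence determined by its
   values on an interval of length 1/q. *)
Lemma average_oscillation (g : circle -> R) L q x : (0 < q)%N -> 0 <= L ->
  lip_real L g -> `|S g q x - S g q (pr 0)| <= L.
Proof.
move=> q0 L0 gL; have qR : 0 < q%:R :> R by rewrite ltr0n.
have step y : S g q (y + pr q%:R^-1) = S g q y.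
  rewrite /S; case: q q0 qR => // q _ qR;
    rewrite big_nat_recr//= [RHS]big_nat_recl//=.
  rewrite addrC; congr (_ + _).
    rewrite -addrA -circle_projD mul0r; congr (g (y + _)).
    rewrite -(circle_proj_int 0 1); congr pr; rewrite add0r -natr1; field.
    by rewrite natr1 gt_eqF.
  apply: eq_bigr => j _; rewrite -addrA -circle_projD; congr (g (y + pr _)).
  by rewrite -[j.+1%:R]natr1 mulrDl mul1r addrC.
have steps i y : S g q (y + pr (i%:R / q%:R)) = S g q y.
  elim: i y => [|i IH] y.
    by rewrite mul0r; congr (S g q _); rewrite -[RHS]addr0; congr (_ + _);
      exact: raddf0.
  by rewrite -natr1 mulrDl mul1r circle_projD addrA step IH.
have [a0 <-] := circle_proj_surj x.
pose a := a0 - (Num.floor a0)%:~R.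
have -> : pr a0 = pr a by rewrite /a -mulrNz circle_proj_int.
have a_ge0 : 0 <= a by rewrite subr_ge0 floor_le.
have aq0 : 0 <= a * q%:R by rewrite mulr_ge0// ltW.
have /andP[k1 k2] := truncn_itv aq0.
set i := Num.trunc _ in k1 k2.
pose r := a - i%:R / q%:R.
have r0 : 0 <= r by rewrite subr_ge0 ler_pdivrMr.
have r1 : r <= q%:R^-1.
  rewrite /r lerBlDl -[X in _ + X]div1r -mulrDl natr1 ler_pdivlMr//; exact: ltW.
have -> : pr a = pr r + pr (i%:R / q%:R) by rewrite -circle_projD /r subrK.
rewrite steps /S -sumrB; apply: le_trans (ler_norm_sum _ _ _) _.
apply: (@le_trans _ _ (\sum_(0 <= j < q) L / q%:R)).
  apply: ler_sum => j _; apply: le_trans (gL _ _) _; rewrite circle_mdistD.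
  rewrite ler_wpM2l//; apply: le_trans (circle_dist_le _ _) _.
  by rewrite subr0 ger0_norm.
by rewrite sumr_const_nat subn0 -[_ *+ q]mulr_natr divfK// gt_eqF.
Qed.

Lemma invariant_average d (T : measurableType d) (P : probability T R)
    (h : T -> circle) (g : circle -> R) L :
  measurable_fun setT (h : T -> borel circle) ->
  0 <= L -> lip_real L g -> (forall x, 0 <= g x <= 1) ->
  (forall t, Ex P (fun p => g (h p + t)) = Ex P (fun p => g (h p))) ->
  Ex P (fun p => g (h p)) = Ex lambda (g : borel circle -> R).
Proof.
move=> mh L0 gL g01 inv.
have cg : continuous g by exact: lip_real_continuous gL.
have g1 x : `|g x| <= 1 by have /andP[? ?] := g01 x; rewrite ger0_norm.
have H d' (T' : measurableType d') (Q : probability T' R) (h' : T' -> circle) :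
    measurable_fun setT (h' : T' -> borel circle) ->
    (forall t, Ex Q (fun p => g (h' p + t)) = Ex Q (fun p => g (h' p))) ->
    forall q, (0 < q)%N -> `|q%:R * Ex Q (fun p =>
      g (h' p)) - S g q (pr 0)| <= L.
  move=> mh' inv' q q0.
  have bt t : bounded_mfun (fun p => g (h' p + t)).
    split; last by exists 1.
    have ct : continuous (fun x : circle => g (x + t)).
      by move=> x; apply: (@continuous_comp _ _ _ (rotate t) g);
        [exact: rotate_continuous|exact: cg].
    exact: (measurableT_comp (continuous_borel_real ct) mh').
  have bS : bounded_mfun (fun p => S g q (h' p)) by exact: bounded_mfun_sum.
  have -> : q%:R * Ex Q (fun p => g (h' p)) = Ex Q (fun p => S g q (h' p)).
    rewrite Ex_sum//; under eq_bigr do rewrite inv'.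
    by rewrite sumr_const_nat subn0 mulr_natl.
  rewrite -[S g q (pr 0)](Ex_cst Q) -[leRHS](Ex_cst Q).
  apply: Ex_near => //; try exact: bounded_mfun_cst.
  by move=> p; exact: average_oscillation.
have H1 := H _ _ P h mh inv.
have inv2 t : Ex lambda (fun p : borel circle => g (p + t)) =
    Ex lambda (fun p : borel circle => g p).
  by rewrite circle_lebesgue_shift// => x; have /andP[] := g01 x.
have H2 := H _ _ lambda (fun x => x) (@measurable_id _ _ _) inv2.
apply/eqP; rewrite -subr_eq0 -normr_le0; apply/ler_addgt0Pl => e e0;
  rewrite addr0.
have [q q0 hq] := ex_nat_ge (2 * L / e).
have qR : 0 < q%:R :> R by rewrite ltr0n.
set u := Ex P _; set v := Ex lambda _.
have h1 := H1 q q0; have h2 := H2 q q0; rewrite -/u -/v in h1 h2.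
rewrite -(ler_pM2l qR) -{1}(gtr0_norm qR) -normrM mulrBr.
apply: (@le_trans _ _ (2 * L)); last by rewrite -ler_pdivrMr.
have -> : q%:R * u - q%:R * v =
   (q%:R * u - S g q (pr 0)) - (q%:R * v - S g q (pr 0)) by ring.
by apply: le_trans (ler_normB _ _) _; lra.
Qed.

Lemma dist_to_compl_gt0 (X : metricType R) (U : set X) (x : X) : open U ->
  ~` U !=set0 -> (0 < dist_to (~` U) x) <-> U x.
Proof.
move=> oU [z Uz].
have lb : has_lbound [set mdist x y | y in ~` U].
  by exists 0 => _ [w _ <-]; exact: mdist_ge0.
split=> [D0|Ux].
  apply: contrapT => nUx; move: D0; rewrite ltNge => /negP; apply.
  by apply: ge_inf => //; exists x => //; exact: mdistxx.
have [e /= e0 xe] : exists2 e : R, 0 < e & ball x e `<=` U.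
  by apply/nbhs_ballP; exact: open_nbhs_nbhs.
apply: lt_le_trans e0 _; apply: lb_le_inf; first by exists (mdist x z), z.
move=> _ [y Uy <-]; rewrite leNgt; apply/negP => xy; apply: Uy.
by apply: xe; rewrite ballEmdist.
Qed.

Lemma measurable_limit d (T : measurableType d) (X : pmetricType R)
    (g : nat -> T -> X) (l : T -> X) :
  (forall n, measurable_fun setT (g n : T -> borel X)) ->
  (forall x, (fun n => g n x) @ \oo --> l x) ->
  measurable_fun setT (l : T -> borel X).
Proof.
move=> mg gl; apply: (@measurability _ _ T (borel X) _ _ (@open X)) => //.
move=> _ [U oU <-]; rewrite setTI.
have [U0|U0] := pselect (~` U !=set0); last first.
  rewrite (_ : l @^-1` U = setT); first exact: measurableT.
  by apply/seteqP; split => // x _ /=; apply: contrapT => Ux; apply: U0;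
    exists (l x).
have cD : continuous (dist_to (~` U)).
  exact: lip_real_continuous ler01 (dist_to_lip U0).
have mD : measurable_fun setT (fun x => dist_to (~` U) (l x)).
  apply: (@measurable_fun_cvg _ T R setT (fun n x => dist_to (~` U) (g n x))).
    by move=> n; exact: (measurableT_comp (continuous_borel_real cD) (mg n)).
  move=> x _; apply: (@cvg_comp _ _ _ (fun n => g n x) (dist_to (~` U)) _
    (nbhs (l x))); first exact: gl.
  exact: cD.
rewrite (_ : l @^-1` U = (fun x => dist_to (~` U) (l x)) @^-1` `]0,
  +oo[%classic).
  by rewrite -[X in measurable X]setTI; apply: mD => //; exact: measurable_itv.
apply/seteqP; split => x /=; rewrite in_itv/= andbT;
  by move/(dist_to_compl_gt0 (l x) oU U0).
Qed.

Lemma circle_seq_cvg (c : nat -> circle) n0 :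
  (forall n, (n0 <= n)%N -> mdist (c n.+1) (c n) <= 2^-1 ^+ n) ->
  cvg (c @ \oo).
Proof.
move=> hc.
have H n k : (n0 <= n)%N ->
    mdist (c (n + k)%N) (c n) <= 2 * 2^-1 ^+ n - 2 * 2^-1 ^+ (n + k).
  move=> n0n; elim: k => [|k IH]; first by rewrite addn0 mdistxx subrr.
  apply: le_trans (metric_triangle _ (c (n + k)%N) _) _.
  have := hc _ (leq_trans n0n (leq_addr k n)).
  rewrite addnS exprS => h; move: IH h.
  move: (2^-1 ^+ n) (2^-1 ^+ (n + k)) (mdist _ _) (mdist _ _) => *; lra.
apply: (@compact_cauchy_cvg circle setT (c @ \oo)).
- apply: cauchy_exP => e e0.
  have := @cvg_geometric R 2 2^-1;
    rewrite ger0_norm ?invr_ge0// invf_lt1// ltr1n.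
  move=> /(_ isT)/cvgrPdist_lt/(_ _ e0)[N _ hN].
  pose n := maxn N n0.
  exists (c n); exists n => // m /= nm; rewrite -(subnKC nm) ballEmdist/=
    metric_sym.
  apply: le_lt_trans (H _ _ (leq_maxr _ _)) _.
  have := hN n (leq_maxl _ _); rewrite /= sub0r normrN ger0_norm; last first.
    by rewrite mulr_ge0// exprn_ge0.
  apply: le_lt_trans; rewrite gerBl mulr_ge0// exprn_ge0//.
- by exists 0%N.
- exact: circle_compact.
Qed.

End averages.

Section invariant_measures.
Variable R : realType.

Lemma Ex_distribution d d' (T : measurableType d) (T' : measurableType d')
    (P : probability T R) (X : {mfun T >-> T'}) (f : T' -> R) :
  measurable_fun setT f -> (forall x, 0 <= f x) ->
  Ex (distribution P X) f = Ex P (fun x => f (X x)).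
Proof.
move=> mf f0; rewrite /Ex /Rintegral; congr fine.
have mX : measurable_fun setT X by exact: measurable_funPT.
have mf' : measurable_fun setT (EFin \o f).
  exact: (measurableT_comp (@EFin_measurable R setT) mf).
have f0' : {in setT, forall y, (0%R <= (EFin \o f) y)%E}.
  by move=> y _; rewrite lee_fin f0.
apply: etrans _ (ge0_integral_pushforward mX P measurableT mf' f0').
by apply: eq_measure_integral.
Qed.

Lemma Ex_invariant d (T : measurableType d) (P : probability T R) (h : T -> T)
    (f : T -> R) : measurable_fun setT h ->
  (forall A, measurable A -> P (h @^-1` A) = P A) ->
  measurable_fun setT f -> (forall x, 0 <= f x) ->
  Ex P (fun x => f (h x)) = Ex P f.
Proof.
move=> mh inv mf f0.
pose H : {mfun T >-> T} := HB.pack h (isMeasurableFun.Build _ _ _ _ h mh).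
rewrite -(@Ex_distribution _ _ _ _ P H f mf f0) /Ex /Rintegral; congr fine.
by apply: eq_measure_integral => A mA _; exact: inv.
Qed.

Lemma iter_invariant d (T : measurableType d) (P : probability T R) (h : T ->
  T) i :
  measurable_fun setT h ->
  (forall A, measurable A -> P (h @^-1` A) = P A) ->
  forall A, measurable A -> P (iter i h @^-1` A) = P A.
Proof.
move=> mh inv; elim: i => [//|i IH] A mA.
have mhA : measurable (h @^-1` A) by rewrite -[X in measurable X]setTI;
  exact: mh.
by rewrite -(inv A mA) -(IH _ mhA).
Qed.

End invariant_measures.

Section limit_measure.
Variable R : realType.
Notation circle := (circle R).
Notation pr := (@circle_proj R).
Notation lambda := (@circle_lebesgue R).
Notation torus := (torus2 R).
Variables (phi : homeo torus) (alpha : R) (gam : nat -> circle -> circle)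
  (bt : nat -> R).
Hypothesis AK : anosov_katok phi alpha gam bt.

Let jump n (x : circle) : R := mdist (gam n.+1 x) (gam n x).

Let jump_lip n : exists2 L, 0 <= L & lip_real L (jump n).
Proof.
have [K K1 hK] := ak_lip AK n.+1; have [L L1 hL] := ak_lip AK n.
exists (K + L) => [|x y]; first lra.
have h1 := hK x y; have h2 := hL x y; rewrite mulrDl ler_norml.
have t1 := metric_triangle (gam n.+1 x) (gam n.+1 y) (gam n x).
have t2 := metric_triangle (gam n.+1 y) (gam n y) (gam n x).
have t3 := metric_triangle (gam n.+1 y) (gam n.+1 x) (gam n y).
have t4 := metric_triangle (gam n.+1 x) (gam n x) (gam n y).
rewrite (metric_sym (gam n.+1 y) (gam n.+1 x)) in t3.
rewrite (metric_sym (gam n y) (gam n x)) in t2.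
by rewrite /jump; apply/andP; split; lra.
Qed.

Let jump_continuous n : continuous (jump n).
Proof. by have [L L0] := jump_lip n; exact: lip_real_continuous. Qed.

Let jump01 n x : 0 <= jump n x <= 1.
Proof. by rewrite mdist_ge0 circle_mdist_le1. Qed.

Let jump_bounded n : bounded_mfun (jump n : borel circle -> R).
Proof.
apply: (bounded_continuous (C := 1)) => // x.
by have /andP[? ?] := jump01 n x; rewrite ger0_norm.
Qed.

Lemma jump_mean n : Ex lambda (jump n : borel circle -> R) <= eps R n.
Proof.
have [N N0 [tau htau]] := ak_cauchy AK n.
have NR : 0 < N%:R :> R by rewrite ltr0n.
have ct t : continuous (fun x : circle => jump n (x + t)).
  by move=> x; apply: (@continuous_comp _ _ _ (rotate t) (jump n));
    [exact: rotate_continuous|exact: jump_continuous].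
have bt' t : bounded_mfun (fun x : borel circle => jump n (x + t)).
  apply: (bounded_continuous (C := 1)) => // x.
  by have /andP[? ?] := jump01 n (x + t); rewrite ger0_norm.
have E : N%:R * Ex lambda (jump n : borel circle -> R) =
    Ex lambda (fun x : borel circle => \sum_(0 <= i < N) jump n (x + tau i)).
  have j0 x : 0 <= jump n x by have /andP[] := jump01 n x.
  rewrite Ex_sum//.
  under eq_bigr do rewrite (circle_lebesgue_shift _ (@jump_continuous n) j0).
  by rewrite sumr_const_nat subn0 mulr_natl.
rewrite -(ler_pM2l NR) E; apply: Ex_le => //.
by apply: bounded_mfun_sum => i; exact: bt'.
Qed.

(* The graphs converge off the null set [E], by Borel-Cantelli. *)
Let bad n : set (borel circle) := [set x | 2^-1 ^+ n <= jump n x].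

Let bad_measurable n : measurable (bad n).
Proof.
rewrite (_ : bad n = (jump n : borel circle ->
  R) @^-1` `[2^-1 ^+ n, +oo[%classic).
  rewrite -[X in measurable X]setTI.
  exact: (jump_bounded n).1.
by apply/seteqP; split => x /=; rewrite /bad/= in_itv/= andbT.
Qed.

Let bad_measure n : (lambda (bad n) <= (2^-1 ^+ n)%:E)%E.
Proof.
have fin : lambda (bad n) \is a fin_num by exact: fin_num_measure.
rewrite -(fineK fin) lee_fin.
have -> : fine (lambda (bad n)) = Ex lambda (\1_(bad n)).
  by rewrite /Ex /Rintegral integral_indic// setIT.
apply: (@le_trans _ _ (Ex lambda (fun x => 2 ^+ n * (jump n x)))).
  apply: le_Ex; [split|exact: bounded_mfunZ|].
  - exact: measurable_indic.
  - by exists 1 => x; rewrite indicE; case: (_ \in _); rewrite ?normr1 ?normr0.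
  move=> x; rewrite indicE; have [|] := boolP (x \in bad n) => /=; last first.
    by rewrite mulr_ge0 ?exprn_ge0// mdist_ge0.
  by rewrite inE /bad/= exprVn -ler_pdivrMl ?exprn_gt0// mulr1.
rewrite ExZ// exprVn -ler_pdivlMl ?exprn_gt0//.
apply: le_trans (jump_mean n) _.
rewrite /eps -exprVn -exprMn le_eqVlt; apply/orP; left; apply/eqP;
  congr (_ ^+ n).
by field.
Qed.

Let E := lim_sup_set bad.

Let E_measurable : measurable E.
Proof.
apply: bigcap_measurable => // k _.
by apply: bigcup_measurable => j _; exact: bad_measurable.
Qed.

Let E_null : lambda E = 0%E.
Proof.
apply: lim_sup_set_cvg0 => //.
apply: (@le_lt_trans _ _ (\sum_(n <oo) (2^-1 ^+ n)%:E)%E).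
  by apply: lee_nneseries => // n _; exact: bad_measure.
have := @cvg_geometric_eseries_half R 2 0; rewrite expr0 divr1.
rewrite (_ : eseries _ = (fun N => \sum_(0 <= n < N) (2^-1 ^+ n)%:E)%E).
  by move/cvg_lim => ->//; rewrite ltry.
apply/funext => N; rewrite /eseries/=; apply: eq_bigr => k _; congr EFin.
by rewrite addn1 natrX exprS invfM mulrA divff// mul1r exprVn.
Qed.

Let gamma (x : circle) : circle :=
  if x \in E then 0 else lim ((fun n => gam n x) @ \oo).

Let gam_cvg x : ~ E x -> (fun n => gam n x) @ \oo --> gamma x.
Proof.
move=> Ex; rewrite /gamma memNset//.
have [n0 hn0] : exists n0, forall n, (n0 <= n)%N -> ~ bad n x.
  apply: contrapT => H; apply: Ex => n _; apply: contrapT => H2; apply: H.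
  by exists n => k nk bk; apply: H2; exists k.
apply: (@circle_seq_cvg R (fun n => gam n x) n0) => n n0n.
by rewrite ltW// ltNge; apply/negP; exact: hn0.
Qed.

Lemma graph_measurable :
  measurable_fun setT ((fun x => (x, gamma x)) : borel circle -> borel torus).
Proof.
pose g n (x : borel circle) : torus := if x \in E then (x, 0) else (x, gam n x).
apply: (@measurable_limit R _ (borel circle) torus g) => [n|x].
  apply: (@measurable_fun_ifT _ _ (borel circle) (borel torus)).
  - apply: (measurable_fun_bool true); rewrite setTI.
    rewrite (_ : _ @^-1` _ = E)//.
    by apply/seteqP; split => y /=; [move/set_mem|move/mem_set].
  - apply: continuous_borel.
    apply: (@lip_continuous R circle torus _ 1) => // u v.
    by rewrite torus_mdist ge_max mdistxx mul1r lexx mdist_ge0.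
  - apply: continuous_borel.
    have [L L1 hL] := ak_lip AK n.
    apply: (@lip_continuous R circle torus _ L) => [|u v]; first lra.
    by rewrite torus_mdist ge_max hL andbT ler_peMl ?mdist_ge0.
have [Ex|Ex] := pselect (E x).
  rewrite /g /gamma mem_set//; exact: cvg_cst.
rewrite /g memNset//=; apply: (@cvg_comp _ _ _ (fun n => gam n x)
  (fun y => (x, y) : torus) _ (nbhs (gamma x))); first exact: gam_cvg.
have pair_lip u v : mdist ((x, u) : torus) (x, v) <= 1 * mdist u v.
  by rewrite torus_mdist ge_max mdistxx mul1r lexx mdist_ge0.
exact: (lip_continuous ltr01 pair_lip).
Qed.

Lemma gamma_measurable : measurable_fun setT (gamma : borel circle ->
  borel circle).
Proof.
have c2 : continuous (snd : torus -> circle) by move=> p; exact: cvg_snd.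
exact: (measurableT_comp (continuous_borel c2) graph_measurable).
Qed.

Let graph : {mfun (borel circle) >-> (borel torus)} :=
  HB.pack ((fun x => (x, gamma x)) : borel circle -> borel torus)
    (isMeasurableFun.Build _ _ _ _ _ graph_measurable).

Definition graph_measure : probability (borel torus) R :=
  distribution lambda graph.

Let eps_cvg : eps R @ \oo --> 0.
Proof.
apply: halving_cvg0 => n; first exact: ltW (eps_gt0 R n).
by have := eps_gt0 R n; rewrite /eps exprS; move: (_ ^+ n) => z; lra.
Qed.

Let Ex_graph (f : torus -> R) : continuous f -> (forall p, 0 <= f p <= 1) ->
  (fun n => Ex lambda (fun x : borel circle => f (x, gam n x))) @ \oo -->
    Ex graph_measure (f : borel torus -> R).
Proof.
move=> cf f01.
have f0 p : 0 <= f p by have /andP[] := f01 p.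
rewrite Ex_distribution//; last exact: continuous_borel_real.
apply: (@Ex_cvg _ (borel circle) R lambda _ _ 1 E) => //.
- move=> n; have [L L1 hL] := ak_lip AK n.
  have c : continuous (fun x : circle => (x, gam n x) : torus).
    apply: (@lip_continuous R circle torus _ L) => [|u v]; first lra.
    by rewrite torus_mdist ge_max hL andbT ler_peMl ?mdist_ge0.
  exact: (measurableT_comp (continuous_borel_real cf) (continuous_borel c)).
- exact: (measurableT_comp (continuous_borel_real cf) graph_measurable).
- by move=> n x; have /andP[? ?] := f01 (x, gam n x); rewrite ger0_norm.
move=> x nE.
apply: (@cvg_comp _ _ _ (fun n => gam n x) (fun y =>
  f (x, y)) _ (nbhs (gamma x)));
  first exact: gam_cvg.
have pair_lip u v : mdist ((x, u) : torus) (x, v) <= 1 * mdist u v.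
  by rewrite torus_mdist ge_max mdistxx mul1r lexx mdist_ge0.
apply: (@continuous_comp _ _ _ (fun y => (x, y) : torus) f); last exact: cf.
exact: (lip_continuous ltr01 pair_lip).
Qed.

Let graph_fun_lip (f : torus -> R) L n : 0 <= L -> lip_real L f ->
  exists2 K, 0 <= K & lip_real K (fun x => f (x, gam n x)).
Proof.
move=> L0 fL; have [K K1 hK] := ak_lip AK n.
exists (L * K) => [|x y]; first by rewrite mulr_ge0//; lra.
apply: le_trans (fL _ _) _; rewrite -mulrA ler_wpM2l//.
by rewrite torus_mdist ge_max hK andbT ler_peMl ?mdist_ge0.
Qed.

Let phi_measurable : measurable_fun setT (phi : borel torus -> borel torus).
Proof. by apply: continuous_borel; exact: homeo_fun_continuous. Qed.

Lemma graph_measure_invariant (A : set (borel torus)) : measurable A ->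
  graph_measure (phi @^-1` A) = graph_measure A.
Proof.
pose Phi : {mfun (borel torus) >-> (borel torus)} :=
  HB.pack (phi : borel torus -> borel torus)
    (isMeasurableFun.Build _ _ _ _ _ phi_measurable).
move: A; apply: (@lip_determines R torus (distribution graph_measure Phi)) =>
  f L L0 fL f01.
have f0 p : 0 <= f p by have /andP[] := f01 p.
have cf := lip_real_continuous L0 fL.
have cfp : continuous (fun p => f (phi p)).
  by move=> p; apply: continuous_comp; [exact: homeo_fun_continuous|exact: cf].
rewrite Ex_distribution//; last exact: continuous_borel_real.
have h1 := Ex_graph cf f01.
have h2 := Ex_graph cfp (fun p => f01 (phi p)).
have [d d0 hd] := ak_near AK.
apply: norm_cvg_unique h2 _.
have bnd (u : circle -> torus) : continuous u ->
  bounded_mfun (fun x : borel circle => f (u x)).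
  move=> cu; apply: (bounded_continuous (C := 1)).
    by move=> x; apply: continuous_comp; [exact: cu|exact: cf].
  by move=> x; have /andP[? ?] := f01 (u x); rewrite ger0_norm.
have cg n : continuous (fun x : circle => (x, gam n x) : torus).
  have [K K1 hK] := ak_lip AK n.
  apply: (@lip_continuous R circle torus _ K) => [|u v]; first lra.
  by rewrite torus_mdist ge_max hK andbT ler_peMl ?mdist_ge0.
have close n : `|Ex lambda (fun x : borel circle => f (phi (x, gam n x))) -
    Ex lambda (fun x : borel circle => f (x, gam n x))| <= L * d n.
  have [K K0 gK] := graph_fun_lip n L0 fL.
  have <- : Ex lambda (fun x : borel circle =>
      f (x + pr (bt n), gam n (x + pr (bt n)))) =
      Ex lambda (fun x : borel circle => f (x, gam n x)).
    apply: (@circle_lebesgue_shift R (fun x => f (x, gam n x))) => //.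
    exact: lip_real_continuous gK.
  rewrite -[leRHS](Ex_cst lambda); apply: Ex_near.
  - apply: (bnd (fun x => phi (x, gam n x))) => x.
    by apply: (@continuous_comp _ _ _ (fun x => (x, gam n x) : torus) phi);
      [exact: cg|exact: homeo_fun_continuous].
  - apply: (bnd (fun x => (x + pr (bt n), gam n (x + pr (bt n))))) => x.
    by apply: (@continuous_comp _ _ _ (rotate (pr (bt n))) (fun x =>
      (x, gam n x) : torus));
      [exact: rotate_continuous|exact: cg].
  - exact: bounded_mfun_cst.
  - by move=> x; apply: le_trans (fL _ _) _; rewrite ler_wpM2l.
apply: (cvg_near_seq _ close h1).
rewrite -(mulr0 L); apply: cvgM; [exact: cvg_cst|exact: d0].
Qed.

Let dev_continuous n : continuous (fun p : torus => mdist p.2 (gam n p.1)).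
Proof.
have [L L1 hL] := ak_lip AK n.
apply: (@lip_real_continuous _ _ (1 + L)); first lra.
move=> p q.
have p1 : mdist p.1 q.1 <= mdist p q by rewrite torus_mdist le_max lexx.
have p2 : mdist p.2 q.2 <= mdist p q by rewrite torus_mdist le_max lexx orbT.
have h := hL p.1 q.1.
have h' : L * mdist p.1 q.1 <= L * mdist p q by rewrite ler_wpM2l//; lra.
have t1 := metric_triangle p.2 q.2 (gam n p.1).
have t2 := metric_triangle q.2 (gam n q.1) (gam n p.1).
have t3 := metric_triangle q.2 p.2 (gam n q.1).
have t4 := metric_triangle p.2 (gam n p.1) (gam n q.1).
rewrite (metric_sym q.2 p.2) in t3.
rewrite (metric_sym (gam n q.1) (gam n p.1)) in t2.
by rewrite mulrDl mul1r ler_norml; apply/andP; split; lra.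
Qed.

Section uniqueness.
Variables (m : nat) (nu : probability (borel torus) R).
Hypothesis m0 : (0 < m)%N.
Hypothesis nu_inv : forall A : set (borel torus), measurable A ->
  nu (iter m phi @^-1` A) = nu A.

Let iter_continuous' i : continuous (iter i phi : torus -> torus).
Proof. by apply: iter_continuous; exact: homeo_fun_continuous. Qed.

Let nu_iter i (f : torus -> R) : continuous f -> (forall p, 0 <= f p) ->
  Ex nu (fun p : borel torus => f (iter (m * i) phi p)) =
    Ex nu (f : borel torus -> R).
Proof.
move=> cf f0; rewrite mulnC.
have mh : measurable_fun setT (iter m phi : borel torus -> borel torus).
  exact: continuous_borel.
have E' : iter (i * m) phi = iter i (iter m phi) by apply/funext => p;
  rewrite iterM.
rewrite E'; apply: (@Ex_invariant _ _ (borel torus) nu (iter i (iter m phi)) f)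
  => //.
- by rewrite -E'; exact: continuous_borel.
- exact: iter_invariant.
- exact: continuous_borel_real.
Qed.

Let nu_fst (g : circle -> R) L : 0 <= L -> lip_real L g ->
  (forall x, 0 <= g x <= 1) ->
  Ex nu (fun p : borel torus => g p.1) = Ex lambda (g : borel circle -> R).
Proof.
move=> L0 gL g01; have g0 x : 0 <= g x by have /andP[] := g01 x.
have cg := lip_real_continuous L0 gL.
have c1 : continuous (fst : torus -> circle) by move=> p; exact: cvg_fst.
have cgt t : continuous (fun p : torus => g (p.1 + t)).
  move=> p; apply: (@continuous_comp _ _ _ fst (fun x => g (x + t)));
    first exact: c1.
  by apply: (@continuous_comp _ _ _ (rotate t) g);
    [exact: rotate_continuous|exact: cg].
have bgt t : bounded_mfun (fun p : borel torus => g (p.1 + t)).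
  apply: (bounded_continuous (C := 1)) => // p.
  by have /andP[? ?] := g01 (p.1 + t); rewrite ger0_norm.
have cg1 : continuous (fun p : torus => g p.1).
  by move=> p; apply: (@continuous_comp _ _ _ fst g); [exact: c1|exact: cg].
apply: (@invariant_average R _ (borel torus) nu fst g L) => //.
  exact: (continuous_borel c1).
move=> t; apply/eqP; rewrite -subr_eq0 -normr_le0; apply/ler_addgt0Pl => e e0.
rewrite addr0; have L1 : 0 < L + 1 by lra.
have eL : 0 < e / (L + 1) by rewrite divr_gt0.
have [n mn hn] := ex_eps_small m eL.
have [i] := ak_dense AK m0 (leqW mn) ((pr 0, pr 0) : torus) (t, pr 0).
rewrite torus_mdist ge_max => /andP[hi _].
rewrite (AK_iter_fst AK) -circle_projD add0r in hi.
rewrite -(nu_iter i cg1 (fun p => g0 p.1)).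
have -> : (fun p : borel torus => g (iter (m * i) phi p).1) =
    (fun p : borel torus => g (p.1 + pr ((m * i)%:R * alpha))).
  by apply/funext => p; rewrite (AK_iter_fst AK).
apply: (@le_trans _ _ (Ex nu (fun=> L * mdist t (pr ((m * i)%:R * alpha))))).
  apply: Ex_near => //; first exact: bounded_mfun_cst.
  move=> p; apply: le_trans (gL _ _) _.
  by rewrite !(addrC (p.1)) circle_mdistD.
rewrite Ex_cst; apply: (@le_trans _ _ ((L + 1) * (e / (L + 1)))).
  apply: ler_pM => //; first exact: mdist_ge0.
    by rewrite lerDl.
  by rewrite metric_sym (le_trans hi)// ltW.
by rewrite mulrCA divff ?mulr1// gt_eqF.
Qed.

Let sum_multiples (F : nat -> R) K : (forall i, 0 <= F i) ->
  \sum_(0 <= k < K) F (m * k)%N <= \sum_(0 <= i < m * K) F i.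
Proof.
move=> F0; elim: K => [|K IH]; first by rewrite muln0 !big_geq.
have -> : (m * K.+1 = m * K + m)%N by rewrite mulnS addnC.
rewrite big_nat_recr//= [leRHS](@big_cat_nat _ _ _ (m * K))//= ?leq_addr//.
apply: lerD => //; case: (m) m0 => // m' _.
rewrite big_ltn ?lerDl ?sumr_ge0//.
by rewrite -[X in (X < _)%N]addn0 ltn_add2l.
Qed.

(* An orbit of [iter m phi] is part of an orbit of [phi]; this costs a factor
   [m]. *)
Let nu_dev n : Ex nu (fun p : borel torus => mdist p.2 (gam n p.1)) <=
  m%:R * eps R n.
Proof.
have [N N0 hN] := AK_mean_sum AK n.
pose F (p : torus) : R := mdist p.2 (gam n p.1).
have F0 p : 0 <= F p by exact: mdist_ge0.
have cF : continuous F by exact: dev_continuous.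
have bF i : bounded_mfun (fun p : borel torus => F (iter i phi p)).
  apply: (bounded_continuous (C := 1)).
    by move=> p; apply: (@continuous_comp _ _ _ (iter i phi) F);
      [exact: iter_continuous'|exact: cF].
  by move=> p; rewrite ger0_norm// circle_mdist_le1.
have mean K : K%:R * Ex nu (F : borel torus ->
  R) <= (m * K)%:R * eps R n + N%:R.
  have -> : K%:R * Ex nu (F : borel torus -> R) =
      Ex nu (fun p : borel torus => \sum_(0 <= k < K) F (iter (m * k) phi p)).
    rewrite (@Ex_sum _ _ _ nu K (fun k p => F (iter (m * k) phi p)));
      last first.
      by move=> k; exact: bF.
    under eq_bigr do rewrite nu_iter//.
    by rewrite sumr_const_nat subn0 mulr_natl.
  apply: Ex_le; first by apply: bounded_mfun_sum => k; exact: bF.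
  move=> p; apply: le_trans (hN p (m * K)%N).
  exact: (@sum_multiples (fun i => F (iter i phi p))).
apply/ler_addgt0Pl => e e0; have [K K0 hK] := ex_nat_ge (N%:R / e).
have KR : 0 < K%:R :> R by rewrite ltr0n.
rewrite -(ler_pM2l KR); apply: le_trans (mean K) _.
rewrite mulrDr natrM addrC mulrA (mulrC m%:R) lerD2r.
by rewrite -ler_pdivrMr.
Qed.

Lemma graph_measure_unique (A : set (borel torus)) : measurable A ->
  nu A = graph_measure A.
Proof.
move: A; apply: (@lip_determines R torus) => f L L0 fL f01.
have f0 p : 0 <= f p by have /andP[] := f01 p.
have cf := lip_real_continuous L0 fL.
have c1 : continuous (fst : torus -> circle) by move=> p; exact: cvg_fst.
have bdev n : bounded_mfun (fun p : borel torus => mdist p.2 (gam n p.1)).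
  apply: (bounded_continuous (C := 1)) => [|p]; first exact: dev_continuous.
  by rewrite ger0_norm ?mdist_ge0// circle_mdist_le1.
have close n : `|Ex lambda (fun x : borel circle => f (x, gam n x)) -
    Ex nu (f : borel torus -> R)| <= L * (m%:R * eps R n).
  have [K K0 gK] := graph_fun_lip n L0 fL.
  have cg := lip_real_continuous K0 gK.
  rewrite -(nu_fst K0 gK)// distrC.
  apply: (@le_trans _ _ (Ex nu (fun p : borel torus =>
    L * mdist p.2 (gam n p.1)))).
    apply: Ex_near.
    - by apply: (bounded_continuous (C := 1)) => // p; rewrite ger0_norm//;
        have /andP[] := f01 p.
    - apply: (bounded_continuous (C := 1)) => [p|p].
        by apply: (@continuous_comp _ _ _ fst (fun x => f (x, gam n x)));
          [exact: c1|exact: cg].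
      by rewrite ger0_norm//; have /andP[] := f01 (p.1, gam n p.1).
    - exact: bounded_mfunZ.
    - move=> [x y]; apply: le_trans (fL _ _) _; rewrite ler_wpM2l//.
      by rewrite torus_mdist ge_max mdistxx mdist_ge0 lexx.
  by rewrite ExZ// ler_wpM2l// nu_dev.
apply/esym; apply: norm_cvg_unique (Ex_graph cf f01) _.
apply: (cvg_near_seq _ close); last exact: cvg_cst.
rewrite -(mulr0 L); apply: cvgM; first exact: cvg_cst.
by rewrite -(mulr0 m%:R); apply: cvgM; [exact: cvg_cst|exact: eps_cvg].
Qed.

End uniqueness.

End limit_measure.

Theorem theorem1p1 (R : realType) :
  exists phi : homeo (torus2 R),
    torus_diffeo phi /\
    exists alpha : R,
      [/\ irrational alpha /\ skew_product_over alpha phi,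
          [/\ totally_strictly_ergodic (torus2_tds phi),
              mean_equicontinuous (torus2_tds phi) &
              max_equicontinuous_factor
                (fst : torus2_tds phi -> rotation_tds alpha)] &
          exists mu : probability (borel (torus2_tds phi)) R,
            unique_invariant mu /\
            exists gamma : borel (circle R) -> borel (circle R),
              measurable_fun setT gamma /\
              forall A : set (borel (torus2_tds phi)), measurable A ->
                mu A = pushforward (@circle_lebesgue R)
                  ((fun x => (x, gamma x)) :
                     borel (circle R) -> borel (torus2 R)) A].
Proof.
have [phi [alpha [gam [bt AK]]]] := anosov_katok_exists R.
have inv m (A : set (borel (torus2 R))) : measurable A ->
    graph_measure AK (iter m phi @^-1` A) = graph_measure AK A.
  apply: (@iter_invariant R _ (borel (torus2 R)) (graph_measure AK)).
    by apply: continuous_borel; exact: homeo_fun_continuous.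
  exact: graph_measure_invariant.
exists phi; split; first exact: ak_diffeo AK.
exists alpha; split.
- by split; [exact: ak_irrational AK|exact: ak_skew AK].
- split; [|exact: AK_mean_equicontinuous AK|exact: AK_max_factor AK].
  move=> m m0; split; first exact: (AK_minimal AK m0).
  exists (graph_measure AK); split; first exact: inv.
  by move=> nu nu_inv A mA; exact: (graph_measure_unique AK m0 nu_inv).
- exists (graph_measure AK); split.
    split; first exact: (inv 1%N).
    move=> nu nu_inv A mA.
    exact: (graph_measure_unique AK (ltn0Sn 0) nu_inv).
  by eexists; split; [exact: (gamma_measurable AK)|].
Qed.
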